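(* Let $N\in\mathbb{N}$, $N\ge 1$, $\alpha\in(0,N)$ and $V\in L^\infty(\mathbb{R}^N)$. Assume that $$\liminf_{|x|\to\infty} V(x)\ge 1 .$$ If $c_*<c_\infty$, then the infimum $c_*$ is achieved, and every minimizing sequence for $c_*$ converges, up to a subsequence, strongly in $H^1(\mathbb{R}^N)$.
   Context: All functions are real-valued. $I_\alpha:\mathbb{R}^N\setminus\{0\}\to\mathbb{R}$ is the Riesz potential of order $\alpha\in(0,N)$, $$I_\alpha(x)=\frac{\Gamma(\frac{N-\alpha}{2})}{2^{\alpha}\pi^{N/2}\Gamma(\frac{\alpha}{2})\,|x|^{N-\alpha}} .$$ For $u\in L^2(\mathbb{R}^N)$ put $$D(u)=\int_{\mathbb{R}^N}\bigl(I_\alpha*|u|^{\frac{\alpha}{N}+1}\bigr)|u|^{\frac{\alpha}{N}+1},$$ which is finite by the Hardy-Littlewood-Sobolev inequality. Define $$c_\infty=\inf\Bigl\{\int_{\mathbb{R}^N}|u|^2 : u\in L^2(\mathbb{R}^N),\ D(u)=1\Bigr\}>0,$$ $$c_*=\inf\Bigl\{\int_{\mathbb{R}^N}|\nabla u|^2+V|u|^2 : u\in H^1(\mathbb{R}^N),\ D(u)=1\Bigr\}.$$ The infimum $c_*$ is achieved if there is $u\in H^1(\mathbb{R}^N)$ with $D(u)=1$ and $\int_{\mathbb{R}^N}|\nabla u|^2+V|u|^2=c_*$. A minimizing sequence for $c_*$ is a sequence $(u_n)$ in $H^1(\mathbb{R}^N)$ with $D(u_n)=1$ for all $n$ and $\int_{\mathbb{R}^N}|\nabla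 u_n|^2+V|u_n|^2\to c_*$. Since $V$ is defined almost everywhere, $\liminf_{|x|\to\infty}$ is understood in the essential sense. *)

(* Defs.v *)
From HB Require Import structures.
From mathcomp Require Import all_boot all_order all_algebra.
From mathcomp Require Import all_classical all_reals all_analysis ess_sup_inf.

Set Implicit Arguments.
Unset Strict Implicit.
Unset Printing Implicit Defensive.

Import Order.TTheory GRing.Theory Num.Theory.
Import numFieldNormedType.Exports.

Local Open Scope classical_set_scope.
Local Open Scope ring_scope.

(* [R^n] is ['rV[R]_n], with the sigma-algebra generated by the coordinate
   projections, that is, the Borel sigma-algebra.  As a consequence, elements
   of Lebesgue spaces are represented by Borel functions defined everywhere,
   not by classes of Lebesgue measurable functions. *)

Definition measure_rV_display : measure_display -> measure_display.
Proof. exact. Qed.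

Section measurable_rV.
Context {d} {T : sigmaRingType d}.
Variable n : nat.

Let coord : 'I_n -> 'rV[T]_n -> T := fun i x => x ord0 i.

Let rV_set0 : g_sigma_preimage coord set0.
Proof. exact: sigma_algebra0. Qed.

Let rV_setC A : g_sigma_preimage coord A -> g_sigma_preimage coord (~` A).
Proof. exact: sigma_algebraC. Qed.

Let rV_bigcup (F : _^nat) : (forall i, g_sigma_preimage coord (F i)) ->
  g_sigma_preimage coord (\bigcup_i (F i)).
Proof. exact: sigma_algebra_bigcup. Qed.

HB.instance Definition _ := @isMeasurable.Build (measure_rV_display d)
  'rV[T]_n (g_sigma_preimage coord) rV_set0 rV_setC rV_bigcup.

End measurable_rV.

Lemma measurable_coord d (T : sigmaRingType d) n (i : 'I_n) :
  measurable_fun [set: 'rV[T]_n] (fun x => x ord0 i).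
Proof.
move=> _ Y mY; rewrite setTI; apply: sub_sigma_algebra => /=.
rewrite -bigcup_seq/=; exists i => /=; first by rewrite mem_index_enum.
by exists Y => //; rewrite setTI.
Qed.

Lemma measurable_fun_rV d1 d2 (T1 : measurableType d1) (T2 : measurableType d2)
    n (f : T1 -> 'rV[T2]_n) :
  (forall i, measurable_fun [set: T1] (fun x => f x ord0 i)) ->
  measurable_fun [set: T1] f.
Proof.
move=> mf _ A; rewrite setTI.
suff: @measurable _ 'rV[T2]_n `<=` [set B | measurable (f @^-1` B)] by exact.
apply: smallest_sub.
  split => [|B|F] /=.
  - by rewrite preimage_set0.
  - by move=> mB; rewrite setTD preimage_setC; exact: measurableC.
  - by move=> mF; rewrite preimage_bigcup; exact: bigcup_measurable.
rewrite -bigcup_seq/= => B [i _ [C mC <-]] /=.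
by have := mf i measurableT C mC; rewrite !setTI.
Qed.

Section lebesgue_rV.
Context {R : realType}.

Section step.
Context n (mu : {sigma_finite_measure set 'rV[R]_n -> \bar R}).

Definition cons_rV (p : measurableTypeR R * 'rV[R]_n) : 'rV[R]_n.+1 :=
  row_mx (const_mx p.1 : 'rV_1) p.2.

Lemma cons_rV0 p : cons_rV p ord0 ord0 = p.1.
Proof.
by rewrite mxE; case: splitP => // j _; rewrite mxE.
Qed.

Lemma cons_rVS p i : cons_rV p ord0 (lift ord0 i) = p.2 ord0 i.
Proof.
rewrite mxE; case: splitP => [j|j] /=; first by rewrite ord1.
by move=> [ij]; congr (p.2 _ _); exact/val_inj.
Qed.

Lemma measurable_cons_rV : measurable_fun [set: measurableTypeR R * 'rV[R]_n] cons_rV.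
Proof.
apply: measurable_fun_rV => i; have [j ->|->] := unliftP ord0 i.
  rewrite (_ : (fun _ => _) = (fun x : 'rV[R]_n => x ord0 j) \o snd).
    by apply: measurableT_comp => //; exact: measurable_coord.
  by apply/funext => p; rewrite cons_rVS.
rewrite (_ : (fun _ => _) = fst) //.
by apply/funext => p; rewrite cons_rV0.
Qed.

Definition lebesgue_cons : set 'rV[R]_n.+1 -> \bar R :=
  pushforward (lebesgue_measure \x mu)%E cons_rV.

Let lebesgue_cons0 : lebesgue_cons set0 = 0%E.
Proof. by rewrite /lebesgue_cons /pushforward preimage_set0 measure0. Qed.

Let lebesgue_cons_ge0 A : (0 <= lebesgue_cons A)%E.
Proof. by rewrite /lebesgue_cons /pushforward measure_ge0. Qed.

Let lebesgue_cons_sigma_additive : semi_sigma_additive lebesgue_cons.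
Proof.
move=> F mF tF mUF; rewrite /lebesgue_cons /pushforward preimage_bigcup.
apply: measure_semi_sigma_additive.
- by move=> k; rewrite -[X in measurable X]setTI; exact: measurable_cons_rV.
- apply/trivIsetP => /= i j _ _ ij; rewrite -preimage_setI.
  by move/trivIsetP : tF => /(_ _ _ _ _ ij) ->//; rewrite preimage_set0.
- rewrite -preimage_bigcup -[X in measurable X]setTI.
  exact: measurable_cons_rV.
Qed.

HB.instance Definition _ := isMeasure.Build _ _ _ lebesgue_cons
  lebesgue_cons0 lebesgue_cons_ge0 lebesgue_cons_sigma_additive.

Let lebesgue_cons_sigma_finite : sigma_finite setT lebesgue_cons.
Proof.
have /sigma_finiteP[F [TF ndF Foo]] := sigma_finiteT (@lebesgue_measure R).
have /sigma_finiteP[G [TG ndG Goo]] := sigma_finiteT mu.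
pose g (x : 'rV[R]_n.+1) : measurableTypeR R * 'rV[R]_n :=
  (x ord0 ord0, \row_i x ord0 (lift ord0 i)).
have mg : measurable_fun setT g.
  apply: measurable_fun_pair; first exact: measurable_coord.
  apply: measurable_fun_rV => i; under eq_fun do rewrite mxE.
  exact: measurable_coord.
have consK : cancel cons_rV g.
  move=> [a x]; rewrite /g cons_rV0; congr pair.
  by apply/rowP => i; rewrite mxE cons_rVS.
exists (fun k => g @^-1` (F k `*` G k)).
  apply/seteqP; split => // x _.
  have [i _ Fi] : (\bigcup_i F i) (g x).1 by rewrite -TF.
  have [j _ Gj] : (\bigcup_j G j) (g x).2 by rewrite -TG.
  exists (maxn i j) => //; split.
    by move: Fi; exact/subsetPset/ndF/leq_maxl.
  by move: Gj; exact/subsetPset/ndG/leq_maxr.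
move=> k; have [mF Fk] := Foo k; have [mG Gk] := Goo k; split.
  by rewrite -[X in measurable X]setTI; apply: mg => //; exact: measurableX.
rewrite /lebesgue_cons /pushforward -comp_preimage.
rewrite (_ : g \o cons_rV = id); last by apply/funext => p /=; rewrite consK.
by rewrite preimage_id product_measure1E// lte_mul_pinfty// ge0_fin_numE.
Qed.

HB.instance Definition _ := Measure_isSigmaFinite.Build _ _ _ lebesgue_cons
  lebesgue_cons_sigma_finite.

End step.

Fixpoint lebesgue_rV n : {sigma_finite_measure set 'rV[R]_n -> \bar R} :=
  if n is m.+1 then lebesgue_cons (lebesgue_rV m)
  else \d_(0 : 'rV[R]_0).

End lebesgue_rV.

Lemma lebesgue_rV_box {R : realType} n (A : 'I_n -> set R) :
  (forall i, measurable (A i)) ->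
  (lebesgue_rV n [set x | forall i, A i (x ord0 i)] =
   \prod_(i < n) lebesgue_measure (A i))%E.
Proof.
elim: n A => [|n IHn] A mA.
  by rewrite big_ord0 /= diracE mem_set// => -[].
have mB : measurable [set x : 'rV[R]_n | forall i, A (lift ord0 i) (x ord0 i)].
  rewrite [X in measurable X](_ : _ = \bigcap_(i in [set: 'I_n])
      ((fun x : 'rV[R]_n => x ord0 i) @^-1` A (lift ord0 i))); last first.
    by apply/seteqP; split => [x /= Ax i _|x /= Ax i]; exact: Ax.
  apply: fin_bigcap_measurable => // i _.
  by rewrite -[X in measurable X]setTI; exact: measurable_coord.
rewrite big_ord_recl -IHn// -product_measure1E; [|exact: mA|exact: mB].
rewrite /= /lebesgue_cons /pushforward; congr product_measure1.
apply/seteqP; split => [[a x] /= Ax|[a x] /= [Aa Ax] i].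
  split => [|i]; first by have := Ax ord0; rewrite cons_rV0.
  by have := Ax (lift ord0 i); rewrite cons_rVS.
have [j ->|->] := unliftP ord0 i; last by rewrite cons_rV0.
by rewrite cons_rVS; exact: Ax.
Qed.

Section choquard.
Context {R : realType}.
Local Notation leb := (@lebesgue_rV R _).

Definition Gamma (s : R) : R :=
  (\int[lebesgue_measure]_(t in `]0, +oo[) (t `^ (s - 1) * expR (- t)))%R.

(* The norm [`|x|] of ['rV[R]_n] is the maximum norm. *)
Definition enorm n (x : 'rV[R]_n) : R := Num.sqrt (\sum_i x ord0 i ^+ 2).

(* The division by zero makes [riesz alpha 0 = 0]; the value at the origin is
   irrelevant, as [riesz alpha] is only ever integrated. *)
Definition riesz n (alpha : R) (x : 'rV[R]_n) : R :=
  Gamma ((n%:R - alpha) / 2) /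
  (2 `^ alpha * pi `^ (n%:R / 2) * Gamma (alpha / 2) *
   enorm x `^ (n%:R - alpha)).

Definition convolution n (f g : 'rV[R]_n -> R) (x : 'rV[R]_n) : \bar R :=
  (\int[leb]_y (f (x - y) * g y)%:E)%E.

(* The integrands are nonnegative, so that the value is always meaningful in
   [0, +oo]. *)
Definition choquard n (alpha : R) (u : 'rV[R]_n -> R) : \bar R :=
  let f x := `|u x| `^ (alpha / n%:R + 1) in
  (\int[leb]_x (convolution (riesz alpha) f x * (f x)%:E))%E.

Definition L2 n : set ('rV[R]_n -> R) := [set u | u \in Lfun leb 2%:E].

Definition partial n (i : 'I_n) (f : 'rV[R]_n -> R) : 'rV[R]_n -> R :=
  fun x => 'D_(delta_mx ord0 i) f x.

Definition smooth n (f : 'rV[R]_n -> R) : Prop :=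
  forall s : seq 'I_n, let g := foldr (@partial n) f s in
    continuous g /\ forall i x, derivable g x (delta_mx ord0 i).

Definition test_function n : set ('rV[R]_n -> R) :=
  [set f | smooth f /\ compact (closure [set x | f x != 0])].

Definition is_weak_partial n (i : 'I_n) (u g : 'rV[R]_n -> R) : Prop :=
  forall f, test_function f ->
    (\int[leb]_x (u x * partial i f x))%R = - (\int[leb]_x (g x * f x))%R.

Definition H1 n : set ('rV[R]_n -> R) :=
  [set u | L2 u /\ forall i, exists2 g, L2 g & is_weak_partial i u g].

(* Weak derivatives are unique up to a null set; this picks a representative
   when [u] is in [H1]. *)
Definition weak_partial n (i : 'I_n) (u : 'rV[R]_n -> R) : 'rV[R]_n -> R :=
  xget (fun=> 0) [set g | L2 g /\ is_weak_partial i u g].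

Definition weak_grad_sqr n (u : 'rV[R]_n -> R) (x : 'rV[R]_n) : R :=
  \sum_i weak_partial i u x ^+ 2.

Definition H1norm n (u : 'rV[R]_n -> R) : \bar R :=
  ((\int[leb]_x (weak_grad_sqr u x + u x ^+ 2)%:E) `^ 2^-1)%E.

Definition c_infty n (alpha : R) : \bar R :=
  ereal_inf [set (\int[leb]_x (`|u x| ^+ 2)%:E)%E |
    u in [set u : 'rV[R]_n -> R | L2 u /\ choquard alpha u = 1%E]].

Definition energy n (V u : 'rV[R]_n -> R) : \bar R :=
  (\int[leb]_x (weak_grad_sqr u x + V x * `|u x| ^+ 2)%:E)%E.

Definition admissible n (alpha : R) : set ('rV[R]_n -> R) :=
  [set u | H1 u /\ choquard alpha u = 1%E].

Definition c_star n (alpha : R) (V : 'rV[R]_n -> R) : \bar R :=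
  ereal_inf [set energy V u | u in admissible alpha].

Definition c_star_achieved n (alpha : R) (V : 'rV[R]_n -> R) : Prop :=
  exists2 u, admissible alpha u & energy V u = c_star alpha V.

Definition minimizing_sequence n (alpha : R) (V : 'rV[R]_n -> R)
    (u_ : nat -> 'rV[R]_n -> R) : Prop :=
  (forall k, admissible alpha (u_ k)) /\
  energy V (u_ k) @[k --> \oo] --> c_star alpha V.

(* The essential infimum of [V] over [{x | r < |x|}], in the limit of large
   [r]: it is nondecreasing in [r]. *)
Definition ess_liminf_infty n (V : 'rV[R]_n -> R) : \bar R :=
  ereal_sup (range (fun r : R =>
    ess_inf leb (fun x => if r < enorm x then (V x)%:E else +oo%E))).

End choquard.

(* Main.v *)
Require Import Defs.
From HB Require Import structures.
From mathcomp Require Import all_boot all_order all_algebra.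
From mathcomp Require Import all_classical all_reals all_analysis.
From mathcomp Require Import measurable_realfun ess_sup_inf.
From mathcomp Require Import ring lra.

Set Implicit Arguments.
Unset Strict Implicit.
Unset Printing Implicit Defensive.

Import Order.TTheory GRing.Theory Num.Theory.
Import numFieldNormedType.Exports.

Local Open Scope classical_set_scope.
Local Open Scope ring_scope.

(** Put [p = alpha / N + 1] and let [D] denote the Choquard term.  A minimizing
    sequence [u_m] is bounded in H^1.  Along an ultrafilter finer than the filter
    at infinity it converges weakly to some [u], and [v_m = u_m - u] converges to
    0 in L^2 on every cube (Rellich).  The energy splits, so that [v_m] carries
    the energy [c_star - E(u)], which is at least [a = lim |v_m|_2^2] because
    [V >= 1 - e] outside a cube.  Splitting [D] in the same way gives
    [1 <= D(u) + (a / c)^p] for every [c <= c_infty], while homogeneity gives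
    [E(u) >= c_star D(u)^(1/p)].  If [0 <= c_star < c], then with
    [s = D(u)^(1/p)] these give [1 <= s^p + (c_star / c)^p (1 - s)^p], which
    forces [s = 1] as [c_star / c < 1]; if [c_star < 0], then [s = 1] already
    follows from homogeneity and [E(u) <= c_star].  Hence [u] is a minimizer,
    [a = 0], and [v_m] tends to 0 in H^1.

    The Hardy-Littlewood-Sobolev inequality is only needed when [c_infty > 0],
    where it follows from the definition of [c_infty] by scaling; neither the
    values of the Gamma function nor the sharp form of the kernel matter. *)

(** * Square-integrable functions *)

Section L2.
Context d (T : measurableType d) (R : realType) (mu : {measure set T -> \bar R}).
Implicit Types f g h : T -> R.

(** The obstacle is the interaction of [u] with the part of [v_m] that escapes to infinity. There
    only an L^2 bound on [v_m] is known, so the interaction must be small uniformly over an L^2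
    ball. This comes from superposing two competitors with disjoint supports far away: the
    interaction has degree [p < 2] in the competitor, the squared norm has degree 2, so the
    superposition would beat any positive optimal bound. The splitting of [D] is then proved as an
    upper bound only, which is the direction that the comparison with [c_star] uses.

    Along an ultrafilter the pairings with all functions of L^2 converge at once, and the Riesz
    representation turns their limits into a function. Rellich rests on a translation estimate for
    weak derivatives: a difference of translates of a tensor product is the partial derivative of
    another tensor product, so the definition of the weak derivative can be tested with it directly.
    Tensor products are enough because they approximate indicators of boxes, and boxes determine a
    measure. *)

Definition sqi f : Prop :=
  measurable_fun setT f /\ (\int[mu]_x (f x ^+ 2)%:E < +oo)%E.

Lemma Lfun2P f : f \in Lfun mu 2%:E <-> sqi f.
Proof.
split => [Lf|[mf fi]].
  split.
    by move: Lf; rewrite inE => /andP[/[!inE] ].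
  have /integrableP[_] := Lfun2_integrable_sqr Lf.
  under eq_integral => x _ do rewrite /= ger0_norm ?sqr_ge0//.
  by [].
rewrite inE; apply/andP; split; rewrite inE//=.
rewrite /finite_norm unlock /Lnorm.
apply: poweR_lty.
under eq_integral => x _ do rewrite /= powR_mulrn// real_normK ?num_real//.
by [].
Qed.

(** [ip] is total: [fine] sends an infinite integral to 0. Hence [ipC] and [ip_ge0] hold for all
    functions, while additivity asks for [sqi] arguments. *)
Definition ip f g : R := (\int[mu]_x (f x * g x))%R.

Lemma sqi_integrable f g : sqi f -> sqi g ->
  mu.-integrable setT (EFin \o (fun x => f x * g x)).
Proof.
by move=> /Lfun2P ff /Lfun2P fg; apply/Lfun1_integrable; exact: Lfun2_mul_Lfun1.
Qed.

Lemma sqi_bound f g : measurable_fun setT f -> sqi g ->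
  (forall x, f x ^+ 2 <= g x ^+ 2) -> sqi f.
Proof.
move=> mf [mg gi] fg; split => //; apply: le_lt_trans gi.
apply: ge0_le_integral => //.
- by move=> x _; rewrite lee_fin sqr_ge0.
- by apply/measurable_EFinP; exact: measurable_funX.
- by apply/measurable_EFinP; exact: measurable_funX.
- by move=> x _; rewrite lee_fin.
Qed.

Lemma sqi0 : sqi (fun=> 0).
Proof.
split => //; under eq_integral do rewrite expr0n/=.
by rewrite integral0.
Qed.

Lemma sqiZ a f : sqi f -> sqi (fun x => a * f x).
Proof.
move=> [mf fi]; split; first exact: measurable_funM.
under eq_integral do rewrite exprMn EFinM.
rewrite ge0_integralZl//.
- by apply: lte_mul_pinfty => //; rewrite lee_fin sqr_ge0.
- by apply/measurable_EFinP; exact: measurable_funX.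
- by move=> x _; rewrite lee_fin sqr_ge0.
- by rewrite lee_fin sqr_ge0.
Qed.

Lemma sqiD f g : sqi f -> sqi g -> sqi (fun x => f x + g x).
Proof.
move=> sf sg; have [mf fi] := sf; have [mg gi] := sg.
split; first exact: measurable_funD.
apply: (@le_lt_trans _ _
  (\int[mu]_x ((2 * f x ^+ 2)%:E + (2 * g x ^+ 2)%:E))%E).
  apply: ge0_le_integral => //.
  - by move=> x _; rewrite lee_fin sqr_ge0.
  - by apply/measurable_EFinP; apply: measurable_funX; exact: measurable_funD.
  - apply: emeasurable_funD; apply/measurable_EFinP; apply: measurable_funM => //;
      exact: measurable_funX.
  - move=> x _; rewrite -EFinD lee_fin.
    have : 0 <= (f x - g x) ^+ 2 by exact: sqr_ge0.
    nra.
rewrite ge0_integralD//; last 4 first.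
- by move=> x _; rewrite lee_fin mulr_ge0 ?sqr_ge0.
- by apply/measurable_EFinP; apply: measurable_funM => //; exact: measurable_funX.
- by move=> x _; rewrite lee_fin mulr_ge0 ?sqr_ge0.
- by apply/measurable_EFinP; apply: measurable_funM => //; exact: measurable_funX.
have H h : sqi h -> (\int[mu]_x (2 * h x ^+ 2)%:E < +oo)%E.
  move=> sh; have [_] := sqiZ (Num.sqrt 2) sh.
  by under eq_integral do rewrite exprMn sqr_sqrtr//.
by apply: lte_add_pinfty; exact: H.
Qed.

Lemma sqiB f g : sqi f -> sqi g -> sqi (fun x => f x - g x).
Proof.
move=> sf sg; have := sqiD sf (sqiZ (-1) sg).
by under eq_fun do rewrite mulN1r.
Qed.

Lemma ipC f g : ip f g = ip g f.
Proof. by apply: eq_Rintegral => x _; rewrite mulrC. Qed.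

Lemma ipDl f g h : sqi f -> sqi g -> sqi h ->
  ip (fun x => f x + g x) h = ip f h + ip g h.
Proof.
move=> sf sg sh; rewrite /ip -RintegralD//; [|exact: sqi_integrable..].
by apply: eq_Rintegral => x _; rewrite mulrDl.
Qed.

Lemma ipZl a f h : sqi f -> sqi h -> ip (fun x => a * f x) h = a * ip f h.
Proof.
move=> sf sh; rewrite /ip -RintegralZl//; [|exact: sqi_integrable..].
by apply: eq_Rintegral => x _; rewrite mulrA.
Qed.

Lemma ipBl f g h : sqi f -> sqi g -> sqi h ->
  ip (fun x => f x - g x) h = ip f h - ip g h.
Proof.
move=> sf sg sh; rewrite /ip -RintegralB//; [|exact: sqi_integrable..].
by apply: eq_Rintegral => x _; rewrite mulrBl.
Qed.

Lemma ipDr f g h : sqi f -> sqi g -> sqi h ->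
  ip h (fun x => f x + g x) = ip h f + ip h g.
Proof. by move=> *; rewrite ipC ipDl// ![ip _ h]ipC. Qed.

Lemma ipZr a f h : sqi f -> sqi h -> ip h (fun x => a * f x) = a * ip h f.
Proof. by move=> *; rewrite ipC ipZl// ipC. Qed.

Lemma ipBr f g h : sqi f -> sqi g -> sqi h ->
  ip h (fun x => f x - g x) = ip h f - ip h g.
Proof. by move=> *; rewrite ipC ipBl// ![ip _ h]ipC. Qed.

Lemma ip_ge0 f : 0 <= ip f f.
Proof. by apply: Rintegral_ge0 => x _; rewrite -expr2 sqr_ge0. Qed.

Lemma ipE f g : sqi f -> sqi g -> (\int[mu]_x (f x * g x)%:E = (ip f g)%:E)%E.
Proof.
move=> sf sg; rewrite /ip /Rintegral fineK//.
by apply: integrable_fin_num => //; exact: sqi_integrable.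
Qed.

Lemma sqr_ipE f : sqi f -> (\int[mu]_x (f x ^+ 2)%:E = (ip f f)%:E)%E.
Proof. by move=> sf; rewrite -ipE//; apply: eq_integral => x _; rewrite expr2. Qed.

Lemma ip_sqrD f g : sqi f -> sqi g ->
  ip (fun x => f x + g x) (fun x => f x + g x) = ip f f + 2 * ip f g + ip g g.
Proof.
move=> sf sg; rewrite ipDl ?ipDr//; [|exact: sqiD..].
by rewrite (ipC g f); ring.
Qed.

Lemma ip_sqrB f g : sqi f -> sqi g ->
  ip (fun x => f x - g x) (fun x => f x - g x) = ip f f - 2 * ip f g + ip g g.
Proof.
move=> sf sg; rewrite ipBl ?ipBr//; [|exact: sqiB..].
by rewrite (ipC g f); ring.
Qed.

Lemma ip_sqrZ a f : sqi f ->
  ip (fun x => a * f x) (fun x => a * f x) = a ^+ 2 * ip f f.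
Proof. by move=> sf; rewrite ipZl ?ipZr ?mulrA//; exact: sqiZ. Qed.

Lemma ip_sqrD_le f g : sqi f -> sqi g ->
  ip (fun x => f x + g x) (fun x => f x + g x) <= 2 * (ip f f + ip g g).
Proof.
move=> sf sg; have := ip_ge0 (fun x => f x - g x).
by rewrite (ip_sqrD sf sg) (ip_sqrB sf sg); lra.
Qed.

Lemma sqi_norm f : sqi f -> sqi (fun x => `|f x|).
Proof.
move=> sf; have [mf _] := sf; apply: (sqi_bound _ sf); first exact: measurableT_comp.
by move=> x; rewrite real_normK ?num_real.
Qed.

Lemma ip_norm f : ip (fun x => `|f x|) (fun x => `|f x|) = ip f f.
Proof. by apply: eq_Rintegral => x _; rewrite -!expr2 real_normK ?num_real. Qed.

(** The quadratic polynomial [t -> |f + t g|^2] is nonnegative; it is evaluated at its minimiser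
    [- ip f g / ip g g]. *)
Lemma cauchy_schwarz f g : sqi f -> sqi g -> ip f g ^+ 2 <= ip f f * ip g g.
Proof.
move=> sf sg.
have H t : 0 <= ip f f + 2 * (t * ip f g) + t ^+ 2 * ip g g.
  rewrite -ipZr// -ip_sqrZ// -ip_sqrD//; [exact: ip_ge0|exact: sqiZ].
have := ip_ge0 g; rewrite le_eqVlt => /predU1P[g0|g0].
  have [->|fg0] := eqVneq (ip f g) 0; first by rewrite expr0n/= -g0 mulr0.
  (* With [ip g g = 0] the polynomial is affine, and this [t] would give it the value -1. *)
  have := H (- (ip f f + 1) / (2 * ip f g)).
  rewrite -g0 mulr0 addr0.
  have -> : 2 * (- (ip f f + 1) / (2 * ip f g) * ip f g) = - (ip f f + 1).
    by field.
  lra.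
have := H (- ip f g / ip g g).
have -> : ip f f + 2 * (- ip f g / ip g g * ip f g) + (- ip f g / ip g g) ^+ 2 * ip g g
  = ip f f - ip f g ^+ 2 / ip g g by field; rewrite gt_eqF.
by rewrite subr_ge0 ler_pdivrMr.
Qed.

Lemma ae_ip f f' g g' : sqi f -> sqi f' -> sqi g -> sqi g' ->
  f = f' %[ae mu] -> g = g' %[ae mu] -> ip f g = ip f' g'.
Proof.
move=> sf sf' sg sg' ff' gg'; rewrite /ip /Rintegral; congr fine.
apply: ae_eq_integral => //.
- by apply/measurable_EFinP; apply: measurable_funM; [case: sf|case: sg].
- by apply/measurable_EFinP; apply: measurable_funM; [case: sf'|case: sg'].
- by move: ff' gg'; apply: filterS2 => x /= fx gx _; rewrite fx// gx.
Qed.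

Lemma fatou_le (g_ : nat -> T -> \bar R) (g : T -> \bar R) (C : \bar R) :
  (forall n, measurable_fun setT (g_ n)) -> (forall n x, (0 <= g_ n x)%E) ->
  measurable_fun setT g -> (\forall x \ae mu, g_ n x @[n --> \oo] --> g x) ->
  (\forall n \near \oo, (\int[mu]_x g_ n x <= C)%E) -> (\int[mu]_x g x <= C)%E.
Proof.
move=> mg g0 mg' gg gC.
have -> : (\int[mu]_x g x = \int[mu]_x (limn_einf (g_^~ x)))%E.
  apply: ae_eq_integral => //; first by apply: measurableT_comp => //;
    apply: measurable_fun_limn_esup => n; exact: measurableT_comp.
  apply: filterS gg => x gx _ /=.
  by have /cvg_limn_einf_sup[->] := gx.
apply: le_trans (fatou mu measurableT mg (fun n x _ => g0 n x)) _.
rewrite limn_einf_lim; apply: lime_le; first exact: is_cvg_einfs.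
near=> n; apply: (@le_trans _ _ (\int[mu]_x g_ n x)%E); last by near: n.
by apply: ereal_inf_lbound; exists n => //=.
Unshelve. all: by end_near. Qed.

(** The sum of the [h_ n] has integral at most 2, so it is finite almost everywhere, and it
    dominates every term. A weight put into [h_] thus becomes a pointwise rate of decay. *)
Lemma ae_geo (h_ : nat -> T -> \bar R) :
  (forall n, measurable_fun setT (h_ n)) -> (forall n x, (0 <= h_ n x)%E) ->
  (forall n, (\int[mu]_x h_ n x <= (2^-1 ^+ n)%:E)%E) ->
  \forall x \ae mu, exists C : R, forall n, (h_ n x <= C%:E)%E.
Proof.
move=> mh h0 hi.
pose S x := (\sum_(0 <= n <oo) h_ n x)%E.
have mS : measurable_fun setT S.
  by apply: ge0_emeasurable_sum => // n x _ _; exact: h0.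
have S0 x : (0 <= S x)%E by apply: nneseries_ge0 => n _ _; exact: h0.
have iS : (\int[mu]_x S x <= 2%:E)%E.
  rewrite integral_nneseries//.
  apply: lime_le; first by apply: is_cvg_nneseries => n _ _; exact: integral_ge0.
  apply: nearW => n; rewrite big_mkord.
  apply: (@le_trans _ _ (\sum_(i < n) (2^-1 ^+ i)%:E)%E).
    by apply: lee_sum => i _; exact: hi.
  rewrite sumEFin lee_fin.
  suff -> : \sum_(i < n) 2^-1 ^+ i = 2 - 2 * 2^-1 ^+ n :> R.
    by rewrite gerBl mulr_ge0// exprn_ge0.
  elim: n => [|n IH]; first by rewrite big_ord0 expr0; ring.
  by rewrite big_ord_recr/= IH exprS; field.
have : mu.-integrable setT S.
  apply/integrableP; split => //.
  under eq_integral => x _ do rewrite gee0_abs//.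
  by apply: le_lt_trans iS _; rewrite ltry.
move/integrable_ae => /(_ measurableT); apply: filterS => x /(_ Logic.I) Sx.
exists (fine (S x)) => n; rewrite fineK//.
apply: (@le_trans _ _ (\sum_(0 <= i < n.+1) h_ i x)%E).
  rewrite big_nat_recr//= leeDr// sume_ge0// => i _; exact: h0.
by apply: nneseries_lim_ge => k _ _; exact: h0.
Qed.

Lemma geo_cvg (u : nat -> R) (C : R) :
  (forall n, `|u n.+1 - u n| <= C * 2^-1 ^+ n) -> cvgn u.
Proof.
move=> uC.
have -> : u = (fun n => u 0%N + series (telescope u) n).
  by apply/funext => n; rewrite -eq_sum_telescope.
apply: is_cvgD; first exact: is_cvg_cst.
apply: normed_cvg; apply: (series_le_cvg (v_ := geometric C 2^-1)).
- by move=> n /=.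
- by move=> n /=; exact: le_trans (uC n).
- by move=> n /=; exact: uC.
- by apply: is_cvg_geometric_series; rewrite ger0_norm// invf_lt1// ltr1n.
Qed.

Lemma measurable_sqr f : measurable_fun setT f ->
  measurable_fun setT (fun x => (f x ^+ 2)%:E : \bar R).
Proof. by move=> mf; apply/measurable_EFinP; exact: measurable_funX. Qed.

(** The rate 8^-n leaves room for the weight 4^n: the weighted squared increments have integrals at
    most 2^-n, so by [ae_geo] the increments themselves are pointwise of order 2^-n, and the
    sequence converges almost everywhere. *)
Lemma L2_complete (f_ : nat -> T -> R) : (forall n, sqi (f_ n)) ->
  (forall n m, (n <= m)%N -> ip (fun x => f_ m x - f_ n x) (fun x => f_ m x - f_ n x)
     <= 8^-1 ^+ n) ->
  exists2 f, sqi f &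
    forall n, ip (fun x => f x - f_ n x) (fun x => f x - f_ n x) <= 8^-1 ^+ n.
Proof.
move=> sf fC.
have mf n : measurable_fun setT (f_ n) by case: (sf n).
(* The upper limit is measurable and defined everywhere; it is the limit wherever there is one. *)
pose f x := fine (limn_esup (fun n => (f_ n x)%:E)).
have mf' : measurable_fun setT f.
  apply: measurableT_comp => //; apply: measurable_fun_limn_esup => n.
  exact/measurable_EFinP.
have mB n m : measurable_fun setT (fun x => f_ n x - f_ m x).
  exact: measurable_funB.
have ff : \forall x \ae mu, f_ n x @[n --> \oo] --> f x.
  have := @ae_geo (fun n x => (4 ^+ n * (f_ n.+1 x - f_ n x) ^+ 2)%:E).
  have H1 n : measurable_fun setT (fun x => (4 ^+ n * (f_ n.+1 x - f_ n x) ^+ 2)%:E : \bar R).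
    by apply/measurable_EFinP; apply: measurable_funM => //; exact: measurable_funX.
  have H2 n x : (0 <= (4 ^+ n * (f_ n.+1 x - f_ n x) ^+ 2)%:E :> \bar R)%E.
    by rewrite lee_fin mulr_ge0 ?sqr_ge0 ?exprn_ge0.
  have H3 n : (\int[mu]_x (4 ^+ n * (f_ n.+1 x - f_ n x) ^+ 2)%:E <= (2^-1 ^+ n)%:E)%E.
    under eq_integral do rewrite EFinM.
    rewrite ge0_integralZl//; last 2 first.
    - exact: measurable_sqr.
    - by move=> x _; rewrite lee_fin sqr_ge0.
    rewrite sqr_ipE; last exact: sqiB.
    rewrite -EFinM lee_fin.
    apply: le_trans (ler_wpM2l (exprn_ge0 _ _) (fC _ _ (leqnSn n))) _ => //.
    by rewrite -exprMn lerXn2r// ?nnegrE; lra.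
  move=> /(_ H1 H2 H3); apply: filterS => x [C HC].
  have C0 : 0 <= C.
    by rewrite -lee_fin; apply: le_trans (HC 0%N); exact: H2.
  have : cvgn (f_^~ x).
    apply: (@geo_cvg _ (Num.sqrt C)) => n.
    rewrite -ler_sqr ?nnegrE ?mulr_ge0 ?sqrtr_ge0 ?exprn_ge0//.
    rewrite real_normK ?num_real// exprMn sqr_sqrtr// -exprM mulnC exprM.
    have := HC n; rewrite lee_fin mulrC -ler_pdivlMr ?exprn_gt0//.
    by rewrite -exprVn (_ : (2^-1) ^+ 2 = 4^-1 :> R)//; field.
  move=> /cvg_ex[l fl]; rewrite (_ : f x = l)//.
  rewrite /f; have : (f_ n x)%:E @[n --> \oo] --> l%:E by exact/cvg_EFin/fl/nearW.
  by move=> /cvg_limn_einf_sup[_ ->].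
(* Fatou in [m] with [n] fixed turns the Cauchy bound into a bound on the distance to the limit. *)
have fle n : (\int[mu]_x ((f x - f_ n x) ^+ 2)%:E <= (8^-1 ^+ n)%:E)%E.
  apply: (@fatou_le (fun m x => ((f_ m x - f_ n x) ^+ 2)%:E)).
  - by move=> m; exact: measurable_sqr.
  - by move=> m x; rewrite lee_fin sqr_ge0.
  - by apply: measurable_sqr; exact: measurable_funB.
  - apply: filterS ff => x fx; apply: cvg_EFin; first exact: nearW.
    rewrite /=; under eq_fun do rewrite expr2.
    by rewrite expr2; apply: cvgM; apply: cvgB => //; exact: cvg_cst.
  - exists n => // m /= nm; rewrite sqr_ipE ?lee_fin; first exact: fC.
    exact: sqiB.
have sB n : sqi (fun x => f x - f_ n x).
  split; first exact: measurable_funB.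
  by apply: le_lt_trans (fle n) _; rewrite ltry.
exists f.
  have := sqiD (sB 0%N) (sf 0%N); under eq_fun do rewrite subrK.
  by [].
by move=> n; rewrite -lee_fin -sqr_ipE.
Qed.
(* The representative minimises [ip f f - 2 * L f]. *)
Lemma riesz_representation (L : (T -> R) -> R) (M : R) : 0 <= M ->
  (forall f g, sqi f -> sqi g -> L (fun x => f x + g x) = L f + L g) ->
  (forall a f, sqi f -> L (fun x => a * f x) = a * L f) ->
  (forall f, sqi f -> L f ^+ 2 <= M * ip f f) ->
  exists2 f, sqi f & forall g, sqi g -> L g = ip f g.
Proof.
move=> M0 LD LZ Lb.
pose J f := ip f f - 2 * L f.
pose E := [set J f | f in [set f | sqi f]].
(* [L f] is at most the geometric mean of [M] and [ip f f], hence [2 * L f] is at most their sum. *)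
have JM f : sqi f -> - M <= J f.
  move=> sf; have := Lb _ sf; rewrite /J; have := ip_ge0 f.
  move: (ip f f) (L f) => a b a0 ba.
  rewrite leNgt; apply/negP => h.
  have h1 : a + M < 2 * b by lra.
  have : (a + M) ^+ 2 < (2 * b) ^+ 2 by rewrite ltr_pXn2r// nnegrE; lra.
  have := sqr_ge0 (a - M); nra.
have hE : has_inf E.
  split; first by exists (J (fun=> 0)), (fun=> 0) => //; exact: sqi0.
  by exists (- M) => _ [f sf <-]; exact: JM.
pose I := inf E.
have IJ f : sqi f -> I <= J f.
  by move=> sf; apply: inf_lbound; [exact: hE.2|exists f].
(* By the parallelogram identity [par], two excesses of at most [4^-1 * 8^-1 ^+ n] over the infimum
   put the functions at squared distance at most [8^-1 ^+ n]. *)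
have /choice[f_ Hf] : forall n, exists f, sqi f /\ J f < I + 4^-1 * 8^-1 ^+ n.
  move=> n; have e0 : 0 < 4^-1 * 8^-1 ^+ n :> R by rewrite mulr_gt0// exprn_gt0.
  by have [_ [f sf <-] fI] := inf_adherent e0 hE; exists f.
have sf n : sqi (f_ n) by case: (Hf n).
have Jf n : J (f_ n) < I + 4^-1 * 8^-1 ^+ n by case: (Hf n).
have par f g : sqi f -> sqi g ->
    ip (fun x => f x - g x) (fun x => f x - g x) =
    2 * J f + 2 * J g - 4 * J (fun x => 2^-1 * (f x + g x)).
  move=> s1 s2; rewrite /J ip_sqrZ; last exact: sqiD.
  rewrite LZ; last exact: sqiD.
  by rewrite (ip_sqrB s1 s2) (ip_sqrD s1 s2) LD//; field.
have [||f sf' ff] := @L2_complete f_ => // [n m nm|].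
  rewrite par//.
  have := IJ _ (sqiZ 2^-1 (sqiD (sf m) (sf n))).
  have := Jf n; have := Jf m.
  have : 8^-1 ^+ m <= 8^-1 ^+ n :> R.
    by apply: ler_wiXn2l => //; rewrite invf_le1// ler1n.
  have : 0 <= 8^-1 ^+ m :> R by exact: exprn_ge0.
  lra.
exists f => // g sg.
(* Moving [f_ n] by [t g] cannot bring [J] below [I]. The almost optimal [t] is taken with
   denominator [ip g g + 1], which is never 0. *)
have key n : (ip (f_ n) g - L g) ^+ 2 <= 8^-1 ^+ n * (ip g g + 1).
  have g0 := ip_ge0 g.
  set c := ip (f_ n) g - L g.
  have := IJ _ (sqiD (sf n) (sqiZ (- c / (ip g g + 1)) sg)).
  rewrite {1}/J (ip_sqrD (sf n) (sqiZ _ sg)) LD//; last exact: sqiZ.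
  rewrite LZ// ip_sqrZ// ipZr//.
  set t := - c / (ip g g + 1).
  have tE : t * (ip g g + 1) = - c by rewrite /t mulfVK// gt_eqF// ltr_wpDl.
  have := Jf n; rewrite /J.
  move=> h1 h2.
  have h3 : - (4^-1 * 8^-1 ^+ n) <= 2 * t * c + t ^+ 2 * (ip g g + 1).
    have : 0 <= t ^+ 2 by exact: sqr_ge0.
    rewrite /c; lra.
  have h4 : - (t * c) <= 4^-1 * 8^-1 ^+ n.
    have : t ^+ 2 * (ip g g + 1) = - (t * c) by rewrite expr2 -mulrA tE; ring.
    lra.
  have : c ^+ 2 = - (t * c) * (ip g g + 1).
    by rewrite mulNr mulrAC tE; ring.
  have h5 : 0 <= 8^-1 ^+ n :> R by exact: exprn_ge0.
  have h6 : - (t * c) <= 8^-1 ^+ n by lra.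
  by move=> ->; rewrite ler_wpM2r// ler_wpDl.
have key2 n : (L g - ip f g) ^+ 2 <= 4 * (ip g g + 1) * 8^-1 ^+ n.
  have := cauchy_schwarz (sqiB sf' (sf n)) sg.
  rewrite (ipBl sf' (sf n) sg); have := key n; have := ff n.
  have g0 := ip_ge0 g.
  move: (ip (fun x => _) _) (8^-1 ^+ n) (ip_ge0 (fun x => f x - f_ n x)) => A e.
  move=> h0 h1 h2 h3.
  have : A * ip g g <= e * ip g g by rewrite ler_wpM2r.
  have := sqr_ge0 (L g - ip (f_ n) g - (ip (f_ n) g - ip f g)).
  nra.
apply/eqP; rewrite -subr_eq0 -sqrf_eq0 eq_le sqr_ge0 andbT.
have C : 4 * (ip g g + 1) * 8^-1 ^+ n @[n --> \oo] --> (0 : R).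
  rewrite -[X in _ --> X](mulr0 (4 * (ip g g + 1))).
  apply: cvgMl_tmp; apply: cvg_expr.
  by rewrite ger0_norm// invf_lt1// ltr1n.
rewrite -(cvg_lim _ C)//; apply: limr_ge; last exact: nearW.
by apply/cvg_ex; exists 0.
Qed.

Lemma ultra_fmap (U : set_system nat) (a : nat -> R) :
  UltraFilter U -> UltraFilter (a @ U).
Proof.
move=> UU; split; first exact: fmap_proper_filter.
move=> G GF aG; apply/seteqP; split => // A GA.
have [//|UA] := in_ultra_setVsetC (a @^-1` A) UU.
have GnA : G (~` A) by apply: aG; exact: UA.
exfalso; apply: (@filter_not_empty _ G).
by rewrite -(setICr A); exact: filterI.
Qed.

(** Compactness of the segment: along an ultrafilter every bounded real sequence converges, so
    limits are at hand before any subsequence is chosen. *)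
Lemma ultra_bounded_cvg (U : set_system nat) (a : nat -> R) (M : R) :
  UltraFilter U -> (\forall n \near U, `|a n| <= M) -> cvg (a n @[n --> U]).
Proof.
move=> UU aM; have := @segment_compact R (- M) M.
rewrite compact_ultra => /(_ (a @ U) (ultra_fmap a UU)).
case; last by move=> l [_ al]; apply/cvg_ex; exists l.
by apply: filterS aM => n; rewrite /= in_itv/= ler_norml.
Qed.

(** The limits along [U] of the pairings with all [g] form a bounded linear functional; its
    representative is the weak limit. *)
Lemma ultra_weak_compact (U : set_system nat) (x_ : nat -> T -> R) (M : R) :
  UltraFilter U -> (forall n, sqi (x_ n)) ->
  (\forall n \near U, ip (x_ n) (x_ n) <= M) ->
  exists2 x, sqi x & forall g, sqi g -> ip (x_ n) g @[n --> U] --> ip x g.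
Proof.
move=> UU sx xM.
have M0 : 0 <= M.
  near U => n; apply: (le_trans (ip_ge0 (x_ n))); near: n; exact: xM.
have bnd g : sqi g -> \forall n \near U, `|ip (x_ n) g| <= Num.sqrt (M * ip g g).
  move=> sg; near=> n; rewrite -ler_sqr ?nnegrE ?sqrtr_ge0//.
  rewrite real_normK ?num_real// sqr_sqrtr ?mulr_ge0 ?ip_ge0//.
  apply: le_trans (cauchy_schwarz (sx n) sg) _.
  by rewrite ler_wpM2r ?ip_ge0//; near: n.
have cx g : sqi g -> cvg (ip (x_ n) g @[n --> U]).
  by move=> sg; exact: ultra_bounded_cvg (bnd g sg).
have [||||x sx' xL] := @riesz_representation (fun g => lim (ip (x_ n) g @[n --> U])) M.
- by [].
- move=> f g sf sg; under eq_fun do rewrite ipDr//.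
  by rewrite limD//; exact: cx.
- move=> a f sf; under eq_fun do rewrite ipZr//.
  by apply: cvg_lim => //; apply: cvgMl_tmp; exact: cx.
- move=> f sf; rewrite -[leRHS]sqr_sqrtr ?mulr_ge0 ?ip_ge0//.
  rewrite -real_normK ?num_real// ler_sqr ?nnegrE ?sqrtr_ge0//.
  rewrite -lim_norm; last exact: cx.
  apply: limr_le; last exact: bnd.
  by apply: is_cvg_norm; exact: cx.
- by exists x => // g sg; rewrite -xL//; exact: cx.
Unshelve. all: by end_near. Qed.

End L2.

(** * Lebesgue measure on boxes, translations *)

Section boxes.
Context {R : realType}.
Local Notation leb := (@lebesgue_rV R _).

Definition box n (a b : 'rV[R]_n) : set 'rV[R]_n :=
  [set x | forall i, `]a ord0 i, b ord0 i[%classic (x ord0 i)].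

Lemma measurable_box n (a b : 'rV[R]_n) : measurable (box a b).
Proof.
rewrite [X in measurable X](_ : _ = \bigcap_(i in [set: 'I_n])
    ((fun x : 'rV[R]_n => x ord0 i) @^-1` `]a ord0 i, b ord0 i[%classic)); last first.
  by apply/seteqP; split => [x /= Ax i _|x /= Ax i]; [exact: Ax|exact: (Ax i)].
apply: fin_bigcap_measurable => // i _.
by rewrite -[X in measurable X]setTI; apply: measurable_coord.
Qed.

Lemma lebesgue_box n (a b : 'rV[R]_n) :
  leb (box a b) = (\prod_(i < n) Num.max 0 (b ord0 i - a ord0 i))%:E.
Proof.
rewrite (lebesgue_rV_box (A := fun i => `]a ord0 i, b ord0 i[%classic))//.
rewrite -prodEFin; apply: eq_bigr => i _.
rewrite lebesgue_measure_itv/= lte_fin; case: ifPn => [ab|].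
  by rewrite -EFinB max_r// subr_ge0 ltW.
by rewrite -leNgt => ba; rewrite max_l// subr_le0.
Qed.

Definition boxes n : set_system 'rV[R]_n := [set A | exists a b, A = box a b].

(** A half-space given by a lower bound on one coordinate is the union over [k] of boxes whose other
    sides are bounded by [k] in absolute value. *)
Lemma measurable_boxesE n :
  @measurable _ 'rV[R]_n = <<s @boxes n >>.
Proof.
apply/seteqP; split; last first.
  apply: smallest_sub; first exact: sigma_algebra_measurable.
  by move=> _ [a [b ->]]; exact: measurable_box.
have sG : sigma_algebra setT <<s @boxes n >> by exact: smallest_sigma_algebra.
have [sG0 sGC sGU] := sG.
apply: smallest_sub => //.
rewrite -bigcup_seq/= => B [i _ [C mC <-]] /=; rewrite setTI.
have {mC} : (@ocitv R).-sigma.-measurable C by exact: mC.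
rewrite RGenOInfty.measurableE; move: C.
apply: smallest_sub.
  split => [|B'|F] /=.
  - by rewrite preimage_set0.
  - by move=> mB; rewrite setTD preimage_setC -setTD; exact: sGC.
  - by move=> mF; rewrite preimage_bigcup; exact: sGU.
move=> _ [x ->] /=.
rewrite [X in <<s _ >> X](_ : _ = \bigcup_k box
    (\row_j (if j == i then x else - k%:R)) (const_mx k%:R)).
  apply: sGU => k; apply: sub_sigma_algebra.
  by exists (\row_j (if j == i then x else - k%:R)), (const_mx k%:R).
apply/seteqP; split => [y /=|y [k _] /(_ i)]; last first.
  by rewrite /= !mxE eqxx !in_itv/= => /andP[->].
rewrite in_itv/= andbT => xy.
exists (Num.truncn (\sum_j `|y ord0 j|)).+1 => // j; rewrite /= !mxE in_itv/=.
have yj : `|y ord0 j| < (Num.truncn (\sum_j `|y ord0 j|)).+1%:R.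
  apply: le_lt_trans (truncnS_gt _).
  by rewrite (bigD1 j)//= lerDl sumr_ge0.
move: yj; rewrite ltr_norml => /andP[yj1 yj2]; rewrite yj2 andbT.
by case: eqP => [->|].
Qed.

Definition cube n (r : R) : set 'rV[R]_n := box (const_mx (- r)) (const_mx r).
Arguments cube : clear implicits.

Lemma measurable_cube n r : measurable (cube n r).
Proof. exact: measurable_box. Qed.

Lemma lebesgue_cube n r : 0 <= r -> leb (cube n r) = ((2 * r) ^+ n)%:E.
Proof.
move=> r0; rewrite lebesgue_box; under eq_bigr do rewrite !mxE.
rewrite prodr_const card_ord max_r ?opprK; last by rewrite addr_ge0.
by rewrite (_ : r + r = 2 * r)//; ring.
Qed.

Lemma sub_cube n r s : r <= s -> cube n r `<=` cube n s.
Proof.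
move=> rs x xr i; have := xr i; rewrite /= !mxE !in_itv/= => /andP[h1 h2].
by rewrite (le_lt_trans _ h1) ?(lt_le_trans h2)// lerN2.
Qed.

Lemma cubeP n (x : 'rV[R]_n) r : cube n r x <-> forall i, `|x ord0 i| < r.
Proof.
split=> H i; have := H i; rewrite /= !mxE !in_itv/= ltr_norml//.
Qed.

Lemma cube_cover n (x : 'rV[R]_n) : \forall k \near \oo, cube n k%:R x.
Proof.
near=> k; apply/cubeP => i; apply: (@le_lt_trans _ _ (\sum_j `|x ord0 j|)).
  by rewrite (bigD1 i)//= lerDl sumr_ge0.
by near: k; exact: nbhs_infty_gtr.
Unshelve. all: by end_near. Qed.

(** Boxes are stable under intersection, generate the sigma-algebra, and exhaust the space through
    cubes of finite measure. This yields translation invariance and, later, that a function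
    orthogonal to all boxes vanishes. *)
Lemma rV_measure_unique n (m1 m2 : {measure set 'rV[R]_n -> \bar R}) :
  (forall a b, m1 (box a b) = m2 (box a b)) ->
  (forall a b, (m1 (box a b) < +oo)%E) ->
  forall A, measurable A -> m1 A = m2 A.
Proof.
move=> m12 moo; apply: (measure_unique (@boxes n) (fun k => cube n k%:R)).
- exact: measurable_boxesE.
- move=> _ _ [a [b ->]] [a' [b' ->]].
  exists (\row_i Num.max (a ord0 i) (a' ord0 i)), (\row_i Num.min (b ord0 i) (b' ord0 i)).
  apply/seteqP; split => [x [h1 h2] i|x h].
    have := h1 i; have := h2 i; rewrite /= !mxE !in_itv/= gt_max lt_min.
    by move=> /andP[-> ->] /andP[-> ->].
  by split => i; have := h i; rewrite /= !mxE !in_itv/= gt_max lt_min;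
    move=> /andP[/andP[h1 h2] /andP[h3 h4]]; apply/andP.
- by move=> k; exists (const_mx (- k%:R)), (const_mx k%:R).
- apply/seteqP; split => // x _; have [k _ /(_ k)] := cube_cover x.
  by move=> /(_ (leqnn _)); exists k.
- by move=> A [a [b ->]]; exact: m12.
- by move=> k; exact: moo.
Qed.

Lemma measurable_addr n (h : 'rV[R]_n) : measurable_fun setT (fun x : 'rV[R]_n => x + h).
Proof.
apply: measurable_fun_rV => i; under eq_fun do rewrite mxE.
by apply: measurable_funD => //; exact: measurable_coord.
Qed.

Lemma measurable_subr2 n :
  measurable_fun setT (fun p : 'rV[R]_n * 'rV[R]_n => p.1 - p.2).
Proof.
apply: measurable_fun_rV => i; under eq_fun do rewrite !mxE.
apply: measurable_funB.
- exact: (measurableT_comp (measurable_coord i) measurable_fst).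
- exact: (measurableT_comp (measurable_coord i) measurable_snd).
Qed.

Lemma measurable_addr2 n :
  measurable_fun setT (fun p : 'rV[R]_n * 'rV[R]_n => p.1 + p.2).
Proof.
apply: measurable_fun_rV => i; under eq_fun do rewrite !mxE.
apply: measurable_funD.
- exact: (measurableT_comp (measurable_coord i) measurable_fst).
- exact: (measurableT_comp (measurable_coord i) measurable_snd).
Qed.

Lemma lebesgue_rV_shift n (h : 'rV[R]_n) (A : set 'rV[R]_n) : measurable A ->
  pushforward leb (fun x => x + h) A = leb A.
Proof.
pose m1 := measure_function_pushforward__canonical__measure_function_Measure
  (@lebesgue_rV R n) (measurable_addr h).
have E a b : (fun x : 'rV[R]_n => x + h) @^-1` box a b = box (a - h) (b - h).
  apply/seteqP; split => x xab i; have := xab i; rewrite /= !mxE !in_itv/=;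
    by rewrite ltrBlDr ltrBrDr.
apply: (@rV_measure_unique _ m1) => [a b|a b].
  rewrite /m1/= /pushforward E !lebesgue_box; congr EFin.
  by apply: eq_bigr => i _; rewrite !mxE; congr Num.max; ring.
by rewrite /m1/= /pushforward E lebesgue_box ltry.
Qed.

Lemma ge0_integral_shift n (h : 'rV[R]_n) (f : 'rV[R]_n -> \bar R) :
  measurable_fun setT f -> (forall x, 0 <= f x)%E ->
  (\int[leb]_x f (x + h)%R = \int[leb]_x f x)%E.
Proof.
move=> mf f0.
have := ge0_integral_pushforward (measurable_addr h) (@lebesgue_rV R n) measurableT mf.
rewrite preimage_setT => <- //.
apply: (@eq_measure_integral _ _ _ _ leb
  (measure_function_pushforward__canonical__measure_function_Measure
  (@lebesgue_rV R n) (measurable_addr h))) => A mA _; exact: lebesgue_rV_shift.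
Qed.

Lemma sqi_shift n (h : 'rV[R]_n) (f : 'rV[R]_n -> R) :
  sqi leb f -> sqi leb (fun x => f (x + h)).
Proof.
move=> [mf fi]; split; first exact: measurableT_comp (measurable_addr h).
rewrite (ge0_integral_shift h (f := fun x => (f x ^+ 2)%:E))//.
- exact: measurable_sqr.
- by move=> x; rewrite lee_fin sqr_ge0.
Qed.

Lemma ip_shift n (h : 'rV[R]_n) (f g : 'rV[R]_n -> R) : sqi leb f -> sqi leb g ->
  ip leb (fun x => f (x + h)) (fun x => g (x + h)) = ip leb f g.
Proof.
move=> sf sg.
have := integral_pushforward (measurable_addr h) (mu := @lebesgue_rV R n) (D := setT)
  (f := fun x => (f x * g x)%:E).
rewrite preimage_setT => H; rewrite /ip /Rintegral; congr fine.
rewrite -H//.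
- apply: (@eq_measure_integral _ _ _ _ leb
  (measure_function_pushforward__canonical__measure_function_Measure
  (@lebesgue_rV R n) (measurable_addr h))) => A mA _; exact: lebesgue_rV_shift.
- by have [mf _] := sf; have [mg _] := sg; apply/measurable_EFinP; exact: measurable_funM.
- exact: (sqi_integrable (sqi_shift h sf) (sqi_shift h sg)).
Qed.

(** The sigma-algebra is generated by the coordinates, so an open set has to be exhibited as a
    countable union of boxes; their centres are rational and their half-sides are inverses of
    integers. *)
Lemma open_measurable_rV n (U : set 'rV[R]_n) : open U -> measurable U.
Proof.
move=> oU.
pose F (q : 'rV[rat]_n * nat) : set 'rV[R]_n :=
  let c := map_mx ratr q.1 in let e := q.2.+1%:R^-1 in
  let B := box (c - const_mx e) (c + const_mx e) in
  if `[< B `<=` U >] then B else set0.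
rewrite (_ : U = \bigcup_q F q).
  apply: countable_bigcupT_measurable => // q.
  by rewrite /F; case: asboolP => // _; exact: measurable_box.
apply/seteqP; split => [x Ux|x [q _]]; last first.
  by rewrite /F; case: asboolP => // qU /qU.
have /nbhs_ballP[e /= e0 xeU] := open_nbhs_nbhs (conj oU Ux).
(* If a rational centre is within [e1] of [x], the points of its box are within [2 * e1] of [x]. *)
have [k ke] : exists k : nat, 2 * k.+1%:R^-1 < e.
  exists (Num.truncn (2 / e)); rewrite ltr_pdivrMr//.
  by rewrite mulrC -ltr_pdivrMr//; exact: truncnS_gt.
have [e1 e10 e1E] : exists2 e1 : R, 0 < e1 & k.+1%:R^-1 = e1.
  by exists k.+1%:R^-1 => //; rewrite invr_gt0.
rewrite e1E in ke.
have /choice[q Hq] : forall i, exists q : rat,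
    ratr q \in `]x ord0 i - e1, x ord0 i + e1[.
  by move=> i; apply: rat_in_itvoo; lra.
exists (\row_i q i, k) => //.
rewrite /F /= e1E; case: asboolP => [_ i|].
  rewrite /= !mxE !in_itv/=; have := Hq i; rewrite in_itv/= => /andP[h1 h2].
  by apply/andP; split; lra.
case=> y yB; apply: xeU; split => // i j; rewrite !ord1.
have := yB j; have := Hq j; rewrite /= !mxE !in_itv/= => /andP[h1 h2] /andP[h3 h4].
by rewrite /ball/= ltr_norml; apply/andP; split; lra.
Qed.

Lemma continuous_measurable_rV n (f : 'rV[R]_n -> R) :
  continuous f -> measurable_fun setT f.
Proof.
move=> /continuousP cf mD; apply: (measurability _ (RGenOpens.measurableE R)) => //.
move=> _ [_ [a [b ->] <-]]; rewrite setTI.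
apply: open_measurable_rV; apply: cf; exact: interval_open.
Qed.

(** In dimension 0 the measure is a Dirac mass, whence the condition on [n]. *)
Lemma lebesgue_set1 n (x : 'rV[R]_n) : (0 < n)%N -> leb [set x] = 0%E.
Proof.
case: n x => // n x _.
rewrite (_ : [set x] = [set y | forall i, [set x ord0 i] (y ord0 i)]).
  rewrite (lebesgue_rV_box (A := fun i => [set x ord0 i]))//.
  by rewrite big_ord_recl lebesgue_measure_set1 mul0e.
by apply/seteqP; split => [y -> //|y /= H]; apply/rowP.
Qed.

Lemma measurable_rV1 n (x : 'rV[R]_n) : measurable [set x].
Proof.
rewrite [X in measurable X](_ : _ = \bigcap_(i in [set: 'I_n])
    ((fun y : 'rV[R]_n => y ord0 i) @^-1` [set x ord0 i])); last first.
  by apply/seteqP; split => [y -> i _//|y /= H]; apply/rowP => i; exact: H.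
apply: fin_bigcap_measurable => // i _.
by rewrite -[X in measurable X]setTI; apply: measurable_coord.
Qed.

End boxes.

Arguments cube {R} n r.

(** * Test functions *)

Section smooth1.
Context {R : realType}.
Implicit Types f g : R -> R.

Lemma is_derive_ext f f' x d d' : is_derive x (1 : R) f d -> f =1 f' -> d = d' ->
  is_derive x (1 : R) f' d'.
Proof. by move=> + /funext ff' dd'; rewrite ff' dd'. Qed.

Lemma is_derive_chain (f g : R -> R) x a b : is_derive x (1 : R) g b ->
  is_derive (g x) (1 : R) f a -> is_derive x (1 : R) (fun y => f (g y)) (a * b).
Proof. by move=> dg df; exact: (is_derive1_comp df dg). Qed.

(** The last derivative is not asked to be continuous; for [smooth1] this makes no difference,
    because the next order supplies the continuity. *)
Fixpoint Ck (k : nat) f : Prop :=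
  if k is k'.+1 then (forall x, derivable f x (1 : R)) /\ Ck k' (derive1 f) else True.

Definition smooth1 f := forall k, Ck k f.

Lemma CkS k f : Ck k.+1 f -> Ck k f.
Proof. by elim: k f => [//|k IH] f [df cf]; split => //; exact: IH. Qed.

Lemma smooth1_derive f : smooth1 f -> smooth1 (derive1 f).
Proof. by move=> sf k; have [] := sf k.+1. Qed.

Lemma smooth1_derivable f x : smooth1 f -> derivable f x (1 : R).
Proof. by move=> sf; have [] := sf 1%N. Qed.

Lemma smooth1_continuous f : smooth1 f -> continuous f.
Proof.
by move=> sf x; apply: differentiable_continuous; apply/derivable1_diffP;
  exact: smooth1_derivable.
Qed.

Lemma derive1_eq f g : (forall x, is_derive x (1 : R) f (g x)) -> (derive1 f) = g.
Proof. by move=> fg; apply/funext => x; rewrite derive1E; exact: derive_val. Qed.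

Lemma Ck_is_derive k f g : (forall x, is_derive x (1 : R) f (g x)) -> Ck k g -> Ck k.+1 f.
Proof.
by move=> fg cg; split; [move=> x; exact: ex_derive|rewrite (derive1_eq fg)].
Qed.

Lemma Ck_cst k c : Ck k (fun=> c).
Proof.
by elim: k c => // k IH c; apply: (Ck_is_derive (g := fun=> 0)).
Qed.

Lemma is_derive1 f x : derivable f x (1 : R) -> is_derive x (1 : R) f ((derive1 f) x).
Proof. by move=> df; rewrite derive1E; apply: DeriveDef. Qed.

Lemma CkD k f g : Ck k f -> Ck k g -> Ck k (fun x => f x + g x).
Proof.
elim: k f g => // k IH f g [df cf] [dg cg].
apply: (Ck_is_derive (g := fun x => (derive1 f) x + (derive1 g) x)); last exact: IH.
by move=> x; apply: is_deriveD; exact: is_derive1.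
Qed.

Lemma CkM k f g : Ck k f -> Ck k g -> Ck k (fun x => f x * g x).
Proof.
elim: k f g => // k IH f g Cf Cg; have [df cf] := Cf; have [dg cg] := Cg.
apply: (Ck_is_derive (g := fun x => f x * (derive1 g) x + g x * (derive1 f) x)).
  by move=> x; apply: is_deriveM; exact: is_derive1.
by apply: CkD; apply: IH => //; exact: CkS.
Qed.

Lemma Ck_affine k f (a c : R) : Ck k f -> Ck k (fun x => f (a * x + c)).
Proof.
elim: k f => // k IH f [df cf].
apply: (Ck_is_derive (g := fun x => a * (derive1 f) (a * x + c))).
  move=> x; have h : is_derive x (1 : R) (fun x => a * x + c) a.
    have := is_deriveD (is_deriveZ a (is_derive_id x (1 : R))) (is_derive_cst c x (1 : R)).
    by move=> /is_derive_ext; apply => //; rewrite /GRing.scale/= mulr1 addr0.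
  have := is_derive_chain h (is_derive1 (df (a * x + c))).
  by rewrite mulrC.
by apply: CkM; [exact: Ck_cst|exact: IH].
Qed.

(** The classical flat functions p(1/x) exp(-1/x). Carrying the polynomial along makes the family
    closed under derivation, so that smoothness is an induction. *)
Definition flat (p : {poly R}) (x : R) : R :=
  if 0 < x then p.[x^-1] * expR (- x^-1) else 0.

(** Each monomial satisfies y^i exp(-y) <= i!, since y^i / i! is a term of the exponential
    series. *)
Lemma poly_expRN_bounded (p : {poly R}) :
  exists2 C, 0 < C & forall y, 0 < y -> `|p.[y] * expR (- y)| <= C.
Proof.
exists (1 + \sum_(i < size p) `|p`_i| * i`!%:R).
  by rewrite ltr_pwDl// sumr_ge0// => i _; rewrite mulr_ge0.
move=> y y0; rewrite normrM (ger0_norm (expR_ge0 _)).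
rewrite horner_coef; apply: (@le_trans _ _ (\sum_(i < size p) `|p`_i| * i`!%:R)); last first.
  by rewrite lerDr.
apply: (@le_trans _ _ (\sum_(i < size p) `|p`_i| * y ^+ i * expR (- y))).
  rewrite -mulr_suml ler_wpM2r ?expR_ge0//.
  apply: le_trans (ler_norm_sum _ _ _) _; apply: ler_sum => i _.
  by rewrite normrM (ger0_norm (exprn_ge0 _ (ltW y0))).
apply: ler_sum => i _; rewrite -mulrA ler_wpM2l//.
rewrite expRN ler_pdivrMr ?expR_gt0//.
case: (i : nat) => [|m].
  by rewrite expr0 fact0 mul1r; apply: ltW; rewrite expR_gt1.
rewrite mulrC -ler_pdivrMr ?ltr0n ?fact_gt0//.
by apply: le_trans (expR_ge1Dxn m (ltW y0)); rewrite lerDr.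
Qed.

(** For x > 0 the derivative of p(1/x) exp(-1/x) is x^-2 (p - p')(1/x) exp(-1/x). *)
Definition flat_next (p : {poly R}) : {poly R} := 'X^2 * (p - p^`()).

Lemma is_derive_flat p x : is_derive x (1 : R) (flat p) (flat (flat_next p) x).
Proof.
have [x0|x0|x0] := ltgtP x 0.
- rewrite {2}/flat ltNge (ltW x0)/=.
  apply: (@near_eq_is_derive _ _ _ (fun=> 0) (flat p)) => //.
  near=> y; rewrite /flat ltNge ltW//.
  near: y; exact: lt_nbhsl.
- rewrite {2}/flat x0.
  apply: (near_eq_is_derive (f := fun y : R => p.[y^-1] * expR (- y^-1))).
    by near=> y; rewrite /flat ifT//; near: y; exact: lt_nbhsr.
  have hV : is_derive x (1 : R) (fun y : R => y^-1) (- x ^- 2).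
    apply: is_derive_eq; first by apply: is_deriveV; rewrite gt_eqF.
    by rewrite /GRing.scale/= mulr1.
  have h1 : is_derive x (1 : R) (fun y => p.[y^-1]) (p^`().[x^-1] * (- x ^- 2)).
    exact: (is_derive1_comp (is_derive_poly p x^-1) hV).
  have h2 : is_derive x (1 : R) (fun y => expR (- y^-1)) (expR (- x^-1) * (x ^- 2)).
    have := @is_derive1_comp _ expR (fun y => - y^-1) x _ _
      (is_derive_expR (- x^-1)) (is_deriveN hV).
    by rewrite opprK.
  have := is_deriveM h1 h2; move=> /is_derive_ext; apply => //.
  rewrite /flat_next hornerM hornerXn hornerD hornerN /GRing.scale/=.
  by rewrite exprVn; ring.
(* At 0 the bound for ['X^2 * p] gives [|flat p h| <= C * h ^+ 2], so the difference quotient tends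
   to 0. *)
- rewrite x0 {2}/flat ltxx.
  have [C C0 HC] := poly_expRN_bounded ('X^2 * p).
  have fC h : `|flat p h| <= C * h ^+ 2.
    rewrite /flat; case: ifPn => [h0|_]; last by rewrite normr0 mulr_ge0 ?sqr_ge0// ltW.
    have := HC h^-1; rewrite invr_gt0 => /(_ h0).
    rewrite hornerM hornerXn exprVn -mulrA normrM ger0_norm ?invr_ge0 ?sqr_ge0//.
    by rewrite mulrC ler_pdivrMr ?exprn_gt0.
  have cv : h^-1 *: ((flat p \o shift 0) (h *: (1 : R)) - flat p 0) @[h --> 0^'] --> (0 : R).
    apply/cvgr0Pnorm_le => e e0; near=> h.
    have hn0 : h != 0 by near: h; exact: nbhs_dnbhs_neq.
    rewrite /= addr0 (_ : flat p 0 = 0) ?subr0; last by rewrite /flat ltxx.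
    rewrite normrM normfV ler_pdivrMl ?normr_gt0// mulrC /GRing.scale/= mulr1.
    apply: le_trans (fC h) _.
    rewrite -real_normK ?num_real// expr2 mulrA ler_wpM2r//.
    rewrite mulrC -ler_pdivlMr//; apply: ltW.
    by near: h; apply: dnbhs0_lt; rewrite divr_gt0.
  by apply: DeriveDef; [apply/cvg_ex; exists 0|exact: (cvg_lim _ cv)].
Unshelve. all: by end_near. Qed.

Lemma Ck_flat k p : Ck k (flat p).
Proof.
by elim: k p => // k IH p; apply: (Ck_is_derive (g := flat (flat_next p)));
  [exact: is_derive_flat|exact: IH].
Qed.

(* [steep_bump a b k] increases to the indicator function of [`]a, b[] as [k]
   grows, since [expR (- 1 / (k * t))] tends to [1] for [t > 0]. *)
Definition steep_bump (a b : R) (k : nat) (x : R) : R :=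
  flat 1 (k%:R * x + - (k%:R * a)) * flat 1 (- k%:R * x + k%:R * b).

Lemma smooth1_steep_bump a b k : smooth1 (steep_bump a b k).
Proof. by move=> m; apply: CkM; apply: Ck_affine; exact: Ck_flat. Qed.

Lemma flat1_ge0 x : 0 <= flat 1 x.
Proof. by rewrite /flat; case: ifP => // _; rewrite hornerC mul1r expR_ge0. Qed.

Lemma flat1_le1 x : flat 1 x <= 1.
Proof.
rewrite /flat; case: ifP => // x0; rewrite hornerC mul1r -[leRHS]expR0 ler_expR.
by rewrite oppr_le0 invr_ge0 ltW.
Qed.

Lemma steep_bump_ge0 a b k x : 0 <= steep_bump a b k x.
Proof. by rewrite mulr_ge0 ?flat1_ge0. Qed.

Lemma steep_bump_le a b k x : steep_bump a b k x <= \1_(`]a, b[%classic) x.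
Proof.
rewrite indicE; case: (boolP (x \in _)) => [_|].
  by rewrite mulr_ile1 ?flat1_ge0 ?flat1_le1.
rewrite notin_setE/= in_itv/= => /negP; rewrite negb_and -!leNgt => /orP[xa|bx].
  rewrite /steep_bump -mulrBr [X in X * _](_ : _ = 0) ?mul0r//.
  by rewrite /flat ltNge mulr_ge0_le0 ?subr_le0.
rewrite /steep_bump [- _ * x + _]addrC mulNr -mulrBr [X in _ * X](_ : _ = 0) ?mulr0//.
by rewrite -?mulrBr /flat ltNge mulr_ge0_le0 ?subr_le0.
Qed.

Lemma flat1_cvg (t : R) : 0 < t -> flat 1 (k%:R * t) @[k --> \oo] --> (1 : R).
Proof.
move=> t0; rewrite -[X in _ --> X]expR0.
have H : - (k%:R * t)^-1 @[k --> \oo] --> (0 : R).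
  rewrite -oppr0; apply: cvgN; apply/gtr0_cvgV0.
    by near=> k; rewrite mulr_gt0// ltr0n; near: k; exists 1%N.
  apply/cvgryPge => A; near=> k; rewrite -ler_pdivrMr//.
  by near: k; exact: nbhs_infty_ger.
have H2 : expR (- (k%:R * t)^-1) @[k --> \oo] --> expR 0.
  by apply: continuous_cvg => //; exact: continuous_expR.
move: H2; apply: cvg_trans; apply: near_eq_cvg; near=> k.
rewrite /flat ifT ?hornerC ?mul1r// mulr_gt0// ltr0n.
by near: k; exists 1%N.
Unshelve. all: by end_near. Qed.

Lemma steep_bump_cvg a b x :
  steep_bump a b k x @[k --> \oo] --> (\1_(`]a, b[%classic) x : R).
Proof.
rewrite indicE; case: (boolP (x \in _)) => xab; last first.
  rewrite (_ : (fun k => _) = (fun=> 0)); first exact: cvg_cst.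
  apply/funext => k; apply/eqP; rewrite eq_le steep_bump_ge0 andbT.
  by apply: le_trans (steep_bump_le _ _ _ _) _; rewrite indicE (negbTE xab).
move: xab; rewrite inE/= in_itv/= => /andP[ax xb].
rewrite -[X in _ --> X]mulr1; apply: cvgM.
  under eq_fun do rewrite -mulrBr.
  by apply: flat1_cvg; rewrite subr_gt0.
under eq_fun do rewrite mulNr addrC -mulrBr.
by apply: flat1_cvg; rewrite subr_gt0.
Qed.

(** * Moving integrals of one-variable test functions *)

Section shifted_average.
Variables (b : R -> R) (r : R).
Hypotheses (sb : smooth1 b) (br : forall x, r < `|x| -> b x = 0).
Local Notation mu := (@lebesgue_measure R).

(** The function [primitive x - primitive (x - t)] is the integral of [b] over a window of length
    [t]. It is again smooth with bounded support, and its derivative is the difference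
    [b x - b (x - t)]; this converts translations into derivatives. *)
Definition primitive (x : R) : R := (\int[mu]_(s in `]-oo, x]) b s)%R.

Let ib : mu.-integrable setT (EFin \o b).
Proof.
have cb := smooth1_continuous sb.
have mb := continuous_measurable_fun cb.
have cab : {within `[- r, r], continuous b} by apply: continuous_subspaceT.
have := continuous_compact_integrable (@segment_compact _ (- r) r) cab.
move=> /integrableP[_ bi]; apply/integrableP; split.
  exact/measurable_EFinP.
rewrite [ltLHS](_ : _ = \int[mu]_(x in `[(- r)%R, r]) `|(EFin \o b) x|)%E//.
rewrite [RHS]integral_mkcond; apply: eq_integral => x _; rewrite patchE.
case: ifPn => //; rewrite notin_setE/= in_itv/= => /negP.
by rewrite -ler_norml -ltNge => /br -> /=; rewrite normr0.
Qed.

Lemma is_derive_primitive x : is_derive x (1 : R) primitive (b x).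
Proof.
have xx1 : x < x + 1 by rewrite ltrDl.
have ix : mu.-integrable [set` Interval -oo%O (BRight (x + 1))] (EFin \o b).
  exact: integrableS ib.
have [||d1 d2] := continuous_FTC1 xx1 ix.
- exact: ltNyr.
- exact: smooth1_continuous.
- apply: DeriveDef; first exact: d1.
  by rewrite -derive1E; exact: d2.
Qed.

Lemma shifted_average (t x : R) : 0 < t ->
  (\int[mu]_(s in `[0, t]) b (x - s) = primitive x - primitive (x - t))%R.
Proof.
move=> t0.
have dF s : is_derive s (1 : R) (fun s => - primitive (x - s)) (b (x - s)).
  have h : is_derive s (1 : R) (fun s => x - s) (-1).
    have := is_deriveB (is_derive_cst x s (1 : R)) (is_derive_id s (1 : R)).
    by move=> /is_derive_ext; apply => //; rewrite sub0r.
  have := is_deriveN (is_derive_chain h (is_derive_primitive (x - s))).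
  by rewrite mulrN1 opprK.
have cF : continuous (fun s => - primitive (x - s)).
  by move=> s; apply: differentiable_continuous; apply/derivable1_diffP; apply: ex_derive.
rewrite /Rintegral (@continuous_FTC2 _ _ (fun s => - primitive (x - s)))//=.
- by rewrite subr0; ring.
- apply: continuous_subspaceT => s.
  apply: (@continuous_comp _ _ _ (fun s => x - s) b).
    by apply: continuousB; [exact: cst_continuous|exact: cvg_id].
  exact: smooth1_continuous.
- split; first by move=> s _; apply: ex_derive.
  + by apply: cvg_at_right_filter; exact: cF.
  + by apply: cvg_at_left_filter; exact: cF.
- by move=> s _; rewrite derive1E; exact: derive_val.
Qed.

Lemma smooth1_shifted_average t : smooth1 (fun x => primitive x - primitive (x - t)).
Proof.
(* Raising the order by one allows a derivative to be taken even when [k] is 0. *)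
move=> k; apply: CkS.
apply: (Ck_is_derive (g := fun x => b x + -1 * b (1 * x + - t))).
  move=> x; have h : is_derive x (1 : R) (fun s => s - t) 1.
    have := is_deriveB (is_derive_id x (1 : R)) (is_derive_cst t x (1 : R)).
    by move=> /is_derive_ext; apply => //; rewrite subr0.
  have := is_deriveB (is_derive_primitive x)
    (is_derive_chain h (is_derive_primitive (x - t))).
  by move=> /is_derive_ext; apply => [y|]; rewrite /= ?mul1r ?mulr1 ?mulN1r.
apply: CkD; first exact: sb.
by apply: CkM; [exact: Ck_cst|apply: Ck_affine; exact: sb].
Qed.

Lemma derive_shifted_average t x :
  derive1 (fun x => primitive x - primitive (x - t)) x = b x - b (x - t).
Proof.
rewrite derive1E; apply: derive_val.
have h : is_derive x (1 : R) (fun s => s - t) 1.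
  have := is_deriveB (is_derive_id x (1 : R)) (is_derive_cst t x (1 : R)).
  by move=> /is_derive_ext; apply => //; rewrite subr0.
have := is_deriveB (is_derive_primitive x)
  (is_derive_chain h (is_derive_primitive (x - t))).
by move=> /is_derive_ext; apply => //; rewrite mulr1.
Qed.

Lemma shifted_average_supp t x : 0 < t -> r + t < `|x| ->
  primitive x - primitive (x - t) = 0.
Proof.
move=> t0 rx; rewrite -shifted_average//.
rewrite (@eq_Rintegral _ _ _ _ _ (fun=> 0)); first by rewrite Rintegral_cst// mul0r.
move=> s; rewrite inE/= in_itv/= => /andP[s0 st]; apply: br.
have := lerB_normD x (- s); rewrite normrN (ger0_norm s0).
lra.
Qed.

End shifted_average.

End smooth1.

(** * Tensor products as test functions *)

Section tensor.
Context {R : realType} {n : nat}.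
Local Notation leb := (@lebesgue_rV R n).
Implicit Types b : 'I_n -> R -> R.

Definition tensor b (x : 'rV[R]_n) : R := \prod_(i < n) b i (x ord0 i).

Definition derive_at (i : 'I_n) b : 'I_n -> R -> R :=
  fun j => if j == i then derive1 (b j) else b j.

Lemma tensorD1 b i x : tensor b x = b i (x ord0 i) * \prod_(j < n | j != i) b j (x ord0 j).
Proof. by rewrite /tensor (bigD1 i). Qed.

Lemma is_derive_tensor b (i : 'I_n) (x : 'rV[R]_n) :
  derivable (b i) (x ord0 i) (1 : R) ->
  is_derive x (delta_mx ord0 i) (tensor b) (tensor (derive_at i b) x).
Proof.
move=> dbi.
pose c := \prod_(j < n | j != i) b j (x ord0 j).
have tE (h : R) : tensor b (h *: delta_mx ord0 i + x) = b i (h *: (1 : R) + x ord0 i) * c.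
  rewrite (tensorD1 _ i) !mxE !eqxx; congr (_ * _); apply: eq_bigr => j ji.
  by rewrite !mxE (negbTE ji) andbF mulr0 add0r.
have dE : tensor (derive_at i b) x = derive1 (b i) (x ord0 i) * c.
  rewrite (tensorD1 _ i) /derive_at eqxx; congr (_ * _).
  by apply: eq_bigr => j /negbTE ->.
have cv : h^-1 *: ((tensor b \o shift x) (h *: delta_mx ord0 i) - tensor b x)
    @[h --> 0^'] --> tensor (derive_at i b) x.
  have E : (fun h : R => h^-1 *: ((tensor b \o shift x) (h *: delta_mx ord0 i) - tensor b x))
    = (fun h : R => (h^-1 *: ((b i \o shift (x ord0 i)) (h *: (1 : R)) - b i (x ord0 i))) * c).
    apply/funext => h /=; rewrite tE -[x in tensor b x]add0r -(scale0r (delta_mx ord0 i)) tE.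
    by rewrite scale0r add0r /GRing.scale/= -mulrA mulrBl.
  rewrite E dE; apply: cvgMr_tmp; rewrite derive1E; exact: dbi.
by apply: DeriveDef; [apply/cvg_ex; eexists; exact: cv|exact: (cvg_lim _ cv)].
Qed.

Lemma partial_tensor b (i : 'I_n) : (forall x, derivable (b i) x (1 : R)) ->
  partial i (tensor b) = tensor (derive_at i b).
Proof.
by move=> db; apply/funext => x; apply: derive_val; exact: is_derive_tensor.
Qed.

Lemma tensor_continuous b : (forall i, continuous (b i)) -> continuous (tensor b).
Proof.
move=> cb; apply: continuous_big; first exact: mul_continuous.
move=> i _ x.
apply: (@continuous_comp _ _ _ (fun x : 'rV[R]_n => x ord0 i) (b i)).
  exact: coord_continuous.
exact: cb.
Qed.

(** A partial derivative only replaces one factor by its derivative, so all iterated partial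
    derivatives are again tensor products of smooth factors. *)
Lemma tensor_smooth b : (forall i, smooth1 (b i)) -> smooth (tensor b).
Proof.
move=> sb s.
suff [b' [sb' ->]] : exists b', (forall i, smooth1 (b' i)) /\
    foldr (@partial R n) (tensor b) s = tensor b'.
  split; first by apply: tensor_continuous => i; exact: smooth1_continuous.
  move=> i x; have /(is_derive_tensor (b := b')) : derivable (b' i) (x ord0 i) (1 : R).
    exact: smooth1_derivable.
  by move=> h; exact: ex_derive.
elim: s => [|i s [b' [sb' IH]]]; first by exists b.
exists (derive_at i b'); split.
  by move=> j; rewrite /derive_at; case: eqP => // _; exact: smooth1_derive.
by rewrite /= IH partial_tensor// => x; exact: smooth1_derivable.
Qed.

Lemma compact_cube_closure (A : set 'rV[R]_n) (r : R) :
  (forall x, A x -> forall i, `|x ord0 i| <= r) -> compact (closure A).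
Proof.
move=> Ar; pose K := [set x : 'rV[R]_n | forall i, `[- r, r]%classic (x ord0 i)].
have cK : compact K by apply: (rV_compact (A := fun=> `[- r, r]%classic)) => i;
  exact: segment_compact.
have clK : closed K.
  rewrite [K](_ : _ = \bigcap_(i in setT) ((fun x : 'rV[R]_n => x ord0 i) @^-1` `[- r, r]%classic)).
    apply: closed_bigI => i _; apply: closed_comp; last exact: interval_closed.
    by move=> x _; exact: coord_continuous.
  by apply/seteqP; split => [x Kx i _|x Kx i]; [exact: Kx|exact: (Kx i)].
apply: subclosed_compact cK _; first exact: closed_closure.
rewrite closureE => x; apply; split => // y Ay i.
by rewrite /= in_itv/= -ler_norml; exact: Ar.
Qed.

Lemma tensor_test b (r : R) : (forall i, smooth1 (b i)) ->
  (forall i x, r < `|x| -> b i x = 0) -> test_function (tensor b).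
Proof.
move=> sb br; split; first exact: tensor_smooth.
apply: (@compact_cube_closure _ r) => x /= tx i; rewrite leNgt; apply/negP => rx.
by move: tx; rewrite (tensorD1 _ i) br// mul0r eqxx.
Qed.

Lemma sqi_indic (A : set 'rV[R]_n) (M : R) : measurable A -> (leb A < +oo)%E ->
  sqi leb (fun x => M * \1_A x).
Proof.
move=> mA Aoo; apply: sqiZ; split; first exact: measurable_indic.
rewrite (eq_integral (fun x => (\1_A x)%:E)); first by rewrite integral_indic// setIT.
by move=> x _; rewrite indicE; case: (_ \in _); rewrite ?expr1n ?expr0n.
Qed.

Lemma sqi_bounded_support (f : 'rV[R]_n -> R) (M r : R) : 0 <= r ->
  measurable_fun setT f -> (forall x, `|f x| <= M) ->
  (forall x, ~ cube n r x -> f x = 0) -> sqi leb f.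
Proof.
move=> r0 mf fM fr.
have H : sqi leb (fun x => M * \1_(cube n r) x).
  by apply: sqi_indic; [exact: measurable_cube|rewrite lebesgue_cube// ltry].
apply: (sqi_bound mf H) => x.
have [xr|xr] := pselect (cube n r x).
  rewrite indicE mem_set// mulr1 -real_normK ?num_real//.
  by rewrite -[leRHS]real_normK ?num_real// ler_sqr ?nnegrE// (le_trans (fM x))// ler_norm.
by rewrite fr// expr0n sqr_ge0.
Qed.

Lemma compact_bounded_cube (K : set 'rV[R]_n) : compact K ->
  exists2 r : R, 0 <= r & K `<=` cube n r.
Proof.
move=> cK.
have H (i : 'I_n) : exists r : R, forall x, K x -> `|x ord0 i| <= r.
  have cc : {within K, continuous (fun x : 'rV[R]_n => x ord0 i)}.
    by apply: continuous_subspaceT; exact: coord_continuous.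
  have := continuous_compact cc cK.
  move=> /compact_bounded[M [_ HM]]; exists (M + 1) => x Kx.
  by apply: (HM (M + 1)); [rewrite ltrDl|exists x].
have [r Hr] := choice H.
exists (1 + \sum_i `|r i|); first by rewrite addr_ge0// sumr_ge0.
move=> x Kx; apply/cubeP => i; apply: (le_lt_trans (Hr i x Kx)).
rewrite (bigD1 i)//= ltr_pwDl//; apply: le_trans (ler_norm _) _.
by rewrite lerDl sumr_ge0.
Qed.

Lemma test_function_support (f : 'rV[R]_n -> R) : test_function f ->
  exists2 r : R, 0 <= r & forall x, ~ cube n r x -> f x = 0 /\ forall i, partial i f x = 0.
Proof.
move=> [sf cf]; have [r r0 Kr] := compact_bounded_cube cf.
exists r => // x xr.
have nx : ~ closure [set y | f y != 0] x by move/Kr.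
split.
  apply/eqP/negPn/negP => fx; apply: nx; exact: subset_closure.
(* Off its closed support [f] vanishes in a whole neighbourhood, and so do its partial derivatives
   there. *)
move=> i; apply: derive_val; apply: (near_eq_is_derive (f := fun=> 0)).
have : nbhs x (~` closure [set y | f y != 0]).
  by apply: open_nbhs_nbhs; split => //; apply: closed_openC; exact: closed_closure.
apply: filterS => y ny; apply/esym/eqP/negPn/negP => fy.
by apply: ny; exact: subset_closure.
Qed.

(** This makes both sides of the identity in [is_weak_partial] pairings in L^2, to which bilinearity
    and weak convergence apply. *)
Lemma test_function_sqi (f : 'rV[R]_n -> R) : test_function f ->
  sqi leb f /\ forall i, sqi leb (partial i f).
Proof.
move=> tf; have [sf cf] := tf; have [r r0 fr] := test_function_support tf.
have H (g : 'rV[R]_n -> R) : continuous g -> (forall x, ~ cube n r x -> g x = 0) -> sqi leb g.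
  move=> cg gr.
  have : compact (closure (cube n r)).
    by apply: (@compact_cube_closure _ r) => x /cubeP xr i; exact: ltW.
  move=> cK; have := continuous_compact (continuous_subspaceT cg) cK.
  move=> /compact_bounded[M [_ HM]].
  apply: (@sqi_bounded_support _ (`|M| + 1) r) => //; first exact: continuous_measurable_rV.
  move=> x; have [xr|xr] := pselect (cube n r x).
    apply: (HM (`|M| + 1)); first by apply: le_lt_trans (ler_norm M) _; rewrite ltrDl.
    by exists x => //; exact: subset_closure.
  by rewrite gr// normr0 addr_ge0.
split.
  by apply: H; [have [] := sf [::]|move=> x /fr[]].
by move=> i; apply: H; [have [] := sf [:: i]|move=> x /fr[_]].
Qed.

End tensor.

(** * Measures with a density *)

Section density.
Context d (T : measurableType d) (R : realType) (mu : {measure set T -> \bar R}).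
Variables (g : T -> R) (mg : measurable_fun setT g).

(** The absolute value makes this a measure for every measurable [g]; it will be applied to positive
    and negative parts, which it leaves unchanged. *)
Definition density (A : set T) : \bar R := (\int[mu]_(x in A) `|g x|%:E)%E.

Let density0 : density set0 = 0%E. Proof. exact: integral_set0. Qed.

Let density_ge0 A : (0 <= density A)%E.
Proof. by apply: integral_ge0 => x _; rewrite lee_fin. Qed.

Let density_sigma_additive : semi_sigma_additive density.
Proof.
move=> F mF tF mUF; rewrite /density ge0_integral_bigcup//.
- by apply: is_cvg_nneseries => n _ _; exact: density_ge0.
- apply/measurable_EFinP; apply: measurableT_comp => //.
  exact: measurable_funTS.
Qed.

HB.instance Definition _ := isMeasure.Build _ _ _ density
  density0 density_ge0 density_sigma_additive.

Definition density_measure : {measure set T -> \bar R} := density.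

End density.

(** * The fundamental lemma of the calculus of variations *)

Section fundamental_lemma.
Context {R : realType} {n : nat}.
Local Notation leb := (@lebesgue_rV R n).
Implicit Types w : 'rV[R]_n -> R.

Lemma tensor_steep_bump_le (a b : 'rV[R]_n) k x :
  0 <= tensor (fun i => steep_bump (a ord0 i) (b ord0 i) k) x <= \1_(box a b) x.
Proof.
rewrite /tensor prodr_ge0 => [/=|i _]; last exact: steep_bump_ge0.
have [xab|xab] := pselect (box a b x).
  rewrite indicE mem_set//; apply: prodr_ile1 => i _.
  rewrite steep_bump_ge0/=; apply: le_trans (steep_bump_le _ _ _ _) _.
  by rewrite indicE; case: (_ \in _).
have [i xi] : exists i, ~ `]a ord0 i, b ord0 i[%classic (x ord0 i).
  by apply/existsNP.
rewrite (bigD1 i)//= [X in X * _](_ : _ = 0) ?mul0r//.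
apply/eqP; rewrite eq_le steep_bump_ge0 andbT.
by apply: le_trans (steep_bump_le _ _ _ _) _; rewrite indicE memNset.
Qed.

Lemma tensor_steep_bump_cvg (a b : 'rV[R]_n) x :
  tensor (fun i => steep_bump (a ord0 i) (b ord0 i) k) x @[k --> \oo]
    --> (\1_(box a b) x : R).
Proof.
have -> : \1_(box a b) x = \prod_(i < n) \1_(`]a ord0 i, b ord0 i[%classic) (x ord0 i) :> R.
  have [xab|xab] := pselect (box a b x).
    rewrite indicE mem_set// big1// => i _.
    by rewrite indicE mem_set//; exact: xab.
  have [i xi] : exists i, ~ `]a ord0 i, b ord0 i[%classic (x ord0 i).
    by apply/existsNP.
  by rewrite indicE memNset// (bigD1 i)//= indicE memNset// mul0r.
apply: cvg_big; first exact: mul_continuous.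
by move=> i _; exact: steep_bump_cvg.
Qed.

Lemma sqi_box (a b : 'rV[R]_n) : sqi leb (\1_(box a b) : 'rV[R]_n -> R).
Proof.
have := sqi_indic 1 (measurable_box a b); rewrite lebesgue_box ltry => /(_ isT).
by congr sqi; apply/funext => x; rewrite mul1r.
Qed.

Definition orthogonal_to_tensors w := forall (b : 'I_n -> R -> R) (r : R),
  (forall i, smooth1 (b i)) -> (forall i x, r < `|x| -> b i x = 0) ->
  ip leb w (tensor b) = 0.

(** The tensor products of steep bumps converge to the indicator of the box and stay below it, so
    dominated convergence passes the orthogonality to the limit. *)
Lemma orthogonal_box w (a b : 'rV[R]_n) : sqi leb w ->
  orthogonal_to_tensors w -> ip leb w (\1_(box a b)) = 0.
Proof.
move=> sw ow; have [mw _] := sw.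
pose phi k := tensor (fun i => steep_bump (a ord0 i) (b ord0 i) k).
pose r := \sum_i (`|a ord0 i| + `|b ord0 i|).
have ow0 k : ip leb w (phi k) = 0.
  apply: (ow _ r) => [i|i x rx]; first exact: smooth1_steep_bump.
  apply/eqP; rewrite eq_le steep_bump_ge0 andbT.
  apply: le_trans (steep_bump_le _ _ _ _) _; rewrite indicE memNset//=.
  rewrite in_itv/= => /andP[h1 h2]; move: rx; apply/negP; rewrite -leNgt.
  apply: (@le_trans _ _ (`|a ord0 i| + `|b ord0 i|)); last first.
    by rewrite /r (bigD1 i)//= lerDl sumr_ge0// => j _; rewrite addr_ge0.
  rewrite ler_norml; have := ler_norm (- a ord0 i); have := ler_norm (b ord0 i).
  rewrite normrN; have := normr_ge0 (a ord0 i); have := normr_ge0 (b ord0 i).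
  by move=> *; apply/andP; split; lra.
have mphi k : measurable_fun setT (phi k).
  apply: continuous_measurable_rV; apply: tensor_continuous => i.
  by apply: smooth1_continuous; exact: smooth1_steep_bump.
have sB := sqi_box a b; have [mB _] := sB.
have := @dominated_cvg _ _ _ leb setT measurableT
  (fun k (x : 'rV[R]_n) => (w x * phi k x)%:E : \bar R)
  (fun x : 'rV[R]_n => (w x * \1_(box a b) x)%:E : \bar R)
  (fun x : 'rV[R]_n => `|w x * \1_(box a b) x|%:E : \bar R).
move=> H.
have {}H : (\int[leb]_x (w x * phi k x)%:E)%E @[k --> \oo] -->
    (\int[leb]_x (w x * \1_(box a b) x)%:E)%E.
  apply: H.
  - by move=> k; apply/measurable_EFinP; exact: measurable_funM.
  - move=> x _; apply: cvg_EFin; first exact: nearW.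
    by apply: cvgMl_tmp; exact: tensor_steep_bump_cvg.
  - by [].
  - exact: integrable_abse (sqi_integrable sw sB).
  - move=> k x _ /=; rewrite lee_fin !normrM ler_wpM2l//.
    have /andP[h1 h2] := tensor_steep_bump_le a b k x.
    by rewrite ger0_norm// (le_trans h2)// ler_norm.
have {}H : (0%E : \bar R) @[k --> \oo] --> (\int[leb]_x (w x * \1_(box a b) x)%:E)%E.
  have E : (fun k => \int[leb]_x (w x * phi k x)%:E)%E = (fun=> 0%E).
    apply/funext => k; rewrite ipE ?ow0//; apply: (sqi_bound (mphi k) sB) => x.
    have /andP[h1 h2] := tensor_steep_bump_le a b k x.
    by rewrite ler_sqr ?nnegrE// (le_trans h1).
  by rewrite E in H.
have E0 : (ip leb w (\1_(box a b)))%:E = 0%E.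
  rewrite -ipE// -(cvg_lim (@ereal_hausdorff R) H); apply: lim_cst.
  exact: ereal_hausdorff.
exact: (EFin_inj E0).
Qed.

(** Write [w = p - m] with the positive and negative parts. The measures with densities [p] and [m]
    agree on boxes, hence on the set where [w > 0]; there [m] vanishes, so [p] has integral 0 on it
    and the set is null. *)
Lemma orthogonal_le0 w : sqi leb w -> orthogonal_to_tensors w ->
  \forall x \ae leb, w x <= 0.
Proof.
move=> sw ow; have [mw _] := sw.
pose p x := Num.max (w x) 0; pose m x := Num.max (- w x) 0.
have mp : measurable_fun setT p by exact: measurable_maxr.
have mm : measurable_fun setT m by apply: measurable_maxr => //; exact: measurableT_comp.
have p0 x : 0 <= p x by rewrite le_max lexx orbT.
have m0 x : 0 <= m x by rewrite le_max lexx orbT.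
have wE x : w x = p x - m x.
  rewrite /p /m; have [h|h] := leP 0 (w x).
    by rewrite max_r ?subr0// oppr_le0.
  by rewrite max_l ?opprK ?add0r// oppr_ge0 ltW.
have sp : sqi leb p.
  apply: (sqi_bound mp sw) => x; rewrite -[leRHS]real_normK ?num_real//.
  by rewrite ler_sqr ?nnegrE// ge_max normr_ge0 ler_norm.
have sm : sqi leb m.
  apply: (sqi_bound mm sw) => x; rewrite -[leRHS]real_normK ?num_real//.
  by rewrite ler_sqr ?nnegrE// ge_max normr_ge0 -normrN ler_norm.
have dE (f : 'rV[R]_n -> R) (a b : 'rV[R]_n) : (forall x, 0 <= f x) -> sqi leb f ->
    density leb f (box a b) = (ip leb f (\1_(box a b)))%:E.
  move=> f0 sf; rewrite -ipE//; last exact: sqi_box.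
  rewrite /density integral_mkcond; apply: eq_integral => x _.
  by rewrite patchE indicE; case: (_ \in _); rewrite ?mulr1 ?mulr0 ?ger0_norm.
have pm A : measurable A -> density_measure leb mp A = density_measure leb mm A.
  apply: rV_measure_unique => a b; rewrite /= !dE//; last by rewrite ltry.
  congr EFin; apply/eqP; rewrite -subr_eq0 -ipBl//; last exact: sqi_box.
  rewrite -(orthogonal_box a b sw ow); apply/eqP; congr ip.
  by apply/funext => x; rewrite wE.
pose A := [set x | 0 < w x].
have mA : measurable A.
  rewrite (_ : A = w @^-1` `]0, +oo[%classic); first by rewrite -[X in measurable X]setTI;
    exact: mw.
  by apply/seteqP; split => x /=; rewrite in_itv/= andbT.
have : density leb p A = 0%E.
  have /= -> := pm A mA; rewrite /density integral0_eq// => x /= wx.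
  by rewrite /m max_r ?normr0// oppr_le0 ltW.
rewrite /density => pA.
have : (\int[leb]_(x in A) `|(p x)%:E| = 0)%E by exact: pA.
move=> /(ae_eq_integral_abs _ mA).
have mpA : measurable_fun A (fun x => (p x)%:E).
  by apply/measurable_EFinP; exact: measurable_funTS.
move=> /(_ mpA); apply: filterS => x H.
rewrite leNgt; apply/negP => wx; have := H wx; rewrite /p max_l ?(ltW wx)//.
by move=> [w0]; move: wx; rewrite w0 ltxx.
Qed.

Lemma fundamental_lemma w : sqi leb w -> orthogonal_to_tensors w ->
  w = (fun=> 0) %[ae leb].
Proof.
move=> sw ow.
have sN : sqi leb (fun x => -1 * w x) by exact: sqiZ.
have := orthogonal_le0 sN; move=> H.
have {}H : \forall x \ae leb, -1 * w x <= 0.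
  apply: H => b r sb br; rewrite ipZl ?(ow b r)// ?mulr0//.
  by have [] := test_function_sqi (tensor_test sb br).
have := orthogonal_le0 sw ow; move: H; apply: filterS2 => x h1 h2 _.
by apply/eqP; rewrite eq_le h2/=; lra.
Qed.

End fundamental_lemma.

(** * Translations of weakly differentiable functions *)

Section norm.
Context d (T : measurableType d) (R : realType) (mu : {measure set T -> \bar R}).
Implicit Types f g : T -> R.
Local Notation sqi := (sqi mu).

Definition l2n f : R := Num.sqrt (ip mu f f).

Lemma l2n_ge0 f : 0 <= l2n f. Proof. exact: sqrtr_ge0. Qed.

Lemma sqr_l2n f : l2n f ^+ 2 = ip mu f f.
Proof. by rewrite sqr_sqrtr// ip_ge0. Qed.

Lemma ip_le_l2n f g : sqi f -> sqi g -> `|ip mu f g| <= l2n f * l2n g.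
Proof.
move=> sf sg; rewrite -ler_sqr ?nnegrE ?mulr_ge0 ?l2n_ge0//.
by rewrite real_normK ?num_real// exprMn !sqr_l2n; exact: cauchy_schwarz.
Qed.

Lemma l2nD f g : sqi f -> sqi g -> l2n (fun x => f x + g x) <= l2n f + l2n g.
Proof.
move=> sf sg; rewrite -ler_sqr ?nnegrE ?addr_ge0 ?l2n_ge0//.
rewrite sqr_l2n ip_sqrD// sqrrD !sqr_l2n.
have := le_trans (ler_norm _) (ip_le_l2n sf sg).
lra.
Qed.

End norm.

Section weak_translation.
Context {R : realType} {n : nat}.
Local Notation leb := (@lebesgue_rV R n).
Local Notation mu := (@lebesgue_measure R).
Local Notation sqi := (sqi leb).
Local Notation l2n := (l2n leb).
Implicit Types u g phi : 'rV[R]_n -> R.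

Lemma l2n_shift (h : 'rV[R]_n) u : sqi u -> l2n (fun x => u (x + h)) = l2n u.
Proof. by move=> su; rewrite /l2n ip_shift. Qed.

Section average.
Variables (i : 'I_n) (t : R) (g : 'rV[R]_n -> R).
Hypotheses (t0 : 0 < t) (sg : sqi g).
Local Notation e := (delta_mx ord0 i : 'rV[R]_n).

Let chi : measurableTypeR R -> R := \1_(`[0, t]%classic : set R).

Let mchi : measurable_fun setT chi.
Proof. by apply: measurable_indic; exact: measurable_itv. Qed.

(** Integrated over both variables, this pairs [phi] with the integral of the translates
    [g (x + s e)] over [s] in [0, t], after the translation has been moved from [g] to [phi]. *)
Definition avg_kernel phi (p : measurableTypeR R * 'rV[R]_n) : R :=
  chi p.1 * (g p.2 * phi (p.2 - p.1 *: e)).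

Lemma measurable_sub_scale :
  measurable_fun setT (fun p : measurableTypeR R * 'rV[R]_n => p.2 - p.1 *: e).
Proof.
apply: measurable_fun_rV => j; under eq_fun do rewrite !mxE.
apply: measurable_funB.
  exact: (measurableT_comp (measurable_coord j) measurable_snd).
by apply: measurable_funM => //; exact: measurable_fst.
Qed.

Lemma measurable_avg_kernel phi : sqi phi -> measurable_fun setT (avg_kernel phi).
Proof.
move=> [mphi _]; have [mg _] := sg; apply: measurable_funM.
  exact: (measurableT_comp mchi measurable_fst).
apply: measurable_funM.
  exact: (measurableT_comp mg measurable_snd).
exact: (measurableT_comp mphi measurable_sub_scale).
Qed.

Lemma integral_chi (c : R) : 0 <= c -> (\int[mu]_s (chi s * c)%:E = (c * t)%:E)%E.
Proof.
move=> c0; under eq_integral do rewrite mulrC EFinM.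
rewrite ge0_integralZl//.
- rewrite integral_indic//.
  rewrite setIT [X in (c%:E * X)%E](_ : _ = t%:E)//.
  by have := @lebesgue_measure_itv R `[0, t]; rewrite /= lte_fin t0 -EFinB subr0.
- exact/measurable_EFinP.
- by move=> s _; rewrite lee_fin /chi indicE.
Qed.

(** For fixed [s] the Cauchy-Schwarz inequality bounds the integral in [x] by [l2n g * l2n phi],
    independently of [s] as translations preserve the norm, and [chi] restricts [s] to length
    [t]. *)
Lemma integrable_avg_kernel phi : sqi phi ->
  (mu \x leb)%E.-integrable setT (EFin \o avg_kernel phi).
Proof.
move=> sphi; have mk := measurable_avg_kernel sphi.
apply/integrable12ltyP; first exact/measurable_EFinP.
apply: (@le_lt_trans _ _ (\int[mu]_s (chi s * (l2n g * l2n phi))%:E)%E); last first.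
  by rewrite integral_chi ?mulr_ge0 ?l2n_ge0// ltry.
apply: ge0_le_integral => //.
- by move=> s _; exact: integral_ge0.
- apply: (measurable_fun_fubini_tonelli_F (m2 := leb)
    (fun p => (`|(EFin \o avg_kernel phi) p|)%E)) => //.
  by apply: measurableT_comp => //; exact/measurable_EFinP.
- by apply/measurable_EFinP; apply: measurable_funM.
move=> s _ /=.
have ss : sqi (fun x => phi (x - s *: e)) by exact: (sqi_shift (- (s *: e)) sphi).
have la f : l2n (fun x => `|f x|) = l2n f by rewrite /l2n ip_norm.
under eq_integral do rewrite /avg_kernel/= normrM EFinM.
rewrite ge0_integralZl//; last first.
  have [mg _] := sg; have [ms _] := ss.
  by apply/measurable_EFinP; apply: measurableT_comp => //; exact: measurable_funM.
under eq_integral do rewrite normrM.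
rewrite ipE; [|exact: sqi_norm..].
rewrite -EFinM lee_fin ger0_norm ?indicE// ler_wpM2l//.
apply: le_trans (ler_norm _) _; apply: le_trans (ip_le_l2n (sqi_norm sg) (sqi_norm ss)) _.
by rewrite !la (l2n_shift (- (s *: e)) sphi).
Qed.

Lemma avg_kernel_inner phi s : sqi phi ->
  (\int[leb]_x (avg_kernel phi (s, x))%:E = (chi s * ip leb g (fun x => phi (x - s *: e)))%:E)%E.
Proof.
move=> sphi.
have ss : sqi (fun x => phi (x - s *: e)) by exact: (sqi_shift (- (s *: e)) sphi).
under eq_integral do rewrite /avg_kernel/= EFinM.
rewrite integralZl//; last exact: (sqi_integrable sg ss).
by rewrite ipE.
Qed.

Lemma integrable_avg phi : sqi phi ->
  mu.-integrable setT (fun s => (chi s * ip leb g (fun x => phi (x - s *: e)))%:E).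
Proof.
move=> sphi; have := integrable_fubini_F (integrable_avg_kernel sphi).
by congr integrable; apply/funext => s; rewrite /fubini_F /= avg_kernel_inner.
Qed.

(** The average of the translates of [g] is introduced as a functional, so that no function with
    values in L^2 has to be integrated; [avg_form_represented] then supplies the function. *)
Definition avg_form phi : R :=
  (\int[mu]_s (chi s * ip leb g (fun x => phi (x - s *: e))))%R.

Lemma avg_form_represented : exists2 h, sqi h &
  l2n h <= t * l2n g /\ forall phi, sqi phi -> avg_form phi = ip leb h phi.
Proof.
have sh phi s : sqi phi -> sqi (fun x => phi (x - s *: e)).
  by move=> sphi; exact: (sqi_shift (- (s *: e)) sphi).
have bnd phi : sqi phi -> `|avg_form phi| <= t * l2n g * l2n phi.
  move=> sphi; apply: le_trans (le_normr_Rintegral _ (integrable_avg sphi)) _ => //.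
  rewrite -lee_fin /Rintegral fineK; last first.
    apply: integrable_fin_num => //; exact: (integrable_norm (integrable_avg sphi)).
  have -> : (t * l2n g * l2n phi)%:E = (\int[mu]_s (chi s * (l2n g * l2n phi))%:E)%E.
    by rewrite integral_chi ?mulr_ge0 ?l2n_ge0//; congr EFin; ring.
  apply: ge0_le_integral => //.
  - have /measurable_int := integrable_avg sphi.
    by move=> /measurable_EFinP ms; apply/measurable_EFinP; exact: measurableT_comp.
  - by apply/measurable_EFinP; exact: measurable_funM.
  move=> s _; rewrite lee_fin normrM ger0_norm ?indicE// ler_wpM2l//.
  by rewrite -(l2n_shift (- (s *: e)) sphi); apply: ip_le_l2n => //; exact: sh.
have [||||h sh' hL] := @riesz_representation _ _ _ leb avg_form ((t * l2n g) ^+ 2).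
- exact: sqr_ge0.
- move=> f1 f2 s1 s2; rewrite /avg_form -RintegralD//; [|exact: integrable_avg..].
  by apply: eq_Rintegral => s _; rewrite ipDr ?mulrDr//; exact: sh.
- move=> a f sf; rewrite /avg_form -RintegralZl//; last exact: integrable_avg.
  by apply: eq_Rintegral => s _; rewrite (ipZr a (sh f s sf) sg) mulrCA.
- move=> f sf; rewrite -sqr_l2n -exprMn -[leLHS]real_normK ?num_real//.
  by rewrite ler_sqr ?nnegrE ?bnd// ?mulr_ge0 ?l2n_ge0// ltW.
exists h => //; split => [|phi sphi]; last exact: hL.
(* Testing with [phi = h] gives [l2n h ^+ 2 <= t * l2n g * l2n h]. *)
have := bnd h sh'; rewrite hL// -sqr_l2n ger0_norm ?sqr_ge0//.
have := l2n_ge0 leb h; rewrite le_eqVlt => /predU1P[<- _|h0].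
  by rewrite mulr_ge0 ?l2n_ge0// ltW.
by rewrite expr2 ler_pM2r.
Qed.

Lemma tensor_shift (b : 'I_n -> R -> R) x (s : R) :
  tensor b (x - s *: e) = b i (x ord0 i - s) * \prod_(j < n | j != i) b j (x ord0 j).
Proof.
rewrite (tensorD1 _ i) !mxE !eqxx mulr1; congr (_ * _); apply: eq_bigr => j ji.
by rewrite !mxE (negbTE ji) andbF mulr0 subr0.
Qed.

Section avg_tensor.
Variables (b : 'I_n -> R -> R) (r : R).
Hypotheses (sb : forall j, smooth1 (b j)) (br : forall j x, r < `|x| -> b j x = 0).

(** Only the factor in direction [i] is averaged; the derivative of the resulting tensor product in
    that direction is a difference of translates of [tensor b]. *)
Definition avg_profile : 'I_n -> R -> R :=
  fun j => if j == i then fun y => primitive (b i) y - primitive (b i) (y - t) else b j.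

Lemma avg_profile_test : test_function (tensor avg_profile).
Proof.
apply: (@tensor_test _ _ _ (r + t)) => j; rewrite /avg_profile; case: eqP => _ //.
- exact: smooth1_shifted_average (sb i) (br i) _.
- by move=> x; apply: (shifted_average_supp (sb i) (br i) t0).
- by move=> x rx; apply: br; apply: lt_trans rx; rewrite ltrDl.
Qed.

Lemma sqi_tensor : sqi (tensor b).
Proof. by have [] := test_function_sqi (tensor_test sb br). Qed.

(** By Fubini the integral over [s] comes first. It acts on the [i]-th factor alone and turns it
    into its moving integral. *)
Lemma avg_form_tensor : avg_form (tensor b) = ip leb g (tensor avg_profile).
Proof.
have sphi := sqi_tensor.
rewrite /avg_form /ip /Rintegral.
under eq_integral do rewrite -avg_kernel_inner//.
rewrite (Fubini (integrable_avg_kernel sphi)); congr fine.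
apply: eq_integral => x _ /=.
pose c := \prod_(j < n | j != i) b j (x ord0 j).
have E s : avg_kernel (tensor b) (s, x) = (g x * c) * (chi s * b i (x ord0 i - s)).
  by rewrite /avg_kernel/= tensor_shift -/c; ring.
under eq_integral do rewrite E EFinM.
have cb : continuous (fun s => b i (x ord0 i - s)).
  move=> s; apply: (@continuous_comp _ _ _ (fun s => x ord0 i - s) (b i)).
    by apply: continuousB; [exact: cst_continuous|exact: cvg_id].
  exact: smooth1_continuous.
have ib : mu.-integrable `[0, t] (EFin \o (fun s => b i (x ord0 i - s))).
  apply: continuous_compact_integrable; first exact: segment_compact.
  exact: continuous_subspaceT.
have chiE : (fun s => (chi s * b i (x ord0 i - s))%:E) =
    (EFin \o (fun s => b i (x ord0 i - s))) \_ `[0, t].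
  apply/funext => s; rewrite patchE /chi indicE.
  by case: (_ \in _); rewrite ?mul1r ?mul0r.
rewrite integralZl//; last first.
  by rewrite chiE -integrable_mkcond//; exact: measurable_itv.
rewrite [X in (_ * X)%E](_ : _ =
    (\int[mu]_(s in `[0, t]) b i (x ord0 i - s))%R%:E); last first.
  rewrite /Rintegral fineK; last exact: integrable_fin_num.
  by rewrite [RHS]integral_mkcond; apply: eq_integral => s _; rewrite -chiE.
rewrite (shifted_average (sb i) (br i))// -EFinM; congr EFin.
rewrite (tensorD1 _ i) /avg_profile eqxx -mulrA; congr (_ * _).
rewrite mulrC; congr (_ * _).
by apply: eq_bigr => j /negbTE ->.
Qed.

Lemma partial_avg_profile : partial i (tensor avg_profile) =
  (fun x => tensor b x - tensor b (x - t *: e)).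
Proof.
rewrite partial_tensor; last first.
  move=> x; rewrite /avg_profile eqxx; apply: smooth1_derivable.
  exact: smooth1_shifted_average (sb i) (br i) _.
apply/funext => x; rewrite tensor_shift !(tensorD1 _ i) /derive_at eqxx -mulrBl.
congr (_ * _); last first.
  by apply: eq_bigr => j /negbTE ji; rewrite /avg_profile ji.
rewrite {1}/avg_profile eqxx; exact: derive_shifted_average (sb i) (br i) _ _.
Qed.

End avg_tensor.

(* Tested against a tensor product, [u (x + t e) - u x] and the average of the
   translates of [g] agree: a difference of translates of a test function is
   the partial derivative of its shifted average. *)
Lemma l2n_weak_translation u : sqi u -> is_weak_partial i u g ->
  l2n (fun x => u (x + t *: e) - u x) <= t * l2n g.
Proof.
move=> su ug; have [h sh [hg hL]] := avg_form_represented.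
have sw : sqi (fun x => u (x + t *: e) - u x) by apply: sqiB => //; exact: sqi_shift.
have swh : sqi (fun x => u (x + t *: e) - u x - h x) by exact: sqiB.
(* Since [h] represents the average of the translates of [g], it remains to see that the difference
   is orthogonal to all tensor products. *)
suff w0 : (fun x => u (x + t *: e) - u x - h x) = (fun=> 0) %[ae leb].
  apply: le_trans hg; rewrite /l2n le_eqVlt; apply/orP; left; apply/eqP.
  congr Num.sqrt; apply: ae_ip => //; move: w0; apply: filterS => x /= H _;
    by apply/eqP; rewrite -subr_eq0 H.
apply: fundamental_lemma => // b r sb br.
have sphi := sqi_tensor sb br.
rewrite (ipBl sw sh sphi) -hL// (avg_form_tensor sb br).
rewrite (ipBl (sqi_shift (t *: e) su) su sphi).
have := ug _ (avg_profile_test sb br); rewrite (partial_avg_profile sb br).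
have s2 : sqi (fun x => tensor b (x - t *: e)) by exact: (sqi_shift (- (t *: e)) sphi).
have -> : (\int[leb]_x (u x * (tensor b x - tensor b (x - t *: e))) =
    ip leb u (tensor b) - ip leb u (fun x => tensor b (x - t *: e)))%R.
  by rewrite -(ipBr sphi s2 su).
have -> : ip leb u (fun x => tensor b (x - t *: e)) =
    ip leb (fun x => u (x + t *: e)) (tensor b).
  rewrite -(ip_shift (t *: e) su s2); congr ip; apply/funext => x.
  by rewrite addrK.
by rewrite /ip => H; move: H; lra.
Qed.

End average.

(** For [t < 0] the difference is, up to sign, a translate of the one for [- t]. *)
Lemma weak_translation_abs i (t : R) u g : sqi u -> sqi g -> is_weak_partial i u g ->
  l2n (fun x => u (x + t *: delta_mx ord0 i) - u x) <= `|t| * l2n g.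
Proof.
move=> su sg ug; have [t0|t0|->] := ltgtP t 0.
- have su' : sqi (fun x => u (x + - t *: delta_mx ord0 i) - u x).
    by apply: sqiB => //; exact: sqi_shift.
  rewrite ltr0_norm//; have := l2n_weak_translation (i := i) (t := - t) (g := g).
  rewrite oppr_gt0 => /(_ t0 sg u su ug).
  rewrite -(l2n_shift (t *: delta_mx ord0 i) su').
  rewrite /l2n [X in Num.sqrt X <= _ -> _](_ : _ =
    ip leb (fun x => u (x + t *: delta_mx ord0 i) - u x)
      (fun x => u (x + t *: delta_mx ord0 i) - u x)) //.
  by apply: eq_Rintegral => x _; rewrite scaleNr addrK; ring.
- by rewrite gtr0_norm//; exact: l2n_weak_translation.
- rewrite normr0 mul0r /l2n /ip.
  rewrite (@eq_Rintegral _ _ _ _ _ (fun=> 0)); first by rewrite Rintegral_cst// mul0r sqrtr0.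
  by move=> x _; rewrite scale0r addr0 subrr mul0r.
Qed.

(** The vector [h] is reached one coordinate at a time: [hk k] keeps its first [k] coordinates, and
    the triangle inequality adds up the steps. *)
Lemma l2n_translation (u : 'rV[R]_n -> R) (g : 'I_n -> 'rV[R]_n -> R) (h : 'rV[R]_n) :
  sqi u -> (forall i, sqi (g i) /\ is_weak_partial i u (g i)) ->
  l2n (fun x => u (x + h) - u x) <= \sum_i `|h ord0 i| * l2n (g i).
Proof.
move=> su Hg.
pose hk k : 'rV[R]_n := \row_j (if (j < k)%N then h ord0 j else 0).
have shk k : sqi (fun x => u (x + hk k) - u x) by apply: sqiB => //; exact: sqi_shift.
have key k : l2n (fun x => u (x + hk k) - u x) <=
    \sum_(i < n | (i < k)%N) `|h ord0 i| * l2n (g i).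
  elim: k => [|k IH].
    rewrite big1// /l2n /ip.
    rewrite (@eq_Rintegral _ _ _ _ _ (fun=> 0)); first by rewrite Rintegral_cst// mul0r sqrtr0.
    move=> x _; rewrite (_ : hk 0%N = 0) ?addr0 ?subrr ?mul0r//.
    by apply/rowP => j; rewrite !mxE.
  have [kn|nk] := ltnP k n; last first.
    have -> : hk k.+1 = hk k.
      by apply/rowP => j; rewrite !mxE !(leq_trans (ltn_ord j))// ltnW.
    apply: le_trans IH _; rewrite le_eqVlt; apply/orP; left; apply/eqP.
    by apply: eq_bigl => j; rewrite !(leq_trans (ltn_ord j))// ltnW.
  pose i := Ordinal kn.
  have hkS : hk k.+1 = h ord0 i *: delta_mx ord0 i + hk k.
    apply/rowP => j; rewrite !mxE eqxx/= ltnS leq_eqVlt.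
    have [->|ji] := eqVneq j i; first by rewrite eqxx/= ltnn mulr1 addr0.
    have -> : ((j : nat) == k) = false by apply/negbTE.
    by rewrite mulr0 add0r.
  rewrite (bigD1 i)//= [X in _ + X](eq_bigl (fun j : 'I_n => (j < k)%N)); last first.
    move=> j; rewrite ltnS leq_eqVlt; have [->|ji] := eqVneq j i.
      by rewrite ltnn andbF.
    by rewrite andbT (_ : ((j : nat) == k) = false)//; apply/negbTE.
  have [sgi ugi] := Hg i.
  have si : sqi (fun x => u (x + h ord0 i *: delta_mx ord0 i) - u x).
    by apply: sqiB => //; exact: sqi_shift.
  apply: le_trans (lerD (weak_translation_abs (h ord0 i) su sgi ugi) IH).
  rewrite -(l2n_shift (hk k) si).
  apply: le_trans (l2nD (sqi_shift (hk k) si) (shk k)).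
  rewrite le_eqVlt; apply/orP; left; apply/eqP; congr Num.sqrt; congr ip.
    apply/funext => x; rewrite hkS.
    have -> : x + (h ord0 i *: delta_mx ord0 i + hk k) = x + hk k + h ord0 i *: delta_mx ord0 i.
      by rewrite addrA addrAC.
    by rewrite addrA subrK.
  apply/funext => x; rewrite hkS.
  have -> : x + (h ord0 i *: delta_mx ord0 i + hk k) = x + hk k + h ord0 i *: delta_mx ord0 i.
    by rewrite addrA addrAC.
  by rewrite addrA subrK.
have := key n.
rewrite (_ : hk n = h); last by apply/rowP => j; rewrite mxE ltn_ord.
by rewrite (eq_bigl xpredT)// => j; rewrite ltn_ord.
Qed.

End weak_translation.

(** * Local compactness *)

Section grid.
Context {R : realType} {n : nat}.
Local Notation leb := (@lebesgue_rV R n).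
Local Notation sqi := (sqi leb).
Local Notation l2n := (l2n leb).
Local Notation ip := (ip leb).
Implicit Types v : 'rV[R]_n -> R.

Lemma measurable_comp_fst v : measurable_fun setT v ->
  measurable_fun setT (fun p : 'rV[R]_n * 'rV[R]_n => v p.1).
Proof. by move=> mv; exact: (measurableT_comp mv measurable_fst). Qed.

Lemma measurable_comp_snd v : measurable_fun setT v ->
  measurable_fun setT (fun p : 'rV[R]_n * 'rV[R]_n => v p.2).
Proof. by move=> mv; exact: (measurableT_comp mv measurable_snd). Qed.

Definition restr (C : set 'rV[R]_n) v : 'rV[R]_n -> R := fun x => \1_C x * v x.

Lemma indic01 C (x : 'rV[R]_n) : 0 <= (\1_C x : R).
Proof. by rewrite indicE. Qed.

Lemma sqi_restr C v : measurable C -> sqi v -> sqi (restr C v).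
Proof.
move=> mC sv; have [mv _] := sv; apply: (sqi_bound _ sv).
  by apply: measurable_funM => //; exact: measurable_indic.
move=> x; rewrite /restr indicE; case: (_ \in _); rewrite ?mul1r//.
by rewrite mul0r expr0n sqr_ge0.
Qed.

(** The variance identity on [C]: expanding the square, the diagonal terms give twice the measure
    times the integral of the square, and the cross term gives the square of the integral. *)
Lemma oscillation_integral (C : set 'rV[R]_n) v : measurable C -> (leb C < +oo)%E ->
  sqi v ->
  (\int[leb]_x \int[leb]_y (\1_C x * \1_C y * (v x - v y) ^+ 2)%:E =
   (2 * (fine (leb C) * ip (restr C v) (restr C v)) - 2 * ip v (\1_C) ^+ 2)%:E)%E.
Proof.
move=> mC Coo sv.
pose chi : 'rV[R]_n -> R := \1_C.
have schi : sqi chi.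
  by have := sqi_indic 1 mC Coo; congr sqi; apply/funext => x; rewrite mul1r.
have chi2 x : chi x * chi x = chi x.
  by rewrite /chi indicE; case: (_ \in _); rewrite ?mulr1 ?mulr0.
pose p := restr C v; have sp : sqi p by exact: sqi_restr.
have AE : ip chi chi = fine (leb C).
  rewrite /ip /Rintegral (eq_integral (fun x => (\1_C x)%:E)) => [|x _]; last by rewrite chi2.
  by rewrite integral_indic// setIT.
have mE : ip chi p = ip v chi.
  by apply: eq_Rintegral => x _; rewrite /p /restr mulrA chi2 mulrC.
pose A := fine (leb C); pose m := ip v chi; pose S := ip p p.
have inner x : (\int[leb]_y (\1_C x * \1_C y * (v x - v y) ^+ 2)%:E =
    ((A * p x * p x)%:E - ((2 * m * p x * chi x)%:E - (S * chi x * chi x)%:E))%E)%E.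
  transitivity (\int[leb]_y ((chi x)%:E * ((v x * chi y - p y) * (v x * chi y - p y))%:E))%E.
    apply: eq_integral => y _; rewrite -EFinM; congr EFin.
    by rewrite /p /restr -/chi; rewrite -{1}(chi2 y); ring.
  have sd : sqi (fun y => v x * chi y - p y) by apply: sqiB => //; exact: sqiZ.
  rewrite integralZl//; last exact: (sqi_integrable sd sd).
  rewrite ipE// -EFinM -!EFinB; congr EFin.
  rewrite (ip_sqrB (sqiZ (v x) schi) sp) ip_sqrZ// ipZl// AE mE -/m -/S -/A.
  have pE : p x = chi x * v x by [].
  have [c0|c1] : chi x = 0 \/ chi x = 1.
    by rewrite /chi indicE; case: (_ \in _); [right|left].
  - by rewrite pE c0; ring.
  - by rewrite pE c1; ring.
under eq_integral do rewrite inner.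
have i1 := sqi_integrable (sqiZ A sp) sp.
have i2 := sqi_integrable (sqiZ (2 * m) sp) schi.
have i3 := sqi_integrable (sqiZ S schi) schi.
rewrite integralB//; last exact: integrableB.
rewrite integralB// !ipE//; [|exact: sqiZ..].
rewrite (ipZl A sp sp) (ipZl _ sp schi) (ipZl _ schi schi) AE (ipC leb p chi) mE -!EFinB;
  congr EFin.
by rewrite -/A -/m -/S; ring.
Qed.

Section translation_bound.
Variables (l G : R).
Hypotheses (l0 : 0 <= l) (G0 : 0 <= G).

(** After the substitution [y = x + h] and Tonelli, the double integral is that of
    [|v (. + h) - v|^2] over [h] in a cube of measure [(2 * l) ^+ n]. *)
Lemma near_oscillation_le v : sqi v ->
  (forall h, cube n l h -> l2n (fun x => v (x + h) - v x) <= l * G) ->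
  (\int[leb]_x \int[leb]_y (\1_(cube n l) (y - x) * (v x - v y) ^+ 2)%:E
    <= ((2 * l) ^+ n * (l * G) ^+ 2)%:E)%E.
Proof.
move=> sv vG; have [mv _] := sv.
have mcube : measurable_fun setT (\1_(cube n l) : 'rV[R]_n -> R).
  by apply: measurable_indic; exact: measurable_cube.
have E x : (\int[leb]_y (\1_(cube n l) (y - x) * (v x - v y) ^+ 2)%:E =
    \int[leb]_h (\1_(cube n l) h * (v x - v (h + x)) ^+ 2)%:E)%E.
  rewrite -(ge0_integral_shift x
    (f := fun y => (\1_(cube n l) (y - x) * (v x - v y) ^+ 2)%:E)).
  - by apply: eq_integral => h _; rewrite addrK.
  - apply/measurable_EFinP; apply: measurable_funM.
      exact: (measurableT_comp mcube (measurable_addr (- x))).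
    by apply: measurable_funX; exact: measurable_funB.
  - by move=> y; rewrite lee_fin mulr_ge0 ?sqr_ge0// indicE.
under eq_integral do rewrite E.
rewrite (fubini_tonelli (m1 := leb) (m2 := leb)
  (fun p => (\1_(cube n l) p.2 * (v p.1 - v (p.2 + p.1)) ^+ 2)%:E)); last 2 first.
- apply/measurable_EFinP; apply: measurable_funM.
    exact: (measurable_comp_snd mcube).
  apply: measurable_funX; apply: measurable_funB.
    exact: measurable_comp_fst.
  under eq_fun do rewrite addrC.
  exact: (measurableT_comp mv (@measurable_addr2 R n)).
- by move=> p; rewrite lee_fin mulr_ge0 ?sqr_ge0// indicE.
have -> : (((2 * l) ^+ n * (l * G) ^+ 2)%:E = \int[leb]_h (\1_(cube n l) h * (l * G) ^+ 2)%:E)%E.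
  under eq_integral do rewrite mulrC EFinM.
  rewrite ge0_integralZl//; last 2 first.
  - exact/measurable_EFinP.
  - by rewrite lee_fin sqr_ge0.
  rewrite integral_indic//; last exact: measurable_cube.
  rewrite setIT [X in (_ * X)%E](_ : _ = ((2 * l) ^+ n)%:E); last exact: lebesgue_cube.
  by rewrite -EFinM mulrC.
apply: ge0_le_integral => //.
- by move=> h _; apply: integral_ge0 => x _; rewrite lee_fin mulr_ge0 ?sqr_ge0// indicE.
- apply: (measurable_fun_fubini_tonelli_F (m2 := leb)
    (fun p => (\1_(cube n l) p.1 * (v p.2 - v (p.1 + p.2)) ^+ 2)%:E)).
  + apply/measurable_EFinP; apply: measurable_funM.
      exact: (measurable_comp_fst mcube).
    apply: measurable_funX; apply: measurable_funB.
      exact: measurable_comp_snd.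
    exact: (measurableT_comp mv (@measurable_addr2 R n)).
  + by move=> p; rewrite lee_fin mulr_ge0 ?sqr_ge0// indicE.
- by apply/measurable_EFinP; apply: measurable_funM.
move=> h _ /=; rewrite indicE; case: (boolP (h \in _)) => hc; last first.
  rewrite mul0r integral0_eq// => x _; first by rewrite mul0r.
rewrite mul1r; under eq_integral do rewrite mul1r.
have sd : sqi (fun x => v (x + h) - v x) by apply: sqiB => //; exact: sqi_shift.
have := vG h; rewrite inE in hc => /(_ hc) le.
rewrite (eq_integral (fun x : 'rV[R]_n => ((v (x + h) - v x) ^+ 2)%:E)); last first.
  by move=> x _ /=; rewrite (addrC h x) -sqrrN opprB.
rewrite sqr_ipE// lee_fin -sqr_l2n ler_sqr ?nnegrE ?l2n_ge0//.
by rewrite mulr_ge0.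
Qed.

End translation_bound.

Section cells.
Variables (r : R) (m : nat).
Hypotheses (r0 : 0 < r) (m0 : (0 < m)%N).

Definition mesh : R := 2 * r / m%:R.

Lemma mesh_gt0 : 0 < mesh.
Proof. by rewrite divr_gt0 ?mulr_gt0// ltr0n. Qed.

(** The cells are half-open so that they are pairwise disjoint and still cover the open cube. *)
Definition cell (z : {ffun 'I_n -> 'I_m}) : set 'rV[R]_n :=
  [set x | forall i, `[- r + (z i)%:R * mesh, - r + (z i).+1%:R * mesh[%classic (x ord0 i)].

Lemma measurable_cell z : measurable (cell z).
Proof.
rewrite [X in measurable X](_ : _ = \bigcap_(i in [set: 'I_n])
    ((fun x : 'rV[R]_n => x ord0 i) @^-1`
      `[- r + (z i)%:R * mesh, - r + (z i).+1%:R * mesh[%classic)); last first.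
  by apply/seteqP; split => [x /= Ax i _|x /= Ax i]; [exact: Ax|exact: (Ax i)].
apply: fin_bigcap_measurable => // i _.
by rewrite -[X in measurable X]setTI; apply: measurable_coord.
Qed.

Lemma lebesgue_cell z : leb (cell z) = (mesh ^+ n)%:E.
Proof.
rewrite (lebesgue_rV_box (A := fun i =>
  `[- r + (z i)%:R * mesh, - r + (z i).+1%:R * mesh[%classic))//.
rewrite (eq_bigr (fun=> mesh%:E)) => [|i _].
  by rewrite prodEFin prodr_const card_ord.
rewrite lebesgue_measure_itv/= lte_fin ltrD2l ltr_pM2r ?mesh_gt0// ltr_nat ltnSn.
by rewrite -EFinB -natr1; congr EFin; ring.
Qed.

Lemma cellE z x : cell z x ->
  forall i, (z i : nat) = Num.truncn ((x ord0 i + r) / mesh).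
Proof.
move=> xz i; have := xz i; rewrite /= in_itv/= => /andP[h1 h2].
apply/esym/eqP; rewrite truncn_eq; last first.
  rewrite divr_ge0 ?(ltW mesh_gt0)//.
  by have := mulr_ge0 (ler0n R (z i)) (ltW mesh_gt0); lra.
by rewrite ler_pdivlMr ?ltr_pdivrMr ?mesh_gt0//; apply/andP; split; lra.
Qed.

Lemma cell_inj z z' x : cell z x -> cell z' x -> z = z'.
Proof.
move=> /cellE h /cellE h'; apply/ffunP => i; apply: val_inj.
by rewrite /= h h'.
Qed.

Lemma cell_cover x : cube n r x -> exists z, cell z x.
Proof.
move=> /cubeP xr.
have H (i : 'I_n) : exists k : 'I_m, `[- r + k%:R * mesh, - r + k.+1%:R * mesh[%classic (x ord0 i).
  have := xr i; rewrite ltr_norml => /andP[h1 h2].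
  have q0 : 0 <= (x ord0 i + r) / mesh by rewrite divr_ge0 ?ltW ?mesh_gt0//; lra.
  have km : (Num.truncn ((x ord0 i + r) / mesh) < m)%N.
    rewrite truncn_lt_nat// ltr_pdivrMr ?mesh_gt0// /mesh mulrC mulfVK.
      by lra.
    by rewrite pnatr_eq0 -lt0n.
  exists (Ordinal km); rewrite /= in_itv/=.
  have /andP[] := truncn_itv q0.
  by rewrite ler_pdivlMr ?ltr_pdivrMr ?mesh_gt0// => h3 h4; apply/andP; split; lra.
have [f Hf] := choice H.
by exists [ffun i => f i] => i; rewrite ffunE; exact: Hf.
Qed.

Lemma cell_close z x y : cell z x -> cell z y -> cube n mesh (y - x).
Proof.
move=> xz yz; apply/cubeP => i; rewrite !mxE.
have := xz i; have := yz i; rewrite /= !in_itv/= -natr1 mulrDl mul1r => /andP[h1 h2] /andP[h3 h4].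
by rewrite ltr_norml; apply/andP; split; lra.
Qed.

(** At most one cell contains both points, and two points of a cell differ by less than [mesh] in
    every coordinate. *)
Lemma sum_cells_le x y :
  \sum_z \1_(cell z) x * \1_(cell z) y <= \1_(cube n mesh) (y - x) :> R.
Proof.
have [[z [xz yz]]|H] := pselect (exists z, cell z x /\ cell z y).
  rewrite (bigD1 z)//= big1 => [|z' zz'].
    by rewrite !indicE !mem_set//; [rewrite mulr1 addr0|exact: cell_close xz yz].
  rewrite indicE memNset ?mul0r// => xz'.
  by move: zz'; rewrite (cell_inj xz xz') eqxx.
rewrite big1 ?indicE// => z _; rewrite !indicE.
have [xz|xz] := pselect (cell z x); last by rewrite memNset ?mul0r.
have [yz|yz] := pselect (cell z y); last by rewrite (memNset yz) mulr0.
by exfalso; apply: H; exists z.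
Qed.

(* On a cell [z], the integral of [v ^+ 2] is the square of the integral of [v]
   over [mesh ^+ n], plus the mean square oscillation of [v], which the
   translations by vectors of [cube n mesh] control. *)
Lemma local_poincare v (G : R) : 0 <= G -> sqi v ->
  (forall h, cube n mesh h -> l2n (fun x => v (x + h) - v x) <= mesh * G) ->
  2 * mesh ^+ n * ip (restr (cube n r) v) (restr (cube n r) v) <=
  2 * \sum_z ip v (\1_(cell z)) ^+ 2 + (2 * mesh) ^+ n * (mesh * G) ^+ 2.
Proof.
move=> G0 sv vG; have [mv _] := sv.
have le0 := ltW mesh_gt0.
have H := near_oscillation_le le0 G0 sv vG.
have mc z : measurable_fun setT (\1_(cell z) : 'rV[R]_n -> R).
  by apply: measurable_indic; exact: measurable_cell.
pose F z (p : 'rV[R]_n * 'rV[R]_n) : \bar R :=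
  (\1_(cell z) p.1 * \1_(cell z) p.2 * (v p.1 - v p.2) ^+ 2)%:E.
have F0 z p : (0 <= F z p)%E by rewrite /F lee_fin mulr_ge0 ?sqr_ge0// mulr_ge0 ?indic01.
have mF z : measurable_fun setT (F z).
  apply/measurable_EFinP; apply: measurable_funM.
    by apply: measurable_funM; [exact: (measurable_comp_fst (mc z))|exact:
      (measurable_comp_snd (mc z))].
  apply: measurable_funX; apply: measurable_funB.
    exact: measurable_comp_fst.
  exact: measurable_comp_snd.
have osc z : (\int[leb]_x \int[leb]_y F z (x, y) =
    (2 * (mesh ^+ n * ip (restr (cell z) v) (restr (cell z) v)) - 2 * ip v (\1_(cell z)) ^+
      2)%:E)%E.
  rewrite /F /= oscillation_integral//; last first.
  - by rewrite lebesgue_cell ltry.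
  - exact: measurable_cell.
  by rewrite lebesgue_cell.
(* Together the oscillations inside the cells are part of the oscillation over all pairs at distance
   less than [mesh]. *)
have step : (\sum_z \int[leb]_x \int[leb]_y F z (x, y) <=
    ((2 * mesh) ^+ n * (mesh * G) ^+ 2)%:E)%E.
  apply: le_trans H.
  rewrite -ge0_integral_sum//; last 2 first.
  - by move=> z; exact: measurable_fun_fubini_tonelli_F.
  - by move=> z x _; exact: integral_ge0.
  apply: ge0_le_integral => //.
  - by move=> x _; apply: sume_ge0 => z _; exact: integral_ge0.
  - by apply: emeasurable_sum => z; exact: measurable_fun_fubini_tonelli_F.
  - apply: (measurable_fun_fubini_tonelli_F (m2 := leb)
      (fun p : 'rV[R]_n * 'rV[R]_n => (\1_(cube n mesh) (p.2 - p.1) * (v p.1 - v p.2) ^+ 2)%:E)).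
    + apply/measurable_EFinP; apply: measurable_funM.
        have ms : measurable_fun setT (fun p : 'rV[R]_n * 'rV[R]_n => p.2 - p.1).
          apply: measurable_fun_rV => i; under eq_fun do rewrite !mxE.
          apply: measurable_funB.
            exact: (measurableT_comp (measurable_coord i) measurable_snd).
          exact: (measurableT_comp (measurable_coord i) measurable_fst).
        apply: (measurableT_comp _ ms).
        by apply: measurable_indic; exact: measurable_cube.
      apply: measurable_funX; apply: measurable_funB.
        exact: measurable_comp_fst.
      exact: measurable_comp_snd.
    + by move=> p; rewrite lee_fin mulr_ge0 ?sqr_ge0// indicE.
  move=> x _; rewrite -ge0_integral_sum//; last first.
    by move=> z; exact: (measurableT_comp (mF z) (measurable_pair1 x)).
  apply: ge0_le_integral => //.
  - by move=> y _; exact: sume_ge0.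
  - by apply: emeasurable_sum => z; exact: (measurableT_comp (mF z) (measurable_pair1 x)).
  - apply/measurable_EFinP; apply: measurable_funM.
      apply: (measurableT_comp _ (measurable_addr (- x))).
      by apply: measurable_indic; exact: measurable_cube.
    by apply: measurable_funX; exact: measurable_funB.
  move=> y _; rewrite sumEFin lee_fin -mulr_suml ler_wpM2r ?sqr_ge0//.
  exact: sum_cells_le.
move: step; under eq_bigr do rewrite osc.
rewrite sumEFin lee_fin sumrB -!mulr_sumr => step.
(* An inequality, since the cells also contain boundary points of the cube. *)
suff cover : ip (restr (cube n r) v) (restr (cube n r) v) <=
    \sum_z ip (restr (cell z) v) (restr (cell z) v).
  have := ler_wpM2l (exprn_ge0 n le0) cover; lra.
rewrite -lee_fin -sqr_ipE; last by apply: sqi_restr => //; exact: measurable_cube.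
rewrite -sumEFin.
have sc z : sqi (restr (cell z) v) by apply: sqi_restr => //; exact: measurable_cell.
under eq_bigr do rewrite -sqr_ipE//.
rewrite -ge0_integral_sum//; last 2 first.
- by move=> z; have [mz _] := sc z; exact: measurable_sqr.
- by move=> z x _; rewrite lee_fin sqr_ge0.
have [mr _] : sqi (restr (cube n r) v) by apply: sqi_restr => //; exact: measurable_cube.
apply: ge0_le_integral => //.
- by move=> x _; rewrite lee_fin sqr_ge0.
- exact: measurable_sqr.
- by apply: emeasurable_sum => z; have [mz _] := sc z; exact: measurable_sqr.
move=> x _; rewrite sumEFin lee_fin /restr.
have [/cell_cover[z xz]|xr] := pselect (cube n r x); last first.
  by rewrite indicE memNset// mul0r expr0n sumr_ge0// => z _; rewrite sqr_ge0.
rewrite (bigD1 z)//= !indicE (mem_set xz); apply: ler_wpDr.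
  by apply: sumr_ge0 => z' _; rewrite sqr_ge0.
by case: (_ \in _); rewrite mul1r// mul0r expr0n sqr_ge0.
Qed.

End cells.

(** Once the mesh is fixed there are finitely many cells, and weak convergence sends the integral
    over each of them to 0. What remains in [local_poincare] is the oscillation inside the cells,
    which the translation estimate makes small with the mesh, uniformly in the sequence. *)
Lemma rellich (U : set_system nat) (v_ : nat -> 'rV[R]_n -> R)
    (g_ : nat -> 'I_n -> 'rV[R]_n -> R) (M r : R) : ProperFilter U -> 0 < r ->
  (forall k, sqi (v_ k)) ->
  (forall k i, sqi (g_ k i) /\ is_weak_partial i (v_ k) (g_ k i)) ->
  (\forall k \near U, \sum_i l2n (g_ k i) <= M) ->
  (forall w, sqi w -> ip (v_ k) w @[k --> U] --> (0 : R)) ->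
  ip (restr (cube n r) (v_ k)) (restr (cube n r) (v_ k)) @[k --> U] --> (0 : R).
Proof.
move=> UU r0 sv Hg gM vw; apply/cvgr0Pnorm_le => e e0.
pose G := `|M|.
(* With [l = 2 * r / m] the oscillation term [2 ^+ n * l ^+ 2 * G ^+ 2] is at most [e], because
   [m <= m ^+ 2]. *)
pose m := (Num.truncn (2 ^+ n * (2 * r) ^+ 2 * G ^+ 2 / e)).+1.
have m0 : (0 < m)%N by [].
set l := mesh r m; have l0 : 0 < l by exact: mesh_gt0.
have small : 2 ^+ n * l ^+ 2 * G ^+ 2 <= e.
  have h : 2 ^+ n * (2 * r) ^+ 2 * G ^+ 2 < m%:R * e by rewrite -ltr_pdivrMr// truncnS_gt.
  have mr : 0 < m%:R :> R by rewrite ltr0n.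
  have m1 : 1 <= m%:R :> R by rewrite ler1n.
  have -> : 2 ^+ n * l ^+ 2 * G ^+ 2 = 2 ^+ n * (2 * r) ^+ 2 * G ^+ 2 / m%:R ^+ 2.
    by rewrite /l /mesh; field; rewrite pnatr_eq0.
  rewrite ler_pdivrMr ?exprn_gt0//.
  apply: le_trans (ltW h) _; rewrite mulrC ler_pM2l// expr2.
  by rewrite -[leLHS]mul1r ler_pM2r.
have sums : \sum_z ip (v_ k) (\1_(@cell r m z)) ^+ 2 @[k --> U] --> (0 : R).
  have Z : \sum_(z : {ffun 'I_n -> 'I_m}) (0 : R) = 0 by rewrite big1.
  rewrite -[X in _ --> X]Z.
  apply: cvg_big; first exact: add_continuous.
  move=> z _; rewrite -[X in _ --> X](mulr0 (0 : R)).
  under eq_fun do rewrite expr2.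
  have sc : sqi (\1_(@cell r m z)).
    have mc := measurable_cell r z.
    have := sqi_indic 1 mc; rewrite lebesgue_cell// ltry => /(_ isT).
    by congr sqi; apply/funext => x; rewrite mul1r.
  by apply: cvgM; exact: vw.
have ln0 : 0 < l ^+ n by rewrite exprn_gt0.
(* After division by [2 * l ^+ n], this part and the oscillation term contribute [e / 2] each. *)
have e1 : 0 < l ^+ n * (e / 2) by rewrite mulr_gt0// divr_gt0.
have /cvgr0Pnorm_le/(_ _ e1) H1 := sums.
near=> k.
rewrite ger0_norm ?ip_ge0//.
have gk : \sum_i l2n (g_ k i) <= G.
  by apply: (@le_trans _ _ M); [near: k|exact: ler_norm].
have := @local_poincare r m r0 m0 (v_ k) G (normr_ge0 _) (sv k).
have H h : cube n l h -> l2n (fun x => v_ k (x + h) - v_ k x) <= l * G.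
  move=> /cubeP hl; apply: le_trans (l2n_translation h (sv k) (Hg k)) _.
  apply: le_trans (ler_wpM2l (ltW l0) gk); rewrite mulr_sumr.
  by apply: ler_sum => i _; rewrite ler_wpM2r ?l2n_ge0// ltW.
move=> /(_ H); rewrite -/l.
have : \sum_z ip (v_ k) (\1_(@cell r m z)) ^+ 2 <= l ^+ n * (e / 2).
  by apply: le_trans (ler_norm _) _; near: k.
rewrite (exprMn n 2 l) (exprMn 2 l G).
move: small (ip (restr _ _) _) => small X h1 h2.
rewrite -(ler_pM2l ln0).
have h3 : l ^+ n * (2 ^+ n * l ^+ 2 * G ^+ 2) <= l ^+ n * e by rewrite ler_pM2l.
lra.
Unshelve. all: by end_near. Qed.

End grid.

(** * The Choquard term *)

Section riesz_kernel.
Context {R : realType} {n : nat}.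
Variables (alpha : R).
Hypotheses (alpha0 : 0 < alpha) (alphan : alpha < n%:R).
Local Notation leb := (@lebesgue_rV R n).
Local Notation kern := (@riesz R n alpha).

Lemma Gamma_ge0 (s : R) : 0 <= Gamma s.
Proof.
by apply: Rintegral_ge0 => t _; rewrite mulr_ge0 ?powR_ge0 ?expR_ge0.
Qed.

Lemma enorm_ge (x : 'rV[R]_n) i : `|x ord0 i| <= enorm x.
Proof.
rewrite /enorm -sqrtr_sqr ler_sqrt; last by rewrite sumr_ge0// => j _; exact: sqr_ge0.
by rewrite (bigD1 i)//= lerDl sumr_ge0// => j _; exact: sqr_ge0.
Qed.

Lemma enorm_ge0 (x : 'rV[R]_n) : 0 <= enorm x.
Proof. exact: sqrtr_ge0. Qed.

Lemma measurable_enorm : measurable_fun setT (@enorm R n).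
Proof.
apply: continuous_measurable_rV => x.
apply: (@continuous_comp _ _ _ (fun x : 'rV[R]_n => \sum_i x ord0 i ^+ 2) Num.sqrt); last first.
  exact: sqrt_continuous.
apply: continuous_big; first exact: add_continuous.
move=> i _ y.
apply: (@continuous_comp _ _ _ (fun x : 'rV[R]_n => x ord0 i) (fun t => t ^+ 2)).
  exact: coord_continuous.
exact: exprn_continuous.
Qed.

Definition riesz_const : R := Gamma ((n%:R - alpha) / 2) /
  (2 `^ alpha * pi `^ (n%:R / 2) * Gamma (alpha / 2)).

Lemma riesz_const_ge0 : 0 <= riesz_const.
Proof.
by rewrite divr_ge0 ?Gamma_ge0// !mulr_ge0 ?powR_ge0 ?Gamma_ge0.
Qed.

Lemma rieszE x : kern x = riesz_const / enorm x `^ (n%:R - alpha).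
Proof. by rewrite /riesz /riesz_const invfM mulrA. Qed.

Lemma riesz_ge0 x : 0 <= kern x.
Proof. by rewrite rieszE divr_ge0 ?riesz_const_ge0 ?powR_ge0. Qed.

Lemma rieszN x : kern (- x) = kern x.
Proof.
rewrite !rieszE /enorm; congr (_ / (Num.sqrt _ `^ _)).
by apply: eq_bigr => i _; rewrite mxE sqrrN.
Qed.

Lemma riesz_gt0 x : 0 < riesz_const -> x != 0 -> 0 < kern x.
Proof.
move=> A0 x0; rewrite rieszE divr_gt0// powR_gt0//.
have [i xi] : exists i, x ord0 i != 0.
  apply/existsP; move: x0; apply: contraNT; rewrite negb_exists => /forallP H.
  by apply/eqP/rowP => i; rewrite mxE; apply/eqP; have := H i; rewrite negbK.
by apply: lt_le_trans (enorm_ge x i); rewrite normr_gt0.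
Qed.

Lemma measurable_riesz : measurable_fun setT kern.
Proof.
rewrite (_ : kern = fun x => riesz_const / enorm x `^ (n%:R - alpha)); last first.
  by apply/funext => x; exact: rieszE.
apply: measurable_funM => //.
under eq_fun do rewrite -powR_inv1 ?powR_ge0//.
apply: (measurableT_comp (measurable_powR _)).
by apply: (measurableT_comp (measurable_powR _)); exact: measurable_enorm.
Qed.

Lemma nneseries_geometric_le (C rho : R) : 0 <= C -> 0 <= rho -> rho < 1 ->
  (\sum_(0 <= j <oo) (C * rho ^+ j)%:E <= (C / (1 - rho))%:E)%E.
Proof.
move=> C0 rho0 rho1.
have r1 : 0 < 1 - rho by rewrite subr_gt0.
apply: lime_le.
  by apply: is_cvg_nneseries => j _ _; rewrite lee_fin mulr_ge0 ?exprn_ge0.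
apply: nearW => m; rewrite big_mkord sumEFin lee_fin.
have -> : \sum_(i < m) C * rho ^+ i = C * (1 - rho ^+ m) / (1 - rho).
  elim: m => [|m IH]; first by rewrite big_ord0 expr0 subrr mulr0 mul0r.
  by rewrite big_ord_recr/= IH exprS; field; rewrite gt_eqF.
rewrite ler_wpM2r ?invr_ge0 ?(ltW r1)//.
by rewrite ler_piMr// gerBl exprn_ge0.
Qed.

Lemma powR_exprn (a s : R) m : 0 <= a -> (a ^+ m) `^ s = (a `^ s) ^+ m.
Proof.
move=> a0; elim: m => [|m IH]; first by rewrite !expr0 powR1.
by rewrite !exprS powRM ?exprn_ge0// IH.
Qed.

(** On dyadic shells the kernel grows like 2^(j s), with s = n - alpha, while the volume decays like
    2^(-j n); the product is geometric. *)
Lemma riesz_locally_integrable (r : R) : 0 < r ->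
  (\int[leb]_x (\1_(cube n r) x * kern x)%:E < +oo)%E.
Proof.
move=> r0; set s := n%:R - alpha; have s0 : 0 < s by rewrite subr_gt0.
set A := riesz_const; have A0 : 0 <= A by exact: riesz_const_ge0.
pose h : R := 2^-1; have h0 : 0 < h by rewrite invr_gt0.
have h1 : h < 1 by rewrite invf_lt1// ltr1n.
pose rj (j : nat) := r * h ^+ j.
have rj0 j : 0 < rj j by rewrite mulr_gt0// exprn_gt0.
(* On the dyadic shell [cube n (rj j) `\` cube n (rj j.+1)] the kernel is at
   most [c j]. *)
pose c (j : nat) := A / (rj j.+1) `^ s.
have c0 j : 0 <= c j by rewrite divr_ge0 ?powR_ge0.
have mI j : measurable_fun setT (fun x : 'rV[R]_n => (c j * \1_(cube n (rj j)) x)%:E : \bar R).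
  apply/measurable_EFinP; apply: measurable_funM => //.
  by apply: measurable_indic; exact: measurable_cube.
have I0 j (x : 'rV[R]_n) : (0 <= (c j * \1_(cube n (rj j)) x)%:E :> \bar R)%E.
  by rewrite lee_fin mulr_ge0 ?indic01.
apply: (@le_lt_trans _ _ (\int[leb]_x \sum_(0 <= j <oo) (c j * \1_(cube n (rj j)) x)%:E)%E).
  apply: ge0_le_integral => //.
  - by move=> x _; rewrite lee_fin mulr_ge0 ?indic01 ?riesz_ge0.
  - apply/measurable_EFinP; apply: measurable_funM; last exact: measurable_riesz.
    by apply: measurable_indic; exact: measurable_cube.
  - by apply: ge0_emeasurable_sum => // j x _ _; exact: I0.
  move=> x _.
  have [xr|xr] := pselect (cube n r x); last first.
    by rewrite indicE memNset// mul0r; apply: nneseries_ge0 => j _ _; exact: I0.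
  rewrite indicE mem_set// mul1r.
  (* The origin lies in no shell, but there the kernel has the default value 0 of a division by
     zero. *)
  have [->|x0] := eqVneq x 0.
    rewrite rieszE (_ : enorm 0 = 0); last first.
      rewrite /enorm big1 ?sqrtr0// => i _; by rewrite mxE expr0n.
    by rewrite powR0 ?gt_eqF// invr0 mulr0; apply: nneseries_ge0 => j _ _; exact: I0.
  have [i xi] : exists i, x ord0 i != 0.
    apply/existsP; move: x0; apply: contraNT; rewrite negb_exists => /forallP H.
    by apply/eqP/rowP => i; rewrite mxE; apply/eqP; have := H i; rewrite negbK.
  have [j [xj xj1]] : exists j, cube n (rj j) x /\ ~ cube n (rj j.+1) x.
    apply: contrapT => H.
    have all j : cube n (rj j) x.
      elim: j => [|j IH]; first by rewrite /rj expr0 mulr1.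
      by apply: contrapT => nx; apply: H; exists j.
    have : rj j @[j --> \oo] --> (0 : R).
      rewrite -[X in _ --> X](mulr0 r); apply: cvgMl_tmp; apply: cvg_expr.
      by rewrite ger0_norm// ltW.
    move=> /cvgr0Pnorm_lt/(_ `|x ord0 i|); rewrite normr_gt0 => /(_ xi)[m _ /(_ m (leqnn m))] /=.
    rewrite ger0_norm ?(ltW (rj0 m))//; apply/negP; rewrite -leNgt ltW//.
    by have /cubeP := all m; exact.
  apply: (@le_trans _ _ (\sum_(0 <= i < j.+1) (c i * \1_(cube n (rj i)) x)%:E)%E); last first.
    by apply: nneseries_lim_ge => k _ _; exact: I0.
  rewrite big_nat_recr//=; apply: (@le_trans _ _ (c j * \1_(cube n (rj j)) x)%:E); last first.
    by rewrite leeDr// sume_ge0.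
  rewrite lee_fin indicE mem_set// mulr1 rieszE -/A -/s /c ler_wpM2l//.
  have [l xl] : exists l, rj j.+1 <= `|x ord0 l|.
    apply: contrapT => H; apply: xj1; apply/cubeP => l; rewrite ltNge; apply/negP => hl.
    by apply: H; exists l.
  rewrite lef_pV2 ?posrE ?powR_gt0//; last first.
    by apply: lt_le_trans (enorm_ge x i); rewrite normr_gt0.
  by rewrite ge0_ler_powR ?nnegrE ?enorm_ge0 ?(ltW (rj0 _)) ?(ltW s0)// (le_trans xl)// enorm_ge.
rewrite integral_nneseries//.
pose C := A * (2 * r) ^+ n / (r `^ s * h `^ s).
(* As [n = s + alpha], this ratio is [h] to the power [alpha], which is less than 1. *)
pose rho := h ^+ n / (h `^ s).
have hs0 : 0 < h `^ s by rewrite powR_gt0.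
have rs0 : 0 < r `^ s by rewrite powR_gt0.
have rho1 : rho < 1.
  rewrite /rho ltr_pdivrMr// mul1r -powR_mulrn ?(ltW h0)//.
  rewrite (_ : n%:R = s + alpha); last by rewrite /s subrK.
  rewrite powRD ?(gt_eqF h0) ?implybT// gtr_pMr//.
  have := gt0_ltr_powR alpha0 _ _ h1; rewrite powR1; apply; rewrite nnegrE//.
  exact: ltW.
rewrite (eq_eseriesr (g := fun j => (C * rho ^+ j)%:E)); last first.
  move=> j _; under eq_integral do rewrite EFinM.
  rewrite ge0_integralZl//; last 2 first.
  - by apply/measurable_EFinP; apply: measurable_indic; exact: measurable_cube.
  - by rewrite lee_fin.
  rewrite integral_indic//; last exact: measurable_cube.
  rewrite setIT [X in (_ * X)%E](_ : _ = ((2 * rj j) ^+ n)%:E); last first.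
    by apply: lebesgue_cube; exact: ltW.
  rewrite -EFinM; congr EFin; rewrite /c /C /rho /rj powRM ?exprn_ge0 ?(ltW r0) ?(ltW h0)//.
  rewrite powR_exprn ?(ltW h0)// exprS expr_div_n !exprMn -!exprM (mulnC n j).
  by field; rewrite !gt_eqF ?exprn_gt0.
apply: le_lt_trans (nneseries_geometric_le _ _ rho1) _; last by rewrite ltry.
  by rewrite divr_ge0 ?(ltW (mulr_gt0 rs0 hs0))// mulr_ge0// exprn_ge0// mulr_ge0// ltW.
by rewrite divr_ge0 ?powR_ge0 ?exprn_ge0 ?(ltW h0).
Qed.

End riesz_kernel.

(** * Bilinear forms of nonnegative even kernels *)

Section kernel_form.
Context {R : realType} {n : nat}.
Local Notation leb := (@lebesgue_rV R n).
Variable k : 'rV[R]_n -> R.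
Hypotheses (mk : measurable_fun setT k) (k0 : forall x, 0 <= k x).
Hypothesis kN : forall x, k (- x) = k x.
Implicit Types f g h : 'rV[R]_n -> R.

Definition nn f := measurable_fun setT f /\ forall x, 0 <= f x.

(** On nonnegative functions the values are in [0, +oo], so that symmetry and bilinearity follow
    from Tonelli before any finiteness is known. *)
Definition kform f g : \bar R := (\int[leb]_x \int[leb]_y (k (x - y) * (f y * g x))%:E)%E.

Definition kintegrand f g (p : 'rV[R]_n * 'rV[R]_n) : \bar R :=
  (k (p.1 - p.2) * (f p.2 * g p.1))%:E.

Lemma measurable_kintegrand f g : measurable_fun setT f -> measurable_fun setT g ->
  measurable_fun setT (kintegrand f g).
Proof.
move=> mf mg; apply/measurable_EFinP; apply: measurable_funM.
  exact: (measurableT_comp mk (@measurable_subr2 R n)).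
by apply: measurable_funM; [exact: (measurable_comp_snd mf)|exact: (measurable_comp_fst mg)].
Qed.

Lemma measurable_kinner f g x : measurable_fun setT f ->
  measurable_fun setT (fun y : 'rV[R]_n => (k (x - y) * (f y * g x))%:E : \bar R).
Proof.
move=> mf; apply/measurable_EFinP; apply: measurable_funM.
  apply: (measurableT_comp mk); apply: measurable_fun_rV => i.
  under eq_fun do rewrite !mxE.
  by apply: measurable_funB => //; exact: measurable_coord.
exact: measurable_funM.
Qed.

Lemma kintegrand_ge0 f g p : nn f -> nn g -> (0 <= kintegrand f g p)%E.
Proof. by move=> [_ f0] [_ g0]; rewrite lee_fin mulr_ge0 ?mulr_ge0. Qed.

Lemma kouter_ge0 f g x : nn f -> nn g ->
  (0 <= \int[leb]_y (k (x - y) * (f y * g x))%:E)%E.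
Proof.
by move=> nf ng; apply: integral_ge0 => y _; exact: (kintegrand_ge0 (x, y)).
Qed.

Lemma measurable_kouter f g : nn f -> nn g ->
  measurable_fun setT (fun x : 'rV[R]_n => \int[leb]_y (k (x - y) * (f y * g x))%:E)%E.
Proof.
move=> nf ng; have [mf _] := nf; have [mg _] := ng.
apply: (measurable_fun_fubini_tonelli_F (m2 := leb) (kintegrand f g)).
  exact: measurable_kintegrand.
by move=> p; exact: kintegrand_ge0.
Qed.

Lemma kform_ge0 f g : nn f -> nn g -> (0 <= kform f g)%E.
Proof. by move=> nf ng; apply: integral_ge0 => x _; exact: kouter_ge0. Qed.

Lemma kform_sym f g : nn f -> nn g -> kform f g = kform g f.
Proof.
move=> nf ng; have [mf _] := nf; have [mg _] := ng.
rewrite /kform (fubini_tonelli (m1 := leb) (m2 := leb) (kintegrand f g)).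
- apply: eq_integral => x _; apply: eq_integral => y _.
  by rewrite /kintegrand/= -kN opprB [f x * _]mulrC.
- exact: measurable_kintegrand.
- by move=> p; exact: kintegrand_ge0.
Qed.

Lemma kform_le f f' g g' : nn f -> nn f' -> nn g -> nn g' ->
  (forall x, f x <= f' x) -> (forall x, g x <= g' x) ->
  (kform f g <= kform f' g')%E.
Proof.
move=> nf nf' ng ng' ff' gg'; have [mf f0] := nf; have [mf' f'0] := nf'.
have [mg g0] := ng; have [mg' g'0] := ng'.
apply: ge0_le_integral => //.
- by move=> x _; exact: kouter_ge0.
- exact: (measurable_kouter nf ng).
- exact: (measurable_kouter nf' ng').
move=> x _; apply: ge0_le_integral => //.
- by move=> y _; exact: (kintegrand_ge0 (x, y)).
- exact: measurable_kinner.
- exact: measurable_kinner.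
- by move=> y _; rewrite lee_fin ler_wpM2l// ler_pM.
Qed.

Lemma nnD f g : nn f -> nn g -> nn (fun x => f x + g x).
Proof.
by move=> [mf f0] [mg g0]; split; [exact: measurable_funD|move=> x; rewrite addr_ge0].
Qed.

Lemma nnZ a f : 0 <= a -> nn f -> nn (fun x => a * f x).
Proof.
by move=> a0 [mf f0]; split; [exact: measurable_funM|move=> x; rewrite mulr_ge0].
Qed.

Lemma kformDl f f' g : nn f -> nn f' -> nn g ->
  (kform (fun x => f x + f' x)%R g = kform f g + kform f' g)%E.
Proof.
move=> nf nf' ng; have [mf f0] := nf; have [mf' f'0] := nf'; have [mg g0] := ng.
rewrite /kform -ge0_integralD//; last 4 first.
- by move=> x _; exact: kouter_ge0.
- exact: (measurable_kouter nf ng).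
- by move=> x _; exact: kouter_ge0.
- exact: (measurable_kouter nf' ng).
apply: eq_integral => x _; rewrite -ge0_integralD//; last 4 first.
- by move=> y _; exact: (kintegrand_ge0 (x, y)).
- exact: measurable_kinner.
- by move=> y _; exact: (kintegrand_ge0 (x, y)).
- exact: measurable_kinner.
by apply: eq_integral => y _; rewrite -EFinD; congr EFin; ring.
Qed.

Lemma kformDr f g g' : nn f -> nn g -> nn g' ->
  (kform f (fun x => g x + g' x)%R = kform f g + kform f g')%E.
Proof.
move=> nf ng ng'; rewrite (kform_sym nf (nnD ng ng')) (kformDl ng ng' nf).
by rewrite (kform_sym ng nf) (kform_sym ng' nf).
Qed.

Lemma kformZl a f g : 0 <= a -> nn f -> nn g ->
  (kform (fun x => a * f x)%R g = a%:E * kform f g)%E.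
Proof.
move=> a0 nf ng; have [mf f0] := nf.
rewrite /kform -ge0_integralZl//; last 2 first.
- exact: measurable_kouter.
- by move=> x _; exact: kouter_ge0.
apply: eq_integral => x _; rewrite -ge0_integralZl//; last 2 first.
- exact: measurable_kinner.
- by move=> y _; exact: (kintegrand_ge0 (x, y)).
by apply: eq_integral => y _; rewrite -EFinM; congr EFin; ring.
Qed.

Lemma kformZr a f g : 0 <= a -> nn f -> nn g ->
  (kform f (fun x => a * g x)%R = a%:E * kform f g)%E.
Proof.
move=> a0 nf ng; rewrite (kform_sym nf (nnZ a0 ng)) (kformZl a0 ng nf).
by rewrite (kform_sym ng nf).
Qed.

(** Fatou is used twice: in [y] for almost every fixed [x], then in [x]. *)
Lemma kform_fatou (f_ g_ : nat -> 'rV[R]_n -> R) f g (C : \bar R) :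
  (forall m, nn (f_ m)) -> (forall m, nn (g_ m)) -> nn f -> nn g ->
  (\forall x \ae leb, f_ m x @[m --> \oo] --> f x) ->
  (\forall x \ae leb, g_ m x @[m --> \oo] --> g x) ->
  (\forall m \near \oo, (kform (f_ m) (g_ m) <= C)%E) -> (kform f g <= C)%E.
Proof.
move=> nf_ ng_ nf ng ff gg fgC; have [mf f0] := nf.
pose J m x := (\int[leb]_y (k (x - y) * (f_ m y * g_ m x))%:E)%E.
have J0 m x : (0 <= J m x)%E by exact: kouter_ge0.
have mJ m : measurable_fun setT (J m) by exact: measurable_kouter.
apply: (@le_trans _ _ (\int[leb]_x limn_einf (J^~ x))%E).
  apply: ae_ge0_le_integral => //.
  - by move=> x _; exact: kouter_ge0.
  - exact: measurable_kouter.
  - by move=> x _; rewrite limn_einf_lim; apply: lime_ge;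
      [exact: is_cvg_einfs|apply: nearW => m; apply: le_ereal_inf_tmp => _ [l _ <-]; exact: J0].
  - by apply: measurableT_comp => //; apply: measurable_fun_limn_esup => m; exact: measurableT_comp.
  apply: filterS gg => x gx _.
  have -> : (\int[leb]_y (k (x - y) * (f y * g x))%:E =
      \int[leb]_y limn_einf (fun m => (k (x - y) * (f_ m y * g_ m x))%:E))%E.
    apply: ae_eq_integral => //; first exact: measurable_kinner.
      apply: measurableT_comp => //; apply: measurable_fun_limn_esup => m.
      by apply: measurableT_comp => //; apply: measurable_kinner; have [] := nf_ m.
    apply: filterS ff => y fy _ /=.
    have : (k (x - y) * (f_ m y * g_ m x))%:E @[m --> \oo] --> (k (x - y) * (f y * g x))%:E.
      apply: cvg_EFin; first exact: nearW.
      by apply: cvgMl_tmp; exact: cvgM.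
    by move=> /cvg_limn_einf_sup[->].
  apply: (fatou leb measurableT (f := fun m (y : 'rV[R]_n) => (k (x - y) * (f_ m y * g_ m x))%:E)).
    by move=> m; apply: measurable_kinner; have [] := nf_ m.
  by move=> m y _; exact: (kintegrand_ge0 (x, y)).
apply: le_trans (fatou leb measurableT mJ (fun m x _ => J0 m x)) _.
rewrite limn_einf_lim; apply: lime_le; first exact: is_cvg_einfs.
near=> m; apply: (@le_trans _ _ (kform (f_ m) (g_ m))); last by near: m.
by apply: ereal_inf_lbound; exists m => //=.
Unshelve. all: by end_near. Qed.

Hypothesis kint : forall r, 0 < r -> (\int[leb]_x (\1_(cube n r) x * k x)%:E < +oo)%E.

(** Two points of a cube differ by a vector of the doubled cube, over which the kernel has finite
    integral. *)
Lemma kform_cube_fin (M r : R) : 0 <= M -> 0 < r ->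
  (kform (fun x => M * \1_(cube n r) x)%R (fun x => M * \1_(cube n r) x)%R < +oo)%E.
Proof.
move=> M0 r0.
have mc s : measurable_fun setT (\1_(cube n s) : 'rV[R]_n -> R).
  by apply: measurable_indic; exact: measurable_cube.
have ncube : nn (fun x => M * \1_(cube n r) x).
  by split; [exact: measurable_funM|move=> x; rewrite mulr_ge0 ?indic01].
pose K := (\int[leb]_x (\1_(cube n (r + r)) x * k x)%:E)%E.
have K0 : (0 <= K)%E.
  by apply: integral_ge0 => x _; rewrite lee_fin mulr_ge0 ?indic01.
have Koo : (K < +oo)%E by apply: kint; rewrite addr_gt0.
have Kfin : K \is a fin_num by rewrite ge0_fin_numE.
apply: (@le_lt_trans _ _ (\int[leb]_x (\1_(cube n r) x * (M ^+ 2 * fine K))%:E)%E); last first.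
  under eq_integral do rewrite mulrC EFinM.
  rewrite ge0_integralZl//; last 2 first.
  - exact/measurable_EFinP.
  - by rewrite lee_fin mulr_ge0 ?sqr_ge0 ?fine_ge0.
  rewrite integral_indic//; last exact: measurable_cube.
  rewrite setIT [X in (_ * X)%E](_ : _ = ((2 * r) ^+ n)%:E); last by apply: lebesgue_cube;
    exact: ltW.
  by rewrite -EFinM ltry.
apply: ge0_le_integral => //.
- by move=> x _; exact: (kouter_ge0 x ncube ncube).
- exact: (measurable_kouter ncube ncube).
- by apply/measurable_EFinP; exact: measurable_funM.
move=> x _; rewrite [in leRHS]indicE; case: (boolP (x \in _)) => xr; last first.
  rewrite mul0r integral0_eq// => y _.
  by rewrite !indicE (negbTE xr) !mulr0.
rewrite mul1r EFinM fineK//.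
rewrite -(ge0_integral_shift x (f := fun y : 'rV[R]_n =>
  (k (x - y) * (M * \1_(cube n r) y * (M * \1_(cube n r) x)))%:E)).
- rewrite /K -ge0_integralZl//; last 3 first.
  + by apply/measurable_EFinP; exact: measurable_funM.
  + by move=> y _; rewrite lee_fin mulr_ge0 ?indic01.
  + by rewrite lee_fin sqr_ge0.
  have mL : measurable_fun setT (fun y : 'rV[R]_n =>
      (k (x - (y + x)) * (M * \1_(cube n r) (y + x) * (M * \1_(cube n r) x)))%:E).
    have [mm _] := ncube.
    exact: (measurableT_comp (measurable_kinner (fun x =>
      M * \1_(cube n r) x) x mm) (measurable_addr x)).
  apply: ge0_le_integral => //.
  + by move=> y _; rewrite lee_fin !mulr_ge0 ?indic01.
  + by apply/measurable_EFinP; apply: measurable_funM => //; exact: measurable_funM.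
  move=> y _; rewrite opprD addrCA subrr addr0 kN -EFinM lee_fin.
  rewrite [\1_(cube n r) x]indicE xr mulr1.
  have : \1_(cube n r) (y + x) <= \1_(cube n (r + r)) y :> R.
    rewrite !indicE; case: (boolP (y + x \in _)) => // yx.
    rewrite mem_set//; apply/cubeP => i; move: xr yx; rewrite !inE => /cubeP/(_ i) h1 /cubeP/(_ i).
    rewrite mxE => h2; have -> : y ord0 i = (y ord0 i + x ord0 i) - x ord0 i by ring.
    by apply: le_lt_trans (ler_normB _ _) _; exact: ltrD.
  move=> h; rewrite (_ : k y * _ = M ^+ 2 * (\1_(cube n r) (y + x) * k y)); last by ring.
  by rewrite ler_wpM2l ?sqr_ge0// ler_wpM2r.
- by have [mm _] := ncube; exact: (measurable_kinner (fun x => M * \1_(cube n r) x)).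
- by move=> y; rewrite lee_fin !mulr_ge0 ?indic01.
Qed.

Hypotheses (kpos : forall x, x != 0 -> 0 < k x) (n0 : (0 < n)%N).

(** For almost every [x] the inner integral is 0. If moreover [f x > 0] for one of these [x], then
    [f y = 0] for almost every [y], because the kernel is positive except at [y = x], a null set in
    positive dimension. *)
Lemma kform_eq0 f : nn f -> kform f f = 0%E -> \forall x \ae leb, f x = 0.
Proof.
move=> nf; have [mf f0] := nf => H.
have mo := measurable_kouter nf nf.
have : \forall x \ae leb, (\int[leb]_y (k (x - y) * (f y * f x))%:E = 0)%E.
  have : (\int[leb]_x `| \int[leb]_y (k (x - y) * (f y * f x))%:E | = 0)%E.
    under eq_integral => x _ do rewrite gee0_abs ?kouter_ge0//.
    exact: H.
  move/(ae_eq_integral_abs _ measurableT) => /(_ mo).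
  by apply: filterS => x; exact.
move=> H1.
have [[x [fx Hx]]|H2] := pselect (exists x,
  0 < f x /\ (\int[leb]_y (k (x - y) * (f y * f x))%:E = 0)%E); last first.
  (* Without such a point [f] vanishes wherever the inner integral does. *)
  apply: filterS H1 => x Hx; apply/eqP; rewrite eq_le f0 andbT leNgt.
  by apply/negP => fx; apply: H2; exists x.
have mi := measurable_kinner f x mf.
have : (\int[leb]_y `| (k (x - y) * (f y * f x))%:E | = 0)%E.
  under eq_integral => y _ do rewrite gee0_abs ?(kintegrand_ge0 (x, y))//.
  exact: Hx.
move/(ae_eq_integral_abs _ measurableT) => /(_ mi).
have Hx0 : \forall y \ae leb, y != x.
  exists [set x]; split; [exact: measurable_rV1|exact: lebesgue_set1|].
  by move=> y /= /negP; rewrite negbK => /eqP.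
move: Hx0; apply: filterS2 => y yx /(_ Logic.I) /= [] /eqP.
rewrite mulf_eq0 gt_eqF/=; last by apply: kpos; rewrite subr_eq0 eq_sym.
by rewrite mulf_eq0 (gt_eqF fx) orbF => /eqP.
Qed.

End kernel_form.

(** * Restriction to a set and to its complement *)

Section restriction.
Context {R : realType} {n : nat}.
Local Notation leb := (@lebesgue_rV R n).
Local Notation sqi := (sqi leb).
Local Notation ip := (ip leb).
Implicit Types (u v w : 'rV[R]_n -> R) (C D : set 'rV[R]_n).

Lemma restr_in C v x : C x -> restr C v x = v x.
Proof. by move=> Cx; rewrite /restr indicE mem_set// mul1r. Qed.

Lemma restr_out C v x : ~ C x -> restr C v x = 0.
Proof. by move=> Cx; rewrite /restr indicE memNset// mul0r. Qed.

Lemma restr_norm_le C v x : `|restr C v x| <= `|v x|.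
Proof.
by rewrite /restr indicE; case: (_ \in _); rewrite ?mul1r// mul0r normr0.
Qed.

Lemma restr_norm_sub C D v x : C `<=` D -> `|restr C v x| <= `|restr D v x|.
Proof.
move=> CD; have [Cx|Cx] := pselect (C x); last by rewrite restr_out// normr0.
by rewrite !restr_in//; exact: CD.
Qed.

Lemma restr_split C v : v = (fun x => restr C v x + restr (~` C) v x).
Proof.
apply/funext => x; have [Cx|Cx] := pselect (C x).
  by rewrite restr_in// restr_out ?addr0//; exact.
by rewrite [in X in X + _]restr_out// restr_in// add0r.
Qed.

Lemma ip_disjoint v w : (forall x, v x * w x = 0) -> ip v w = 0.
Proof.
move=> vw; rewrite /ip; under eq_Rintegral do rewrite vw.
by rewrite Rintegral_cst//= mul0r.
Qed.

Lemma restr_disjoint C v w x : restr C v x * restr (~` C) w x = 0.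
Proof.
have [Cx|Cx] := pselect (C x); last by rewrite restr_out ?mul0r.
by rewrite [X in _ * X]restr_out ?mulr0//; exact.
Qed.

Lemma ip_restrC C v : measurable C -> sqi v ->
  ip v v = ip (restr C v) (restr C v) + ip (restr (~` C) v) (restr (~` C) v).
Proof.
move=> mC sv; rewrite {1 2}(restr_split C v) ip_sqrD; last 2 first.
- exact: sqi_restr.
- by apply: sqi_restr => //; exact: measurableC.
by rewrite [X in 2 * X]ip_disjoint ?mulr0 ?addr0// => x; exact: restr_disjoint.
Qed.

Lemma ip_restr_le C v : measurable C -> sqi v -> ip (restr C v) (restr C v) <= ip v v.
Proof. by move=> mC sv; rewrite (ip_restrC mC sv) lerDl ip_ge0. Qed.

(** The tail masses decrease with the cube. If all of them exceeded [d], the restrictions to the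
    cubes would have squared norm at most [ip v v - d], and Fatou would give the same bound for [v]
    itself. *)
Lemma ip_restr_tail v (d : R) : sqi v -> 0 < d -> \forall m \near \oo,
  ip (restr (~` cube n m%:R) v) (restr (~` cube n m%:R) v) <= d.
Proof.
move=> sv d0; have mC m : measurable (cube n (m%:R : R)) by exact: measurable_cube.
have mono (m m' : nat) : (m <= m')%N ->
    ip (restr (~` cube n m'%:R) v) (restr (~` cube n m'%:R) v) <=
    ip (restr (~` cube n m%:R) v) (restr (~` cube n m%:R) v).
  move=> mm'; have -> : restr (~` cube n m'%:R) v =
      restr (~` cube n m'%:R) (restr (~` cube n m%:R) v).
    apply/funext => x; have [Cx|Cx] := pselect (cube n (m'%:R : R) x).
      by rewrite !restr_out//; exact.
    rewrite !restr_in// => Cx'; apply: Cx; apply: sub_cube Cx'.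
    by rewrite ler_nat.
  apply: ip_restr_le; first exact: measurableC.
  by apply: sqi_restr => //; exact: measurableC.
have [[m mP]|H] := pselect (exists m : nat,
    ip (restr (~` cube n m%:R) v) (restr (~` cube n m%:R) v) <= d).
  exists m; first by [].
  by move=> m' /= mm'; apply: le_trans (mono _ _ mm') mP.
exfalso; have : (\int[leb]_x (v x ^+ 2)%:E <= (ip v v - d)%:E)%E.
  have sr m : sqi (restr (cube n m%:R) v) by exact: sqi_restr.
  apply: (@fatou_le _ _ _ leb (fun m x => (restr (cube n m%:R) v x ^+ 2)%:E)).
  - by move=> m; have [mr _] := sr m; exact: measurable_sqr.
  - by move=> m x; rewrite lee_fin sqr_ge0.
  - by have [mv _] := sv; exact: measurable_sqr.
  - apply: aeW => x; apply: cvg_near_cst; have := cube_cover x.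
    by apply: filterS => m mx; rewrite restr_in.
  apply: nearW => m; rewrite sqr_ipE// lee_fin (ip_restrC (mC m) sv).
  have : d < ip (restr (~` cube n m%:R) v) (restr (~` cube n m%:R) v).
    by rewrite ltNge; apply/negP => h; apply: H; exists m.
  lra.
by rewrite sqr_ipE// lee_fin; lra.
Qed.

End restriction.

(** * Powers with exponent greater than 1 *)

Section powers.
Context {R : realType}.
Variable p : R.
Hypothesis p1 : 1 < p.

Let p0 : 0 < p. Proof. exact: lt_trans p1. Qed.

(** Take [t] with (1 + t)^p = 1 + e. Either [b <= t * a], and the first term suffices, or
    [a < b / t], and the second one does. A perturbation small in L^2 thus costs only a factor close
    to 1. *)
Lemma powR_split (e : R) : 0 < e -> exists2 s, 0 <= s &
  forall a b, 0 <= a -> 0 <= b -> (a + b) `^ p <= (1 + e) * a `^ p + s * b `^ p.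
Proof.
move=> e0; pose t := (1 + e) `^ p^-1 - 1.
have t0 : 0 < t.
  have pi0 : 0 < p^-1 by rewrite invr_gt0.
  have e1 : 1 < 1 + e by rewrite ltrDl.
  have n1 : (1 : R) \in Num.nneg by rewrite nnegrE.
  have n2 : 1 + e \in Num.nneg by rewrite nnegrE addr_ge0// ltW.
  by have := gt0_ltr_powR pi0 n1 n2 e1; rewrite powR1 /t subr_gt0.
have tE : (1 + t) `^ p = 1 + e.
  rewrite /t addrC subrK -powRrM mulVf ?gt_eqF// powRr1//.
  by apply: addr_ge0 => //; exact: ltW.
exists ((1 + t^-1) `^ p); first exact: powR_ge0.
move=> a b a0 b0; have [ba|ab] := leP b (t * a).
  apply: (@le_trans _ _ ((1 + e) * a `^ p)); last by rewrite lerDl mulr_ge0 ?powR_ge0.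
  rewrite -tE -powRM//; last by rewrite addr_ge0// ltW.
  have t0' := ltW t0; have h : a + b <= (1 + t) * a by rewrite mulrDl mul1r lerD2l.
  by rewrite ge0_ler_powR ?nnegrE ?(ltW p0)//; [exact: addr_ge0|rewrite mulr_ge0// addr_ge0].
apply: (@le_trans _ _ ((1 + t^-1) `^ p * b `^ p)); last first.
  by rewrite lerDr mulr_ge0 ?powR_ge0// addr_ge0// ltW.
have ti0 : 0 <= t^-1 by rewrite invr_ge0 ltW.
rewrite -powRM ?addr_ge0//.
rewrite ge0_ler_powR ?nnegrE ?(ltW p0) ?addr_ge0 ?mulr_ge0 ?addr_ge0//.
by rewrite mulrDl mul1r addrC lerD2l mulrC ler_pdivlMr// mulrC ltW.
Qed.

Lemma powR_cvg (U : set_system nat) (a : nat -> R) (l : R) : ProperFilter U ->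
  (forall m, 0 <= a m) -> a m @[m --> U] --> l -> a m `^ p @[m --> U] --> l `^ p.
Proof.
move=> UU a0 al.
have : 0 <= l.
  by rewrite -(cvg_lim _ al)//; apply: limr_ge; [exact: cvgP al|exact: nearW].
rewrite le_eqVlt => /predU1P[l0|l0].
  (* At the limit 0 convergence is checked by hand, with threshold e^(1/p); elsewhere the power is
     differentiable. *)
  rewrite -l0 powR0 ?gt_eqF// in al *.
  apply/cvgrPdist_le => e e0; have q0 : 0 < e `^ p^-1 by exact: powR_gt0.
  move/cvgrPdist_le : al => /(_ _ q0); apply: filterS => m.
  rewrite !sub0r !normrN !ger0_norm ?powR_ge0// => am.
  apply: (@le_trans _ _ ((e `^ p^-1) `^ p)); last first.
    by rewrite -powRrM mulVf ?gt_eqF// powRr1// ltW.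
  by rewrite ge0_ler_powR ?nnegrE// ltW.
apply: (@cvg_comp _ _ _ a (fun t => t `^ p)); first exact: al.
have : {for l, continuous (fun t : R => t `^ p)}.
  apply: differentiable_continuous; apply/derivable1_diffP.
  exact: (@ex_derive _ _ _ _ _ _ _ (is_derive1_powR p l0)).
exact.
Qed.

End powers.

(** * The Choquard form and its splitting *)

Section choquard_form.
Context {R : realType} {n : nat}.
Local Notation leb := (@lebesgue_rV R n).
Local Notation sqi := (sqi leb).
Local Notation ip := (ip leb).
Variable k : 'rV[R]_n -> R.
Hypotheses (mk : measurable_fun setT k) (k0 : forall x, 0 <= k x).
Hypothesis kN : forall x, k (- x) = k x.
Hypothesis kint : forall r, 0 < r -> (\int[leb]_x (\1_(cube n r) x * k x)%:E < +oo)%E.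
Variable p : R.
Hypotheses (p1 : 1 < p) (p2 : p < 2).
Implicit Types u v w : 'rV[R]_n -> R.

Let p0 : 0 < p. Proof. exact: lt_trans p1. Qed.
Let pge0 : 0 <= p. Proof. exact: ltW. Qed.

Definition pw u : 'rV[R]_n -> R := fun x => `|u x| `^ p.
Definition bform u w := kform k (pw u) (pw w).

Lemma nn_pw u : measurable_fun setT u -> nn (pw u).
Proof.
move=> mu; split; last by move=> x; exact: powR_ge0.
by apply: (measurableT_comp (measurable_powR _)); exact: measurableT_comp.
Qed.

Lemma bform_ge0 u w : measurable_fun setT u -> measurable_fun setT w ->
  (0 <= bform u w)%E.
Proof. by move=> mu mw; apply: kform_ge0 => //; exact: nn_pw. Qed.

Lemma bform_sym u w : measurable_fun setT u -> measurable_fun setT w ->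
  bform u w = bform w u.
Proof. by move=> mu mw; apply: kform_sym => //; exact: nn_pw. Qed.

Lemma pwZ t u : pw (fun x => t * u x) = (fun x => `|t| `^ p * pw u x).
Proof. by apply/funext => x; rewrite /pw normrM powRM. Qed.

Lemma pw_le u w x : `|u x| <= `|w x| -> pw u x <= pw w x.
Proof. by move=> uw; rewrite ge0_ler_powR ?nnegrE. Qed.

Lemma bform_le u u' w w' : measurable_fun setT u -> measurable_fun setT u' ->
  measurable_fun setT w -> measurable_fun setT w' ->
  (forall x, `|u x| <= `|u' x|) -> (forall x, `|w x| <= `|w' x|) ->
  (bform u w <= bform u' w')%E.
Proof.
move=> mu mu' mw mw' uu' ww'; apply: kform_le => //; try exact: nn_pw.
- by move=> x; exact: pw_le.
- by move=> x; exact: pw_le.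
Qed.

Lemma bformZ t u : measurable_fun setT u ->
  (bform (fun x => t * u x)%R (fun x => t * u x)%R = ((`|t| `^ p) ^+ 2)%:E * bform u u)%E.
Proof.
move=> mu; have npu := nn_pw mu; have t0 : 0 <= `|t| `^ p by exact: powR_ge0.
rewrite /bform !pwZ (kformZl mk k0 t0 npu (nnZ t0 npu)) (kformZr mk k0 kN t0 npu npu).
by rewrite muleA -EFinM.
Qed.

(** The scaling factors cancel. A small [w] can therefore be balanced against a large [u] before a
    bound by the sum of their squared norms is applied. *)
Lemma bform_scale t u w : 0 < t -> measurable_fun setT u -> measurable_fun setT w ->
  bform (fun x => t * u x) (fun x => t^-1 * w x) = bform u w.
Proof.
move=> t0 mu mw; have npu := nn_pw mu; have npw := nn_pw mw.
have h0 : 0 <= `|t| `^ p by exact: powR_ge0.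
have h1 : 0 <= `|t^-1| `^ p by exact: powR_ge0.
rewrite /bform !pwZ (kformZl mk k0 h0 npu (nnZ h1 npw)) (kformZr mk k0 kN h1 npu npw).
by rewrite muleA -EFinM -powRM// -normrM divff ?gt_eqF// normr1 powR1 mul1e.
Qed.

Lemma bform_fatou u (u_ : nat -> 'rV[R]_n -> R) w (w_ : nat -> 'rV[R]_n -> R) (C : \bar R) :
  measurable_fun setT u -> measurable_fun setT w ->
  (forall m, measurable_fun setT (u_ m)) -> (forall m, measurable_fun setT (w_ m)) ->
  (\forall x \ae leb, u_ m x @[m --> \oo] --> u x) ->
  (\forall x \ae leb, w_ m x @[m --> \oo] --> w x) ->
  (\forall m \near \oo, (bform (u_ m) (w_ m) <= C)%E) -> (bform u w <= C)%E.
Proof.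
move=> mu mw mu_ mw_ uu ww.
have cpw v (v_ : nat -> 'rV[R]_n -> R) :
    (\forall x \ae leb, v_ m x @[m --> \oo] --> v x) ->
    (\forall x \ae leb, pw (v_ m) x @[m --> \oo] --> pw v x).
  apply: filterS => x vx.
  by apply: (powR_cvg p1 _) => //; exact: cvg_norm vx.
apply: kform_fatou => //; try exact: nn_pw.
- by move=> m; exact: nn_pw.
- by move=> m; exact: nn_pw.
- exact: cpw.
- exact: cpw.
Qed.

Lemma bform_bounded_fin u (M r : R) : 0 <= M -> 0 < r -> measurable_fun setT u ->
  (forall x, `|u x| <= M * \1_(cube n r) x) -> (bform u u < +oo)%E.
Proof.
move=> M0 r0 mu uM.
have Mp0 : 0 <= M `^ p by exact: powR_ge0.
have ncube : nn (fun x => M `^ p * \1_(cube n r) x).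
  split; last by move=> x; rewrite mulr_ge0 ?indic01.
  by apply: measurable_funM => //; apply: measurable_indic; exact: measurable_cube.
have le x : pw u x <= M `^ p * \1_(cube n r) x.
  rewrite /pw; apply: (@le_trans _ _ ((M * \1_(cube n r) x) `^ p)).
    by rewrite ge0_ler_powR ?nnegrE ?mulr_ge0 ?indic01.
  by rewrite indicE; case: (_ \in _); rewrite ?mulr1// !mulr0 powR0 ?gt_eqF.
apply: le_lt_trans (kform_cube_fin mk k0 kN kint Mp0 r0).
by apply: kform_le => //; exact: nn_pw.
Qed.

Section hls.
Variable c : R.
Hypotheses (c0 : 0 < c) (cP : forall u, sqi u -> bform u u = 1%E -> c <= ip u u).

Lemma hls_finite u : sqi u -> (bform u u < +oo)%E ->
  (bform u u <= ((ip u u / c) `^ p)%:E)%E.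
Proof.
move=> su uoo; have [mu _] := su.
have := bform_ge0 mu mu; rewrite le_eqVlt => /predU1P[<-|D0].
  by rewrite lee_fin powR_ge0.
have Dfin : bform u u \is a fin_num by rewrite ge0_fin_numE// ltW.
move: D0; rewrite -(fineK Dfin); set d := fine _; rewrite !lte_fin lee_fin => d0.
(* The form is homogeneous of degree [2 * p], so this factor normalises it to 1. *)
pose t := d `^ (- (2 * p)^-1).
have t0 : 0 < t by exact: powR_gt0.
have t2 : (t ^+ 2) `^ p = d^-1.
  rewrite /t -powR_mulrn ?powR_ge0// -!powRrM.
  rewrite mulNr mulVf ?gt_eqF ?mulr_gt0//.
  by rewrite powR_inv1// ltW.
have H : bform (fun x => t * u x) (fun x => t * u x) = 1%E.
  rewrite bformZ// gtr0_norm// -(fineK Dfin) -/d -EFinM; congr EFin.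
  by rewrite expr2 -powRM ?(ltW t0)// -expr2 t2 mulVf// gt_eqF.
have := cP (sqiZ t su) H; rewrite ip_sqrZ// => h.
have h2 : (t ^+ 2)^-1 <= ip u u / c.
  rewrite ler_pdivlMr// mulrC ler_pdivrMr ?exprn_gt0//; by rewrite mulrC.
apply: (@le_trans _ _ (((t ^+ 2)^-1) `^ p)); last first.
  by rewrite ge0_ler_powR ?nnegrE ?invr_ge0 ?sqr_ge0 ?divr_ge0 ?ip_ge0// ltW.
rewrite -powR_inv1 ?sqr_ge0// -powRrM mulrC powRrM t2 powR_inv1 ?invr_ge0 ?(ltW d0)//.
by rewrite invrK.
Qed.

(** The cut-off is in height and in space: a bounded function with bounded support has a finite
    form, as [hls_finite] requires. *)
Definition trunc u (m : nat) : 'rV[R]_n -> R :=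
  fun x => \1_([set x | `|u x| < m%:R] `&` cube n m%:R) x * u x.

Lemma measurable_trunc_set u (m : nat) : measurable_fun setT u ->
  measurable ([set x | `|u x| < m%:R] `&` cube n m%:R).
Proof.
move=> mu; apply: measurableI; last exact: measurable_cube.
rewrite (_ : [set x | _] = u @^-1` `]- m%:R, m%:R[%classic).
  by rewrite -[X in measurable X]setTI; exact: mu.
by apply/seteqP; split => x /=; rewrite in_itv/= ltr_norml.
Qed.

Lemma trunc_cvg u x : trunc u m x @[m --> \oo] --> u x.
Proof.
apply: cvg_near_cst; have := cube_cover x; have := nbhs_infty_gtr `|u x|.
apply: filterS2 => m h1 h2; rewrite /trunc indicE mem_set ?mul1r//.
Qed.

(* This is the Hardy-Littlewood-Sobolev inequality, as far as it follows from
   [c] being a positive lower bound for the constrained infimum: truncations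
   have a finite form, hence can be normalised. *)
Lemma hls u : sqi u -> (bform u u <= ((ip u u / c) `^ p)%:E)%E.
Proof.
move=> su; have [mu _] := su.
have st m : sqi (trunc u m) by apply: sqi_restr => //; exact: measurable_trunc_set.
apply: (@bform_fatou _ (trunc u) _ (trunc u)) => //.
- by move=> m; have [] := st m.
- by move=> m; have [] := st m.
- by apply: aeW => x; exact: trunc_cvg.
- by apply: aeW => x; exact: trunc_cvg.
near=> m; have [mt _] := st m.
have m0 : 0 < m%:R :> R by rewrite ltr0n; near: m; exists 1%N.
apply: (@le_trans _ _ ((ip (trunc u m) (trunc u m) / c) `^ p)%:E).
  apply: hls_finite => //; apply: (bform_bounded_fin (ltW m0) m0) => // x.
  rewrite /trunc !indicE; case: (boolP (x \in _ `&` _)) => xm; last first.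
    by rewrite mul0r normr0 mulr_ge0.
  by move: xm; rewrite mul1r inE => -[/= h1 h2]; rewrite mem_set// mulr1 ltW.
rewrite lee_fin ge0_ler_powR ?nnegrE ?divr_ge0 ?ip_ge0 ?(ltW c0)//.
rewrite ler_pM2r ?invr_gt0// -lee_fin -!sqr_ipE//; have [mtr _] := st m.
apply: ge0_le_integral => //.
- by move=> x _; rewrite lee_fin sqr_ge0.
- exact: measurable_sqr.
- exact: measurable_sqr.
move=> x _; rewrite lee_fin /trunc indicE; case: (_ \in _); rewrite ?mul1r//.
by rewrite mul0r expr0n sqr_ge0.
Unshelve. all: by end_near. Qed.

(** Both arguments are dominated by [|u| + |w|], to which [hls] applies. *)
Lemma cross_le u w : sqi u -> sqi w ->
  (bform u w <= ((2 * (ip u u + ip w w) / c) `^ p)%:E)%E.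
Proof.
move=> su sw; have [mu _] := su; have [mw _] := sw.
pose s x := `|u x| + `|w x|.
have ss : sqi s by apply: sqiD; exact: sqi_norm.
have [ms _] := ss.
apply: (@le_trans _ _ (bform s s)).
  apply: bform_le => // x; rewrite (@ger0_norm _ (s x)) ?addr_ge0//.
    by rewrite lerDl.
  by rewrite lerDr.
apply: le_trans (hls ss) _; rewrite lee_fin.
have q0 : 0 <= 2 * (ip u u + ip w w) / c.
  by rewrite divr_ge0 ?mulr_ge0 ?addr_ge0 ?ip_ge0// ltW.
rewrite ge0_ler_powR ?nnegrE ?divr_ge0 ?ip_ge0 ?(ltW c0)//.
  by rewrite mulr_ge0// addr_ge0 ?ip_ge0.
rewrite ler_pM2r ?invr_gt0//.
apply: le_trans (ip_sqrD_le (sqi_norm su) (sqi_norm sw)) _.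
by rewrite !ip_norm.
Qed.

Lemma cross_small (M e : R) : 0 < e -> exists2 d, 0 < d & forall u w, sqi u -> sqi w ->
  ip u u <= M -> ip w w <= d -> (bform u w <= e%:E)%E.
Proof.
move=> e0.
pose q := e `^ p^-1; have q0 : 0 < q by exact: powR_gt0.
have qE : q `^ p = e by rewrite /q -powRrM mulVf ?gt_eqF// powRr1// ltW.
(* [cross_le] yields e as soon as the two rescaled squared norms add up to at most [a]. *)
pose a := c * q / 2; have a0 : 0 < a by rewrite divr_gt0// mulr_gt0.
(* With [t ^+ 2 = a / (2 * (|M| + 1))], both [t ^+ 2 * M] and [d / t ^+ 2]
   are at most [a / 2]. *)
pose T := a / (2 * (`|M| + 1)).
have M1 : 0 < `|M| + 1 by rewrite ltr_wpDl.
have T0 : 0 < T by rewrite divr_gt0// mulr_gt0.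
exists (T * (a / 2)); first by rewrite mulr_gt0// divr_gt0.
move=> u w su sw uM wd; have [mu _] := su; have [mw _] := sw.
pose t := Num.sqrt T; have t0 : 0 < t by rewrite sqrtr_gt0.
have t2 : t ^+ 2 = T by rewrite sqr_sqrtr// ltW.
rewrite -(bform_scale t0 mu mw).
apply: le_trans (cross_le (sqiZ _ su) (sqiZ _ sw)) _; rewrite lee_fin -qE.
rewrite !ip_sqrZ// exprVn t2.
have h1 : T * ip u u <= a / 2.
  apply: (@le_trans _ _ (T * (`|M| + 1))).
    by rewrite ler_pM2l// (le_trans uM)// (le_trans (ler_norm M))// lerDl.
  by rewrite /T le_eqVlt; apply/orP; left; apply/eqP; field; rewrite gt_eqF.
have h2 : T^-1 * ip w w <= a / 2 by rewrite mulrC ler_pdivrMr// mulrC.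
rewrite ge0_ler_powR ?nnegrE ?(ltW q0)//.
  rewrite divr_ge0 ?(ltW c0)// mulr_ge0// addr_ge0// mulr_ge0 ?ip_ge0 ?(ltW T0)//.
  by rewrite invr_ge0 ltW.
rewrite ler_pdivrMr//; have : a * 2 = c * q by rewrite /a; field.
rewrite [q * c]mulrC; lra.
Qed.

Lemma bform_fin u w : sqi u -> sqi w -> bform u w \is a fin_num.
Proof.
move=> su sw; have [mu _] := su; have [mw _] := sw.
by rewrite ge0_fin_numE ?bform_ge0//; apply: le_lt_trans (cross_le su sw) (ltry _).
Qed.

Section tail.
Variables (u : 'rV[R]_n -> R) (M : R).
Hypothesis (su : sqi u).

(** Uniformity in [w] is the point: far away, only the norm of the functions [v_m] is under
    control. *)
Definition tail_le (r s : R) := forall w, sqi w -> ip w w <= M ->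
  (bform u (restr (~` cube n r) w) <= s%:E)%E.

Lemma tail_le_mono r r' s s' : r <= r' -> s <= s' -> tail_le r s -> tail_le r' s'.
Proof.
move=> rr' ss' H w sw wM; have [mu _] := su; have [mw _] := sw.
apply: (@le_trans _ _ s%:E); last by rewrite lee_fin.
have mr t : measurable_fun setT (restr (~` cube n t) w).
  by have [] : sqi (restr (~` cube n t) w) by apply: sqi_restr => //; apply: measurableC;
    exact: measurable_cube.
apply: le_trans (H w sw wM); apply: bform_le => // x.
by apply: restr_norm_sub => y /= h h'; apply: h; exact: sub_cube h'.
Qed.

Lemma tail_le_trivial r : tail_le r ((2 * (ip u u + M) / c) `^ p).
Proof.
move=> w sw wM.
have mC : measurable (~` cube n r) by apply: measurableC; exact: measurable_cube.
have sr := sqi_restr mC sw.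
apply: le_trans (cross_le su sr) _; rewrite lee_fin.
have h := ip_restr_le mC sw.
have g0 : 0 <= ip (restr (~` cube n r) w) (restr (~` cube n r) w) by exact: ip_ge0.
have u0 : 0 <= ip u u by exact: ip_ge0.
rewrite ge0_ler_powR ?nnegrE ?divr_ge0 ?(ltW c0)//; first by lra.
  by lra.
by rewrite ler_pM2r ?invr_gt0//; lra.
Qed.

(** The condition [p < 2], that is [alpha < N], makes this factor less than 1. *)
Definition tail_ratio : R := 2 `^ (p / 2 - 1).

Lemma tail_ratio_gt0 : 0 < tail_ratio. Proof. exact: powR_gt0. Qed.

Lemma tail_ratio_lt1 : tail_ratio < 1.
Proof.
rewrite /tail_ratio /powR pnatr_eq0/= -[ltRHS]expR0 ltr_expR.
by rewrite nmulr_rlt0; [rewrite ln_gt0// ltr1n|have := p2; lra].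
Qed.

Lemma pw_disjoint v w : (forall x, v x * w x = 0) ->
  pw (fun x => v x + w x) = (fun x => pw v x + pw w x).
Proof.
move=> vw; apply/funext => x; rewrite /pw.
have /eqP := vw x; rewrite mulf_eq0 => /orP[]/eqP->.
  by rewrite normr0 powR0 ?gt_eqF// !add0r.
by rewrite normr0 powR0 ?gt_eqF// !addr0.
Qed.

(* Two functions with disjoint supports far away, superposed with weight
   [2^(-1/2)] each, interact with [u] by [2^(-p/2)] times the sum of their
   interactions; as [2 * 2^(-p/2) > 1], one of them interacts less. *)
Lemma tail_contract r s : 0 < s -> tail_le r s -> exists r', tail_le r' (tail_ratio * s).
Proof.
move=> s0 H; apply: contrapT => K; have [mu _] := su.
have mC (t : R) : measurable (cube n t) by exact: measurable_cube.
have mD (t : R) : measurable (~` cube n t) by exact: measurableC.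
(* If the conclusion fails, every cube has a competitor outside it that exceeds the smaller
   bound. *)
have far (t : R) : exists w, [/\ sqi w, ip w w <= M &
    ((tail_ratio * s)%:E < bform u (restr (~` cube n t) w))%E].
  apply: contrapT => h; apply: K; exists t => w sw wM; rewrite leNgt; apply/negP => h'.
  by apply: h; exists w.
have [w [sw wM wE]] := far r.
have sw' := sqi_restr (mD r) sw; have [mw' _] := sw'.
pose near m := restr (cube n m) (restr (~` cube n r) w).
have snear m : sqi (near m) by exact: sqi_restr.
(* By Fatou the strict lower bound survives cutting [w] off at a large cube, which leaves the space
   beyond it to a second competitor. *)
have [m mE] : exists m : nat, ((tail_ratio * s)%:E < bform u (near m%:R))%E.
  apply: contrapT => h; move: wE; rewrite ltNge => /negP; apply.
  apply: (@bform_fatou _ (fun=> u) _ (fun m => near m%:R)) => //.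
  - by move=> m; have [] := snear m%:R.
  - by apply: aeW => x; exact: cvg_cst.
  - apply: aeW => x; apply: cvg_near_cst; have := cube_cover x.
    by apply: filterS => m mx; rewrite /near restr_in.
  apply: nearW => m; rewrite leNgt; apply/negP => h'; apply: h; by exists m.
have [z [sz zM zE]] := far (Num.max m%:R r).
set a := near m%:R; set b := restr (~` cube n (Num.max m%:R r)) z.
have sa : sqi a by exact: snear.
have sb : sqi b by exact: sqi_restr.
have [ma _] := sa; have [mb _] := sb.
have ab x : a x * b x = 0.
  have [mx|mx] := pselect (cube n m%:R x); last by rewrite /a /near restr_out ?mul0r.
  rewrite /b restr_out ?mulr0// => /(_ _); apply; apply: sub_cube mx.
  by rewrite le_max lexx.
pose h : R := (Num.sqrt 2)^-1; pose W x := h * (a x + b x).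
have h0 : 0 < h by rewrite invr_gt0 sqrtr_gt0.
have h2 : h ^+ 2 = 2^-1 by rewrite exprVn sqr_sqrtr.
have sab : sqi (fun x => a x + b x) by exact: sqiD.
have sW : sqi W by exact: sqiZ.
have WM : ip W W <= M.
  rewrite ip_sqrZ// h2 ip_sqrD// (ip_disjoint ab) mulr0 addr0.
  have aM : ip a a <= M.
    apply: le_trans (ip_restr_le (mC _) sw') _.
    exact: le_trans (ip_restr_le (mD _) sw) _.
  have bM : ip b b <= M by apply: le_trans (ip_restr_le (mD _) sz) _.
  lra.
have WE : restr (~` cube n r) W = W.
  apply/funext => x; have [rx|rx] := pselect (cube n r x); last by rewrite restr_in.
  rewrite restr_out; last exact.
  have ax0 : a x = 0.
    apply/eqP; rewrite -normr_le0; apply: le_trans (restr_norm_le _ _ _) _.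
    by rewrite restr_out ?normr0//; exact.
  have bx0 : b x = 0.
    by rewrite /b restr_out// => /(_ _); apply; apply: sub_cube rx; rewrite le_max lexx orbT.
  by rewrite /W ax0 bx0 addr0 mulr0.
have := H W sW WM; rewrite WE leNgt => /negP; apply.
have npa := nn_pw ma; have npb := nn_pw mb; have npu := nn_pw mu.
have ph0 : 0 <= `|h| `^ p by exact: powR_ge0.
have pE : pw W = (fun x => `|h| `^ p * (pw a x + pw b x)) by rewrite pwZ (pw_disjoint ab).
rewrite /bform pE (kformZr mk k0 kN ph0 npu (nnD npa npb)).
rewrite (kformDr mk k0 kN npu npa npb).
(* The weight 2^(-p/2) of each competitor is compensated by twice the ratio 2^(p/2 - 1), so the
   superposition interacts by more than [s]. *)
have hE : `|h| `^ p * (2 * tail_ratio) = 1.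
  rewrite gtr0_norm// /tail_ratio mulr_powRB1//; last by have := p0; lra.
  have E2 : h^-1 `^ 2 = 2 by rewrite powR_mulrn ?invr_ge0 ?ltW// exprVn h2 invrK.
  rewrite -{1}E2 -powRrM mulrCA divff// mulr1.
  by rewrite -powRM ?invr_ge0 ?ltW// divff ?gt_eqF// powR1.
have [x xE] : exists x, bform u a = x%:E by exists (fine (bform u a)); rewrite fineK// bform_fin.
have [y yE] : exists y, bform u b = y%:E by exists (fine (bform u b)); rewrite fineK// bform_fin.
move: mE zE; rewrite -/a -/b xE yE !lte_fin => xs ys.
rewrite [X in X + _]xE [X in _ + X]yE -EFinD -EFinM lte_fin.
have : `|h| `^ p * (2 * tail_ratio) * s < `|h| `^ p * (x + y).
  by rewrite -mulrA ltr_pM2l ?powR_gt0 ?gtr0_norm//; lra.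
by rewrite hE mul1r.
Qed.

(** The trivial bound is contracted repeatedly by [tail_ratio]. Adding 1 to it makes the initial
    bound positive. *)
Lemma tail_small (e : R) : 0 < e -> exists r, tail_le r e.
Proof.
move=> e0; pose s := (2 * (ip u u + M) / c) `^ p + 1.
have s0 : 0 < s by rewrite ltr_wpDl ?powR_ge0.
have H j : exists r, tail_le r (tail_ratio ^+ j * s).
  elim: j => [|j [r IH]].
    exists 0; rewrite expr0 mul1r; apply: (tail_le_mono (lexx _) _ (tail_le_trivial 0)).
    by rewrite /s lerDl.
  have [|r' Hr'] := tail_contract _ IH; first by rewrite mulr_gt0// exprn_gt0// tail_ratio_gt0.
  by exists r'; rewrite exprS -mulrA.
have : tail_ratio ^+ j * s @[j --> \oo] --> 0 * s.
  apply: cvgMr_tmp; apply: cvg_expr.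
  by rewrite gtr0_norm ?tail_ratio_gt0// tail_ratio_lt1.
rewrite mul0r => /cvgrPdist_le/(_ _ e0)[j _ /(_ j (leqnn j))].
rewrite sub0r normrN => /(le_trans (ler_norm _)) je.
by have [r Hr] := H j; exists r; apply: tail_le_mono Hr.
Qed.

End tail.

(** A large cube sorts the sum into a main part [g], made of [u] inside and [v_m] outside, and an
    error [h] that is small in L^2. The two pieces of [g] have disjoint supports, so the power of
    [g] splits exactly and their interaction is a tail; [powR_split] and [cross_small] absorb
    [h]. *)
Lemma choquard_split (U : set_system nat) u (v_ : nat -> 'rV[R]_n -> R) (M e : R) :
  Filter U -> sqi u -> (forall m, sqi (v_ m)) -> 0 < e ->
  (\forall m \near U, ip (v_ m) (v_ m) <= M) ->
  (forall r, 0 < r -> ip (restr (cube n r) (v_ m)) (restr (cube n r) (v_ m)) @[m --> U] -->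
    (0 : R)) ->
  \forall m \near U, (bform (fun x => u x + v_ m x)%R (fun x => u x + v_ m x)%R <=
    (1 + e)%:E * (bform u u + ((ip (v_ m) (v_ m) / c) `^ p)%:E) + e%:E)%E.
Proof.
move=> FU su sv e0 vM vloc; have [mu _] := su.
(* As [kap <= 1], [(1 + kap) ^+ 2 <= 1 + 3 * kap <= 1 + e]. *)
pose kap := Num.min e 1 / 3.
have kap0 : 0 < kap by rewrite divr_gt0// lt_min e0 /=.
have kape : (1 + kap) ^+ 2 <= 1 + e /\ kap <= 1.
  have : Num.min e 1 <= e by rewrite ge_min lexx.
  have : Num.min e 1 <= 1 by rewrite ge_min lexx orbT.
  rewrite /kap; move: kap0; rewrite /kap; nra.
have [kap2 kap1] := kape.
have [sg sg0 sgP] := powR_split p1 kap0.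
(* The tails will cost [2 * (1 + e) * tau = e / 4], and the terms containing [h] at most
   [(4 * sg + sg ^+ 2) * del <= e / 4]. *)
pose tau := e / (8 * (1 + e)).
have tau0 : 0 < tau by rewrite divr_gt0// mulr_gt0// addr_gt0.
pose del := e / (4 * (4 * sg + sg ^+ 2 + 1)).
have sg1 : 0 < 4 * sg + sg ^+ 2 + 1 by rewrite ltr_wpDl// addr_ge0 ?sqr_ge0// mulr_ge0.
have del0 : 0 < del by rewrite divr_gt0// mulr_gt0.
have [r0 r0P] := tail_small M su tau0.
have [d d0 dP] := cross_small (2 * (ip u u + `|M|) + 1) del0.
(* Both pieces of [h] have squared norm at most [d'], hence [ip h h <= 4 * d']. This is at most [d],
   and at most 1, so that [h] may also stand as first argument in [dP]. *)
pose d' := Num.min d 1 / 4.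
have d'0 : 0 < d' by rewrite divr_gt0// lt_min d0/=.
have dd' : 4 * d' <= d /\ 4 * d' <= 1.
  have : Num.min d 1 <= d by rewrite ge_min lexx.
  have : Num.min d 1 <= 1 by rewrite ge_min lexx orbT.
  by rewrite /d'; lra.
have [r [rpos rr0 rtail]] : exists r : R, [/\ 0 < r, r0 <= r &
    ip (restr (~` cube n r) u) (restr (~` cube n r) u) <= d'].
  have := ip_restr_tail su d'0; have := nbhs_infty_gtr (Num.max r0 0).
  move=> H1 H2; have [m _ Hm] := filterI H1 H2; exists m%:R.
  have [] := Hm m (leqnn m); rewrite /= gt_max => /andP[h1 h2] h3.
  by split => //; exact: ltW.
have rP := tail_le_mono su rr0 (lexx tau) r0P.
have mC : measurable (cube n r) by exact: measurable_cube.
have mD : measurable (~` cube n r) by exact: measurableC.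
have := vloc r rpos => /cvgrPdist_le/(_ _ d'0).
move: vM; apply: filterS2 => m vM; rewrite sub0r normrN => /(le_trans (ler_norm _)) vd.
set v := v_ m in vM vd *; have sv' : sqi v by exact: sv.
pose uQ := restr (cube n r) u; pose uD := restr (~` cube n r) u.
pose vQ := restr (cube n r) v; pose vD := restr (~` cube n r) v.
have suQ : sqi uQ by exact: sqi_restr.
have suD : sqi uD by exact: sqi_restr.
have svQ : sqi vQ by exact: sqi_restr.
have svD : sqi vD by exact: sqi_restr.
pose g x := uQ x + vD x; pose h x := vQ x + uD x.
have sqg : sqi g by exact: sqiD.
have sqh : sqi h by exact: sqiD.
have [mg _] := sqg; have [mh _] := sqh.
have [muQ _] := suQ; have [mvD _] := svD; have [mv _] := sv'.
have uQu : ip uQ uQ <= ip u u by exact: ip_restr_le.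
have vDv : ip vD vD <= ip v v by exact: ip_restr_le.
have MM := ler_norm M.
have gM : ip g g <= 2 * (ip u u + `|M|) + 1.
  by apply: le_trans (ip_sqrD_le suQ svD) _; lra.
have u0 : 0 <= ip u u by exact: ip_ge0.
have M0 : 0 <= `|M| by [].
have hd : ip h h <= 4 * d'.
  apply: le_trans (ip_sqrD_le svQ suD) _; rewrite /vQ /uD; lra.
have [hd1 hd2] := dd'.
have npg := nn_pw mg; have nph := nn_pw mh.
have [y yE] : exists y, bform g h = y%:E by exists (fine (bform g h)); rewrite fineK// bform_fin.
have [z zE] : exists z, bform h h = z%:E by exists (fine (bform h h)); rewrite fineK// bform_fin.
have [x xE] : exists x, bform g g = x%:E by exists (fine (bform g g)); rewrite fineK// bform_fin.
have [D DE] : exists D, bform u u = D%:E by exists (fine (bform u u)); rewrite fineK// bform_fin.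
have ydel : y <= del.
  by rewrite -lee_fin -yE; apply: dP => //; lra.
have zdel : z <= del.
  by rewrite -lee_fin -zE; apply: dP => //; lra.
have z0 : 0 <= z by rewrite -lee_fin -zE bform_ge0.
have y0 : 0 <= y by rewrite -lee_fin -yE bform_ge0.
set H := (ip v v / c) `^ p.
have xD : x <= D + 2 * tau + H.
  rewrite -lee_fin -xE.
  have npu := nn_pw muQ; have npv := nn_pw mvD.
  have E : pw g = (fun x => pw uQ x + pw vD x).
    by apply: pw_disjoint => t; exact: restr_disjoint.
  rewrite /bform E (kformDl mk k0 npu npv (nnD npu npv)).
  rewrite (kformDr mk k0 kN npu npu npv) (kformDr mk k0 kN npv npu npv).
  have h1 : (bform uQ uQ <= D%:E)%E.
    by rewrite -DE; apply: bform_le => // t; exact: restr_norm_le.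
  have h2 : (bform uQ vD <= tau%:E)%E.
    apply: le_trans (rP v sv' vM); apply: bform_le => // t; exact: restr_norm_le.
  have h3 : (bform vD uQ <= tau%:E)%E by rewrite bform_sym.
  have h4 : (bform vD vD <= H%:E)%E.
    apply: le_trans (hls sv'); apply: bform_le => // t; exact: restr_norm_le.
  apply: (@le_trans _ _ ((D%:E + tau%:E) + (tau%:E + H%:E))%E).
    exact: (leeD (leeD h1 h2) (leeD h3 h4)).
  by rewrite -!EFinD lee_fin; lra.
have k1 : 0 <= 1 + kap by lra.
have muv : measurable_fun setT (fun x => u x + v x) by exact: measurable_funD.
pose F x := (1 + kap) * pw g x + sg * pw h x.
have nF : nn F by apply: nnD; exact: nnZ.
apply: (@le_trans _ _ (kform k F F)).
  have le x0 : pw (fun x => u x + v x) x0 <= F x0.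
    apply: (@le_trans _ _ ((`|g x0| + `|h x0|) `^ p)); last exact: sgP.
    rewrite /pw ge0_ler_powR ?nnegrE ?addr_ge0//.
    apply: le_trans (ler_normD _ _); rewrite /g /h.
    rewrite {1}(restr_split (cube n r) u) {1}(restr_split (cube n r) v).
    by rewrite -/uQ -/uD -/vQ -/vD le_eqVlt; apply/orP; left; apply/eqP; congr (`|_|); ring.
  by apply: kform_le => //; exact: nn_pw.
have nkg := nnZ k1 npg; have nkh := nnZ sg0 nph.
rewrite /F (kformDl mk k0 nkg nkh nF) (kformDr mk k0 kN nkg nkg nkh) (kformDr mk k0 kN nkh nkg nkh).
rewrite !(kformZl mk k0 k1 npg _)// !(kformZl mk k0 sg0 nph _)//.
rewrite !(kformZr mk k0 kN k1 _ npg)// !(kformZr mk k0 kN sg0 _ nph)//.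
rewrite -!/(bform _ _) (bform_sym mh mg) xE yE zE DE -!EFinM -!EFinD lee_fin.
have t8 : tau * (8 * (1 + e)) = e by rewrite /tau divfK// gt_eqF// mulr_gt0// addr_gt0.
have d4 : del * (4 * (4 * sg + sg ^+ 2 + 1)) = e by rewrite /del divfK// gt_eqF// mulr_gt0.
have H0 : 0 <= H by exact: powR_ge0.
have D0 : 0 <= D by rewrite -lee_fin -DE bform_ge0.
have s1 : (1 + kap) ^+ 2 * x <= (1 + e) * (D + 2 * tau + H).
  apply: (@le_trans _ _ ((1 + kap) ^+ 2 * (D + 2 * tau + H))).
    by rewrite ler_wpM2l ?sqr_ge0.
  by rewrite ler_wpM2r//; lra.
have s2 : (1 + kap) * sg * y <= 2 * sg * del.
  by apply: ler_pM => //; [rewrite mulr_ge0|rewrite ler_wpM2r//; lra].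
have s3 : sg ^+ 2 * z <= sg ^+ 2 * del by rewrite ler_wpM2l ?sqr_ge0.
nra.
Qed.

End hls.
End choquard_form.

(** * The energy *)

Section sobolev.
Context {R : realType} {n : nat}.
Local Notation leb := (@lebesgue_rV R n).
Local Notation sqi := (sqi leb).
Local Notation ip := (ip leb).
Implicit Types (u v w g h : 'rV[R]_n -> R).

Lemma weak_partialE i u g : is_weak_partial i u g <->
  forall f, test_function f -> ip u (partial i f) = - ip g f.
Proof. by []. Qed.

Lemma H1_sqi u : H1 u -> sqi u.
Proof. by move=> [/Lfun2P]. Qed.

Lemma weak_partialP i u : H1 u ->
  sqi (weak_partial i u) /\ is_weak_partial i u (weak_partial i u).
Proof.
move=> [_ /(_ i)[g gL ug]]; rewrite /weak_partial.
have [|/Lfun2P] := @xgetPex _ (fun=> 0) [set g | L2 g /\ is_weak_partial i u g]; last by [].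
by exists g.
Qed.

Lemma sqi_weak_partial i u : H1 u -> sqi (weak_partial i u).
Proof. by move=> /(weak_partialP i)[]. Qed.

Lemma weak_partial_unique i u g h : sqi g -> sqi h -> is_weak_partial i u g ->
  is_weak_partial i u h -> g = h %[ae leb].
Proof.
move=> sg sh ug uh.
have /fundamental_lemma : sqi (fun x => g x - h x) by exact: sqiB.
have ortho : orthogonal_to_tensors (fun x => g x - h x).
  move=> b r sb br; have tb := tensor_test sb br; have [st _] := test_function_sqi tb.
  rewrite ipBl//; have := ug _ tb; have := uh _ tb.
  rewrite -/(ip u _) -/(ip g _) -/(ip h _) => -> /oppr_inj ->; exact: subrr.
by move=> /(_ ortho); apply: filterS => x /= gh _; apply/eqP; rewrite -subr_eq0 gh.
Qed.

Lemma is_weak_partialB i u v g h : sqi u -> sqi v -> sqi g -> sqi h ->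
  is_weak_partial i u g -> is_weak_partial i v h ->
  is_weak_partial i (fun x => u x - v x) (fun x => g x - h x).
Proof.
move=> su sv sg sh ug vh; apply/weak_partialE => f tf.
have [sf spf] := test_function_sqi tf.
move/weak_partialE : ug => /(_ f tf) E1; move/weak_partialE : vh => /(_ f tf) E2.
by rewrite ipBl// ipBl// E1 E2 opprB opprK addrC.
Qed.

Lemma is_weak_partialZ i t u g : sqi u -> sqi g -> is_weak_partial i u g ->
  is_weak_partial i (fun x => t * u x) (fun x => t * g x).
Proof.
move=> su sg ug; apply/weak_partialE => f tf.
have [sf spf] := test_function_sqi tf.
by move/weak_partialE : ug => /(_ f tf) E1; rewrite ipZl// ipZl// E1 mulrN.
Qed.

Lemma H1_intro u (g : 'I_n -> 'rV[R]_n -> R) : sqi u -> (forall i, sqi (g i)) ->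
  (forall i, is_weak_partial i u (g i)) -> H1 u.
Proof.
by move=> su sg ug; split; [exact/Lfun2P|move=> i; exists (g i) => //; exact/Lfun2P].
Qed.

(** [weak_partial] chooses a representative, so every rule of computation for it holds only almost
    everywhere. *)
Lemma weak_partial_ae i u g : H1 u -> sqi g -> is_weak_partial i u g ->
  weak_partial i u = g %[ae leb].
Proof.
move=> /(weak_partialP i)[su wu] sg ug; exact: weak_partial_unique wu ug.
Qed.

Lemma H1B u v : H1 u -> H1 v -> H1 (fun x => u x - v x).
Proof.
move=> Hu Hv; have su := H1_sqi Hu; have sv := H1_sqi Hv.
apply: (H1_intro (g := fun i x => weak_partial i u x - weak_partial i v x)).
- exact: sqiB.
- by move=> i; apply: sqiB; exact: sqi_weak_partial.
move=> i; have [s1 w1] := weak_partialP i Hu; have [s2 w2] := weak_partialP i Hv.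
exact: is_weak_partialB.
Qed.

Lemma H1Z t u : H1 u -> H1 (fun x => t * u x).
Proof.
move=> Hu; have su := H1_sqi Hu.
apply: (H1_intro (g := fun i x => t * weak_partial i u x)).
- exact: sqiZ.
- by move=> i; apply: sqiZ; exact: sqi_weak_partial.
by move=> i; have [s1 w1] := weak_partialP i Hu; exact: is_weak_partialZ.
Qed.

Lemma weak_partialB i u v : H1 u -> H1 v ->
  weak_partial i (fun x => u x - v x) =
  (fun x => weak_partial i u x - weak_partial i v x) %[ae leb].
Proof.
move=> Hu Hv; have [s1 w1] := weak_partialP i Hu; have [s2 w2] := weak_partialP i Hv.
apply: weak_partial_ae; [exact: H1B|exact: sqiB|].
by apply: is_weak_partialB => //; exact: H1_sqi.
Qed.

Lemma weak_partialZ i t u : H1 u ->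
  weak_partial i (fun x => t * u x) = (fun x => t * weak_partial i u x) %[ae leb].
Proof.
move=> Hu; have [s1 w1] := weak_partialP i Hu.
apply: weak_partial_ae; [exact: H1Z|exact: sqiZ|].
by apply: is_weak_partialZ => //; exact: H1_sqi.
Qed.

Definition grad2 u : R := \sum_i ip (weak_partial i u) (weak_partial i u).

Lemma grad2_ge0 u : 0 <= grad2 u.
Proof. by apply: sumr_ge0 => i _; exact: ip_ge0. Qed.

Lemma grad2Z t u : H1 u -> grad2 (fun x => t * u x) = t ^+ 2 * grad2 u.
Proof.
move=> Hu; rewrite /grad2 mulr_sumr; apply: eq_bigr => i _.
have s1 := sqi_weak_partial i Hu; rewrite -ip_sqrZ//.
have s2 := sqi_weak_partial i (H1Z t Hu); have s3 := sqiZ t s1.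
by apply: ae_ip => //; exact: weak_partialZ.
Qed.

Lemma grad2B u v : H1 u -> H1 v -> grad2 (fun x => u x - v x) =
  grad2 u - 2 * (\sum_i ip (weak_partial i u) (weak_partial i v)) + grad2 v.
Proof.
move=> Hu Hv; rewrite /grad2 mulr_sumr -sumrB -big_split/=; apply: eq_bigr => i _.
have s1 := sqi_weak_partial i Hu; have s2 := sqi_weak_partial i Hv.
rewrite -ip_sqrB//; have s3 := sqi_weak_partial i (H1B Hu Hv).
have s4 := sqiB s1 s2; by apply: ae_ip => //; exact: weak_partialB.
Qed.

(** Taking [w = u] gives the norm of H^1, and taking [w = V u] gives the energy. *)
Lemma integral_weak_grad_sqr u w : H1 u -> sqi w ->
  (\int[leb]_x (weak_grad_sqr u x + u x * w x)%:E = (grad2 u + ip u w)%:E)%E.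
Proof.
move=> Hu sw; have su := H1_sqi Hu.
have iu : leb.-integrable setT (fun x : 'rV[R]_n => (u x * w x)%:E) by exact: sqi_integrable.
have ig i : leb.-integrable setT (fun x : 'rV[R]_n => (weak_partial i u x * weak_partial i u x)%:E).
  by apply: sqi_integrable; exact: sqi_weak_partial.
under eq_integral do rewrite EFinD.
rewrite integralD//; last first.
  rewrite (_ : (fun _ => _) = (fun x : 'rV[R]_n =>
      \sum_i (weak_partial i u x * weak_partial i u x)%:E)%E).
    by apply: integrable_sum => // i _; exact: ig.
  by apply/funext => x; rewrite sumEFin; congr EFin; apply: eq_bigr => i _; rewrite expr2.
rewrite EFinD ipE//; congr (_ + _)%E.
under eq_integral => x _.
  rewrite /weak_grad_sqr (_ : \sum_i _ = \sum_i weak_partial i u x * weak_partial i u x);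
    last first.
    by apply: eq_bigr => i _; rewrite expr2.
  rewrite -sumEFin; over.
rewrite integral_sum// /grad2 -sumEFin; apply: eq_bigr => i _.
by rewrite ipE//; exact: sqi_weak_partial.
Qed.

Definition sobolev2 u : R := grad2 u + ip u u.

Lemma sobolev2_ge0 u : 0 <= sobolev2 u.
Proof. by rewrite addr_ge0 ?grad2_ge0 ?ip_ge0. Qed.

Lemma H1normE u : H1 u -> H1norm u = (Num.sqrt (sobolev2 u))%:E.
Proof.
move=> Hu; rewrite /H1norm.
under eq_integral do rewrite expr2.
rewrite integral_weak_grad_sqr//; last exact: H1_sqi.
by rewrite poweR_EFin powR12_sqrt// sobolev2_ge0.
Qed.

Lemma ip_ae_ge0 v w : sqi v -> sqi w -> (\forall x \ae leb, 0 <= v x * w x) -> 0 <= ip v w.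
Proof.
move=> sv sw vw; have [mv _] := sv; have [mw _] := sw.
have mvw : measurable_fun setT (fun x => v x * w x) by exact: measurable_funM.
rewrite -lee_fin -ipE//.
have -> : (\int[leb]_x (v x * w x)%:E = \int[leb]_x `|v x * w x|%:E)%E.
  apply: ae_eq_integral => //.
  - exact/measurable_EFinP.
  - by apply/measurable_EFinP; exact: measurableT_comp.
  - by apply: filterS vw => x vwx _; rewrite ger0_norm.
by apply: integral_ge0 => x _; rewrite lee_fin.
Qed.

Section potential.
Variables (V : 'rV[R]_n -> R) (M : R).
Hypotheses (mV : measurable_fun setT V) (M0 : 0 <= M).
Hypothesis VM : \forall x \ae leb, `|V x| <= M.

Lemma sqi_potential v : sqi v -> sqi (fun x => V x * v x).
Proof.
move=> sv; have [mv _] := sv; have mVv : measurable_fun setT (fun x => V x * v x) by exact: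
  measurable_funM.
split => //; have [mMv] := sqiZ M sv; apply: le_lt_trans.
apply: ae_ge0_le_integral => //.
- by move=> x _; rewrite lee_fin sqr_ge0.
- exact: measurable_sqr.
- by move=> x _; rewrite lee_fin sqr_ge0.
- exact: measurable_sqr.
apply: filterS VM => x Vx _; rewrite lee_fin !exprMn ler_wpM2r ?sqr_ge0//.
by rewrite -real_normK ?num_real// ler_sqr ?nnegrE.
Qed.

Definition pot u : R := ip u (fun x => V x * u x).

Lemma pot_sym u v : ip u (fun x => V x * v x) = ip v (fun x => V x * u x).
Proof. by apply: eq_Rintegral => x _; ring. Qed.

Lemma potZ t u : sqi u -> pot (fun x => t * u x) = t ^+ 2 * pot u.
Proof.
move=> su; have sVu := sqi_potential su.
rewrite /pot (_ : (fun x => V x * _) = (fun x => t * (V x * u x))); last by apply/funext => x; ring.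
by rewrite ipZl ?ipZr//; [rewrite mulrA|exact: sqiZ].
Qed.

Lemma potB u v : sqi u -> sqi v -> pot (fun x => u x - v x) =
  pot u - 2 * ip u (fun x => V x * v x) + pot v.
Proof.
move=> su sv; have sVu := sqi_potential su; have sVv := sqi_potential sv.
rewrite /pot (_ : (fun x => V x * _) = (fun x => V x * u x - V x * v x));
  last by apply/funext => x; ring.
rewrite ipBl ?ipBr//; last exact: sqiB.
by rewrite (pot_sym v u); ring.
Qed.

Lemma pot_ge v (e r : R) : 0 < e -> sqi v ->
  (\forall x \ae leb, ~ cube n r x -> 1 - e <= V x) ->
  (1 - e) * ip v v - (1 + M) * ip (restr (cube n r) v) (restr (cube n r) v) <= pot v.
Proof.
move=> e0 sv Ve; have sVv := sqi_potential sv.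
have mC : measurable (cube n r) by exact: measurable_cube.
have sr := sqi_restr mC sv.
have s1 : sqi (fun x => (1 - e) * v x) by exact: sqiZ.
have s2 : sqi (fun x => (1 + M) * restr (cube n r) v x) by exact: sqiZ.
have s3 : sqi (fun x => V x * v x - (1 - e) * v x) by exact: sqiB.
have s4 : sqi (fun x => V x * v x - (1 - e) * v x + (1 + M) * restr (cube n r) v x) by exact: sqiD.
have : 0 <= ip v (fun x => V x * v x - (1 - e) * v x + (1 + M) * restr (cube n r) v x).
  apply: ip_ae_ge0 => //; move: Ve VM; apply: filterS2 => x Ve Vx.
  have [Cx|Cx] := pselect (cube n r x).
    rewrite restr_in//; have -> : v x * (V x * v x - (1 - e) * v x + (1 + M) * v x) =
      (V x + M + e) * v x ^+ 2 by ring.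
    rewrite mulr_ge0 ?sqr_ge0//; have := ler_norm (- V x); rewrite normrN; lra.
  rewrite restr_out// mulr0 addr0 (_ : _ * _ = (V x - (1 - e)) * v x ^+ 2); last by ring.
  by rewrite mulr_ge0 ?sqr_ge0// subr_ge0; exact: Ve.
rewrite ipDr// ipBr// !ipZr//.
have -> : ip v (restr (cube n r) v) = ip (restr (cube n r) v) (restr (cube n r) v).
  apply: eq_Rintegral => x _; rewrite /restr indicE; case: (_ \in _);
    rewrite ?mul1r// !mul0r mulr0//.
by rewrite /pot; lra.
Qed.

Definition ener u : R := grad2 u + pot u.

Lemma energyE u : H1 u -> energy V u = (ener u)%:E.
Proof.
move=> Hu; have su := H1_sqi Hu; rewrite /energy /ener -integral_weak_grad_sqr//;
  last exact: sqi_potential.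
apply: eq_integral => x _; congr (_ + _)%:E.
by rewrite real_normK ?num_real//; ring.
Qed.

Lemma enerZ t u : H1 u -> ener (fun x => t * u x) = t ^+ 2 * ener u.
Proof. by move=> Hu; rewrite /ener grad2Z// potZ ?mulrDr//; exact: H1_sqi. Qed.

Lemma ener_ge u : H1 u -> - M * ip u u <= ener u.
Proof.
move=> Hu; have su := H1_sqi Hu; have sVu := sqi_potential su.
have sM : sqi (fun x => M * u x) by exact: sqiZ.
have sD : sqi (fun x => M * u x + V x * u x) by exact: sqiD.
have : 0 <= ip u (fun x => M * u x + V x * u x).
  apply: ip_ae_ge0 => //; apply: filterS VM => x Vx.
  rewrite (_ : _ * _ = (M + V x) * u x ^+ 2); last by ring.
  by rewrite mulr_ge0 ?sqr_ge0//; have := ler_norm (- V x); rewrite normrN; lra.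
by rewrite ipDr// ipZr// /ener /pot; have := grad2_ge0 u; lra.
Qed.

End potential.

Lemma Lfun_oo_bound (V : 'rV[R]_n -> R) : V \in Lfun leb +oo%E ->
  measurable_fun setT V /\ exists2 M, 0 <= M & \forall x \ae leb, `|V x| <= M.
Proof.
rewrite inE => /andP[/[!inE]/= mV]; rewrite /finite_norm unlock/= => Voo; split => //.
(* The norm of exponent [+oo] tests whether the whole space has positive measure before taking the
   essential supremum. *)
move: Voo; have -> : (0 < leb [set: 'rV[R]_n])%E.
  apply: (@lt_le_trans _ _ (leb (cube n 1))); last first.
    by apply: le_measure; rewrite ?inE//; exact: measurable_cube.
  have c1 : leb (cube n 1) = ((2 * 1) ^+ n)%:E by apply: lebesgue_cube; exact: ler01.
  by apply: (@lt_le_trans _ _ ((2 * 1) ^+ n)%:E); [rewrite lte_fin exprn_gt0// mulr1|rewrite -c1].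
set y := ess_sup _ _ => yoo.
have H : \forall x \ae leb, (`|V x|%:E <= y)%E by exact: ess_sup_ge.
exists `|fine y| => //; apply: filterS H => x; case: (y) yoo => // r _.
by rewrite lee_fin => /le_trans; apply; exact: ler_norm.
Qed.

(** The Euclidean balls of [ess_liminf_infty] are replaced by cubes: outside [cube n (|r| + 1)] some
    coordinate, hence the Euclidean norm, exceeds [r]. *)
Lemma ess_liminf_bound (V : 'rV[R]_n -> R) (e : R) : (1 <= ess_liminf_infty V)%E -> 0 < e ->
  exists2 r : R, 0 < r & \forall x \ae leb, ~ cube n r x -> 1 - e <= V x.
Proof.
move=> V1 e0; have : ((1 - e)%:E < ess_liminf_infty V)%E.
  by apply: lt_le_trans V1; rewrite lte_fin ltrBlDr ltrDl.
move=> /ereal_sup_gt[_ [r _ <-] rV]; exists (`|r| + 1); first by rewrite ltr_wpDl.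
have := ess_inf_le leb (fun x : 'rV[R]_n => if r < enorm x then (V x)%:E else +oo%E).
apply: filterS => x h Cx; rewrite -lee_fin; apply: (le_trans (ltW rV)).
apply: le_trans h _; rewrite ifT//.
have [i xi] : exists i, `|r| + 1 <= `|x ord0 i|.
  by apply: contrapT => K; apply: Cx; apply/cubeP => i; rewrite ltNge; apply/negP => h;
    apply: K; exists i.
apply: (lt_le_trans _ (enorm_ge x i)); apply: lt_le_trans xi.
by apply: (le_lt_trans (ler_norm r)); rewrite ltrDl.
Qed.

End sobolev.

(** * Weak and local compactness in H^1 *)

Section sobolev_compactness.
Context {R : realType} {n : nat}.
Local Notation leb := (@lebesgue_rV R n).
Local Notation sqi := (sqi leb).
Local Notation ip := (ip leb).
Implicit Types (u v w g h : 'rV[R]_n -> R).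

Lemma grad2B_le u v : H1 u -> H1 v ->
  grad2 (fun x => u x - v x) <= 2 * (grad2 u + grad2 v).
Proof.
move=> Hu Hv; rewrite grad2B//.
have : 0 <= \sum_i ip (fun x => weak_partial i u x + weak_partial i v x)
    (fun x => weak_partial i u x + weak_partial i v x) by apply: sumr_ge0 => i _; exact: ip_ge0.
rewrite (_ : \sum_i _ = grad2 u + 2 * (\sum_i ip (weak_partial i u) (weak_partial i v)) + grad2 v).
  by move: (grad2 u) (grad2 v) (\sum_i _) => a b c; lra.
rewrite /grad2 mulr_sumr -!big_split/=; apply: eq_bigr => i _.
by rewrite ip_sqrD//; exact: sqi_weak_partial.
Qed.

Lemma l2n_weak_partial_le i u : H1 u -> l2n leb (weak_partial i u) <= Num.sqrt (grad2 u).
Proof.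
move=> Hu; rewrite /l2n ler_wsqrtr// /grad2 (bigD1 i)//= lerDl.
by apply: sumr_ge0 => j _; exact: ip_ge0.
Qed.

Definition H1_weak_cvg (U : set_system nat) (u_ : nat -> 'rV[R]_n -> R) u :=
  (forall w, sqi w -> ip (u_ m) w @[m --> U] --> ip u w) /\
  forall i w, sqi w -> ip (weak_partial i (u_ m)) w @[m --> U] --> ip (weak_partial i u) w.

(** The function and its weak derivatives get weak limits separately; the defining identity of a
    weak derivative passes to the limit and ties them together. *)
Lemma H1_weak_compact (U : set_system nat) (u_ : nat -> 'rV[R]_n -> R) (B : R) :
  UltraFilter U -> (forall m, H1 (u_ m)) -> (\forall m \near U, sobolev2 (u_ m) <= B) ->
  exists2 u, H1 u & H1_weak_cvg U u_ u.
Proof.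
move=> UU Hu uB; have su m := H1_sqi (Hu m).
have [|u sqiu cu] := ultra_weak_compact UU su (M := B).
  by apply: filterS uB => m; apply: le_trans; rewrite /sobolev2 lerDr grad2_ge0.
have Hg i : exists g, sqi g /\ forall w, sqi w -> ip (weak_partial i (u_ m)) w @[m --> U] -->
  ip g w.
  have sg m := sqi_weak_partial i (Hu m).
  have [|g sg' cg] := ultra_weak_compact UU sg (M := B); last by exists g.
  apply: filterS uB => m; apply: le_trans; rewrite /sobolev2 /grad2 (bigD1 i)//= -addrA lerDl.
  by rewrite addr_ge0 ?ip_ge0// sumr_ge0// => j _; exact: ip_ge0.
have [g gP] := choice Hg.
have wg i : is_weak_partial i u (g i).
  apply/weak_partialE => f tf; have [sf spf] := test_function_sqi tf; have [_ cg] := gP i.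
  have e1 := cu _ (spf i); have e2 := cvgN (cg _ sf).
  have e3 : ip (u_ m) (partial i f) @[m --> U] --> - ip (g i) f.
    rewrite (_ : (fun m => _) = (fun m => - ip (weak_partial i (u_ m)) f)); first exact: e2.
    by apply/funext => m; have [_ /weak_partialE/(_ f tf)->] := weak_partialP i (Hu m).
  by rewrite -(cvg_lim _ e1)// (cvg_lim _ e3).
have H1u : H1 u by apply: (H1_intro sqiu (g := g)) => // i; have [] := gP i.
exists u => //; split => // i w sw; have [sg cg] := gP i.
rewrite (_ : ip (weak_partial i u) w = ip (g i) w); first exact: cg.
by apply: ae_ip => //; [exact: sqi_weak_partial|exact: weak_partial_ae|exact: ae_eq_refl].
Qed.

Lemma H1_weak_cvg_loc (U : set_system nat) (u_ : nat -> 'rV[R]_n -> R) u (B r : R) :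
  ProperFilter U -> 0 < r -> (forall m, H1 (u_ m)) -> H1 u ->
  (\forall m \near U, sobolev2 (u_ m) <= B) -> H1_weak_cvg U u_ u ->
  ip (restr (cube n r) (fun x => u_ m x - u x)) (restr (cube n r) (fun x => u_ m x - u x))
    @[m --> U] --> (0 : R).
Proof.
move=> UU r0 Hu_ Hu uB [cu _].
have su_ m := H1_sqi (Hu_ m); have su := H1_sqi Hu.
apply: (rellich (v_ := fun m x => u_ m x - u x)
  (g_ := fun m i => weak_partial i (fun x => u_ m x - u x))
  (M := \sum_(i < n) Num.sqrt (2 * (B + grad2 u)))) => //.
- by move=> m; exact: sqiB.
- by move=> m i; apply: weak_partialP; exact: H1B.
- apply: filterS uB => m uB; apply: ler_sum => i _.
  apply: le_trans (l2n_weak_partial_le i (H1B (Hu_ m) Hu)) _; rewrite ler_wsqrtr//.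
  apply: le_trans (grad2B_le (Hu_ m) Hu) _; rewrite ler_pM2l// lerD2r.
  by apply: le_trans uB; rewrite /sobolev2 lerDl ip_ge0.
- move=> w sw; under eq_fun do rewrite ipBl//.
  by rewrite -(subrr (ip u w)); apply: cvgB; [exact: cu|exact: cvg_cst].
Qed.

(** Fatou needs sequences, not filters. The indices [phi j] need not increase; they only make the
    local norms summable, and [P] carries bounds valid along [U] over to the sequence. *)
Lemma local_cvg_ae (U : set_system nat) (u_ : nat -> 'rV[R]_n -> R) u (P : set nat) :
  ProperFilter U -> (forall m, sqi (u_ m)) -> sqi u ->
  (forall r, 0 < r -> ip (restr (cube n r) (fun x => u_ m x - u x))
     (restr (cube n r) (fun x => u_ m x - u x)) @[m --> U] --> (0 : R)) ->
  U P -> exists2 phi : nat -> nat, (forall j, P (phi j)) &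
    \forall x \ae leb, u_ (phi j) x @[j --> \oo] --> u x.
Proof.
move=> UU su_ su loc UP.
pose v m x := u_ m x - u x; have sv m : sqi (v m) by exact: sqiB.
have mC (r : R) : measurable (cube n r) by exact: measurable_cube.
(* A squared norm of at most 4^-j, weighted by 2^j, is summable and leaves a pointwise bound of
   order 2^-j. *)
have /choice[phi phiP] (j : nat) : exists m, P m /\
    2 ^+ j * ip (restr (cube n j.+1%:R) (v m)) (restr (cube n j.+1%:R) (v m)) <= 2^-1 ^+ j.
  have e0 : 0 < 2^-1 ^+ j / 2 ^+ j :> R by rewrite divr_gt0 ?exprn_gt0.
  have := loc j.+1%:R (ltr0Sn _ _) => /cvgrPdist_le/(_ _ e0) H.
  have [m [Pm]] := filter_ex (filterI UP H).
  rewrite /= sub0r normrN => /(le_trans (ler_norm _)) h; exists m; split => //.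
  by rewrite mulrC -ler_pdivlMr ?exprn_gt0.
exists phi; first by move=> j; have [] := phiP j.
pose w j := restr (cube n j.+1%:R) (v (phi j)).
have sw j : sqi (w j) by exact: sqi_restr.
have : \forall x \ae leb, exists C : R, forall j, ((2 ^+ j * w j x ^+ 2)%:E <= C%:E)%E.
  apply: (ae_geo (h_ := fun j x => (2 ^+ j * w j x ^+ 2)%:E)).
  - move=> j; apply/measurable_EFinP; apply: measurable_funM => //; apply: measurable_funX.
    by have [] := sw j.
  - by move=> j x; rewrite lee_fin mulr_ge0 ?sqr_ge0.
  - move=> j; under eq_integral do rewrite EFinM.
    rewrite ge0_integralZl//; last 2 first.
    + by apply: measurable_sqr; have [] := sw j.
    + by move=> x _; rewrite lee_fin sqr_ge0.
    by rewrite sqr_ipE// -EFinM lee_fin; have [] := phiP j.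
apply: filterS => x [C CP]; apply/cvgrPdist_le => e e0.
have C0 : 0 <= C by have := CP 0%N; rewrite lee_fin; apply: le_trans; rewrite mulr_ge0 ?sqr_ge0.
have : C * 2^-1 ^+ j @[j --> \oo] --> C * 0.
  by apply: cvgMl_tmp; apply: cvg_expr; rewrite ger0_norm// invf_lt1// ltr1n.
rewrite mulr0 => /cvgrPdist_le/(_ _ (exprn_gt0 2 e0)); have := cube_cover x.
apply: filterS2 => j xj; rewrite sub0r normrN => /(le_trans (ler_norm _)) h.
have xj1 : cube n (j.+1%:R : R) x by apply: sub_cube xj; rewrite ler_nat.
rewrite distrC -ler_sqr ?nnegrE ?(ltW e0)// real_normK ?num_real//.
apply: le_trans h; have := CP j; rewrite lee_fin /w restr_in// => h.
by rewrite exprVn ler_pdivlMr ?exprn_gt0// mulrC.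
Qed.

End sobolev_compactness.

(** * Minimizing sequences *)

Section concentration.
Context {R : realType} {n : nat}.
Local Notation leb := (@lebesgue_rV R n).
Local Notation sqi := (sqi leb).
Local Notation ip := (ip leb).
Implicit Types (u v w g h : 'rV[R]_n -> R).
Variable k : 'rV[R]_n -> R.
Hypotheses (mk : measurable_fun setT k) (k0 : forall x, 0 <= k x).
Hypothesis kN : forall x, k (- x) = k x.
Hypothesis kint : forall r, 0 < r -> (\int[leb]_x (\1_(cube n r) x * k x)%:E < +oo)%E.
Hypotheses (kpos : forall x, x != 0 -> 0 < k x) (n0 : (0 < n)%N).
Variable p : R.
Hypotheses (p1 : 1 < p) (p2 : p < 2).
Variables (V : 'rV[R]_n -> R) (M : R).
Hypotheses (mV : measurable_fun setT V) (M0 : 0 <= M).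
Hypothesis VM : \forall x \ae leb, `|V x| <= M.
Hypothesis Vinf : forall e : R, 0 < e ->
  exists2 r : R, 0 < r & \forall x \ae leb, ~ cube n r x -> 1 - e <= V x.
Local Notation D := (fun u => bform k p u u).
Local Notation ener := (ener V).
Local Notation loc r v := (ip (restr (cube n r) v) (restr (cube n r) v)).

Let p0 : 0 < p. Proof. exact: lt_trans p1. Qed.

Lemma bform_local_fatou (U : set_system nat) (u_ : nat -> 'rV[R]_n -> R) u (C : \bar R) :
  ProperFilter U -> (forall m, sqi (u_ m)) -> sqi u ->
  (forall r, 0 < r -> loc r (fun x => u_ m x - u x) @[m --> U] --> (0 : R)) ->
  (\forall m \near U, (D (u_ m) <= C)%E) -> (D u <= C)%E.
Proof.
move=> UU su_ su ul uC; have [phi phiC phic] := local_cvg_ae UU su_ su ul uC.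
have [mu _] := su; have mu_ j : measurable_fun setT (u_ (phi j)) by have [] := su_ (phi j).
by apply: (bform_fatou mk k0 p1 mu mu mu_ mu_ phic phic); exact: nearW.
Qed.

Lemma bform_eq0 u : sqi u -> D u = 0%E -> u = (fun=> 0) %[ae leb].
Proof.
move=> [mu _] /(kform_eq0 mk k0 kpos n0 (nn_pw p mu)).
by apply: filterS => x /= /powR_eq0_eq0/eqP; rewrite normr_eq0 => /eqP.
Qed.

Lemma ener_ge_loc (e : R) : 0 < e -> exists2 r, 0 < r & forall v, H1 v ->
  grad2 v + (1 - e) * ip v v - (1 + M) * loc r v <= ener v.
Proof.
move=> e0; have [r r0 Ve] := Vinf e0; exists r => // v Hv.
by have := pot_ge mV M0 VM e0 (H1_sqi Hv) Ve; rewrite /ener; lra.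
Qed.

(** The energy is a quadratic form, so this difference is affine in [u_ m] and weak convergence
    suffices. *)
Lemma ener_split (U : set_system nat) (u_ : nat -> 'rV[R]_n -> R) u :
  ProperFilter U -> (forall m, H1 (u_ m)) -> H1 u -> H1_weak_cvg U u_ u ->
  ener (u_ m) - ener (fun x => u_ m x - u x) @[m --> U] --> ener u.
Proof.
move=> UU Hu_ Hu [cu cg]; have su_ m := H1_sqi (Hu_ m); have su := H1_sqi Hu.
have sVu := sqi_potential mV M0 VM su.
have E m : ener (u_ m) - ener (fun x => u_ m x - u x) =
    2 * (\sum_i ip (weak_partial i (u_ m)) (weak_partial i u) + ip (u_ m) (fun x =>
      V x * u x)) - ener u.
  rewrite /ener grad2B// (potB mV M0 VM)//.
  by move: (grad2 (u_ m)) (grad2 u) (\sum_i _) (pot V (u_ m)) (pot V u) (ip _ _) => *; ring.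
have H : 2 * (\sum_i ip (weak_partial i (u_ m)) (weak_partial i u) +
      ip (u_ m) (fun x => V x * u x)) - ener u @[m --> U] -->
    2 * (\sum_i ip (weak_partial i u) (weak_partial i u) + ip u (fun x => V x * u x)) - ener u.
  apply: cvgB; last exact: cvg_cst.
  apply: cvgMl_tmp; apply: cvgD; last exact: cu.
  apply: cvg_big; first exact: add_continuous.
  by move=> i _; apply: cg; exact: sqi_weak_partial.
rewrite (_ : (fun m => _) = (fun m => 2 * (\sum_i ip (weak_partial i (u_ m)) (weak_partial i u) +
      ip (u_ m) (fun x => V x * u x)) - ener u)); last by apply/funext.
rewrite [X in _ --> X](_ : _ = 2 * (\sum_i ip (weak_partial i u) (weak_partial i u) +
    ip u (fun x => V x * u x)) - ener u)//.
by rewrite /ener /pot /grad2; move: (\sum_i _) (ip _ _) => *; ring.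
Qed.

Lemma ener_eq0 u : H1 u -> u = (fun=> 0) %[ae leb] -> ener u = 0.
Proof.
move=> Hu u0; have su := H1_sqi Hu; have s0 := sqi0 leb; have sVu := sqi_potential mV M0 VM su.
have wp i : weak_partial i u = (fun=> 0) %[ae leb].
  apply: weak_partial_ae => //; apply/weak_partialE => f tf.
  have [sf spf] := test_function_sqi tf.
  rewrite (ae_ip su s0 (spf i) (spf i) u0 (ae_eq_refl _ _ _)).
  by rewrite !(ip_disjoint (v := fun=> 0)) ?oppr0// => x; rewrite mul0r.
rewrite /ener /grad2 /pot (ae_ip su s0 sVu sVu u0 (ae_eq_refl _ _ _)).
rewrite (ip_disjoint (v := fun=> 0)); last by move=> x; rewrite mul0r.
rewrite addr0 big1// => i _; have sw := sqi_weak_partial i Hu.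
rewrite (ae_ip sw s0 sw sw (wp i) (ae_eq_refl _ _ _)).
by rewrite (ip_disjoint (v := fun=> 0))// => x; rewrite mul0r.
Qed.

(* A sequence violating the bound, normalised in H^1, would have a weak limit
   on which the Choquard term vanishes, hence converge locally to 0, and there
   the energy controls the norm. *)
Lemma coercive (K : R) : exists B, forall u, H1 u -> D u = 1%E -> ener u <= K ->
  sobolev2 u <= B.
Proof.
apply: contrapT => /forallNP H.
have /choice[u_ uP] (m : nat) : exists u, [/\ H1 u, D u = 1%E, ener u <= K & m.+1%:R < sobolev2 u].
  have := H m.+1%:R => /existsNP[u /not_implyP[Hu /not_implyP[Du /not_implyP[Ku Bu]]]].
  by exists u; split => //; rewrite ltNge; exact/negP.
pose N m := sobolev2 (u_ m); pose t m := (Num.sqrt (N m))^-1.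
have Nm m : m.+1%:R < N m by have [] := uP m.
have N0 m : 0 < N m by apply: lt_trans (Nm m); rewrite ltr0n.
have t0 m : 0 < t m by rewrite invr_gt0 sqrtr_gt0.
have t2 m : t m ^+ 2 = (N m)^-1 by rewrite exprVn sqr_sqrtr// ltW.
pose w_ m x := t m * u_ m x.
have Hu m : H1 (u_ m) by have [] := uP m.
have Hw m : H1 (w_ m) by exact: H1Z.
have Nw m : sobolev2 (w_ m) = 1.
  rewrite /sobolev2 grad2Z// ip_sqrZ; last exact: H1_sqi.
  by rewrite -mulrDr t2 mulVf// gt_eqF.
have invN m : (N m)^-1 <= m.+1%:R^-1 by rewrite lef_pV2 ?posrE ?ltr0n// ltW.
have Ew m : ener (w_ m) <= `|K| * m.+1%:R^-1.
  rewrite (enerZ mV M0 VM)// t2; have [_ _ uK _] := uP m.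
  apply: (@le_trans _ _ ((N m)^-1 * `|K|)).
    by rewrite ler_pM2l ?invr_gt0// (le_trans uK)// ler_norm.
  by rewrite mulrC ler_wpM2l.
(* By homogeneity the form of [w_ m] is [N m] to the power [- p], at most [(N m)^-1] because
   [N m > 1]. *)
have Dw m : (D (w_ m) <= (m.+1%:R^-1)%:E)%E.
  have [mu _] := H1_sqi (Hu m); have [_ Du _ _] := uP m.
  rewrite /= (bformZ mk k0 kN)// Du mule1 lee_fin gtr0_norm//.
  rewrite -powR_mulrn ?powR_ge0// -powRrM mulrC powRrM powR_mulrn ?(ltW (t0 m))// t2.
  apply: le_trans (invN m); apply: ge1r_powR; last exact: ltW.
  by rewrite invr_gt0 N0/= invf_le1// ltW// (le_lt_trans _ (Nm m))// ler1n.
have [U [UU Uoo]] := ultraFilterLemma (@eventually_filter).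
have Uinv (d : R) : 0 < d -> \forall m \near U, m.+1%:R^-1 <= d.
  by move=> d0; apply: Uoo; near=> m; apply: ltW; near: m; exact: near_infty_natSinv_lt (PosNum d0).
have wB : \forall m \near U, sobolev2 (w_ m) <= 1 by apply: nearW => m; rewrite Nw.
have [w H1w cw] := H1_weak_compact UU Hw wB.
have sw_ m := H1_sqi (Hw m); have sw := H1_sqi H1w.
have wl r : 0 < r -> loc r (fun x => w_ m x - w x) @[m --> U] --> (0 : R).
  by move=> r0; exact: (H1_weak_cvg_loc _ r0 Hw H1w wB cw).
have Dw0 : D w = 0%E.
  have [mw _] := sw; apply/eqP; rewrite eq_le bform_ge0// andbT.
  apply/lee_addgt0Pr => d d0; rewrite add0e.
  apply: (bform_local_fatou _ sw_ sw wl); apply: filterS (Uinv d d0) => m md.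
  by apply: le_trans (Dw m) _; rewrite lee_fin.
have w0 := bform_eq0 sw Dw0.
have e0 : 0 < 2^-1 :> R by [].
have [r r0 rE] := ener_ge_loc e0.
have mC : measurable (cube n r) by exact: measurable_cube.
have lE m : loc r (fun x => w_ m x - w x) = loc r (w_ m).
  have s1 := sqi_restr mC (sqiB (sw_ m) sw); have s2 := sqi_restr mC (sw_ m).
  by apply: ae_ip => //; apply: filterS w0 => x /= /(_ Logic.I) wx _; rewrite /restr wx subr0.
(* For [m] late enough, [grad2 (w_ m) + ip (w_ m) (w_ m) / 2] is at most
   [(|K| + 1 + M) * d = 1 / 8], whereas [sobolev2 (w_ m) = 1] forces it to be at least 1 / 2. *)
pose d : R := (8 * (`|K| + M + 1))^-1.
have KM : 0 < `|K| + M + 1 by rewrite ltr_wpDl// addr_ge0.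
have d0 : 0 < d by rewrite invr_gt0 mulr_gt0.
have dE : d * (`|K| + M + 1) = 8^-1 by rewrite /d; field; rewrite gt_eqF.
have /cvgrPdist_le/(_ _ d0) := wl r r0.
move=> H1; have [m [h1 h2]] := filter_ex (filterI H1 (Uinv d d0)).
move: h1; rewrite /= sub0r normrN lE => /(le_trans (ler_norm _)) h1.
have := rE _ (Hw m); have := Ew m; have := Nw m; have := grad2_ge0 (w_ m).
rewrite /sobolev2.
have : `|K| * m.+1%:R^-1 <= `|K| * d by rewrite ler_wpM2l.
have : (1 + M) * loc r (w_ m) <= (1 + M) * d by rewrite ler_wpM2l// addr_ge0.
move: dE; set a := loc _ _; set b := m.+1%:R^-1; lra.
Unshelve. all: by end_near. Qed.

Variable cst : R.
Hypothesis cstP : forall u, H1 u -> D u = 1%E -> cst <= ener u.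
(** A real number above [cst] stands in for [c_infty], which may be infinite; for [cst >= 0] it is
    positive, as [hls] requires. *)
Hypothesis gap : 0 <= cst ->
  exists2 c, cst < c & forall u, sqi u -> D u = 1%E -> c <= ip u u.

(** The form has degree [2 * p] and the energy degree 2, so normalising by [t] divides the energy by
    l^(1/p). *)
Lemma ener_homogeneous u (l : R) : H1 u -> D u = l%:E -> 0 < l -> cst * l `^ p^-1 <= ener u.
Proof.
move=> Hu Du l0; have [mu _] := H1_sqi Hu.
pose t := l `^ (- (2 * p)^-1).
have t0 : 0 < t by exact: powR_gt0.
have t2 : t ^+ 2 = (l `^ p^-1)^-1.
  rewrite /t -powR_mulrn ?powR_ge0// -powRrM -powRN; congr (_ `^ _).
  by field; rewrite gt_eqF.
have : D (fun x => t * u x) = 1%E.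
  rewrite /= (bformZ mk k0 kN)// Du -EFinM; congr EFin; rewrite gtr0_norm//.
  rewrite expr2 -powRM ?(ltW t0)// -expr2 t2 -powR_inv1 ?powR_ge0// -!powRrM.
  rewrite (_ : p^-1 * (-1 * p) = -1); last by field; rewrite gt_eqF.
  by rewrite powR_inv1 ?ltW// mulVf// gt_eqF.
move=> /(cstP (H1Z t Hu)); rewrite (enerZ mV M0 VM)// t2.
by rewrite mulrC ler_pdivlMr ?powR_gt0.
Qed.

Lemma minimizing_ultra (U : set_system nat) (u_ : nat -> 'rV[R]_n -> R) :
  UltraFilter U -> (forall m, H1 (u_ m)) -> (forall m, D (u_ m) = 1%E) ->
  ener (u_ m) @[m --> U] --> cst ->
  exists u, [/\ H1 u, D u = 1%E, ener u = cst &
    sobolev2 (fun x => u_ m x - u x) @[m --> U] --> (0 : R)].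
Proof.
move=> UU Hu_ Du_ Eu.
have [B BP] := coercive (cst + 1).
have uB : \forall m \near U, sobolev2 (u_ m) <= B.
  have /cvgrPdist_le/(_ _ ltr01) := Eu; apply: filterS => m h.
  by apply: BP => //; move: h; rewrite ler_norml => /andP[]; lra.
have [u Hu cu] := H1_weak_compact UU Hu_ uB; exists u.
have su_ m := H1_sqi (Hu_ m); have su := H1_sqi Hu; have [mu _] := su.
pose v m x := u_ m x - u x.
have Hv m : H1 (v m) by exact: H1B.
have sv m : sqi (v m) by exact: sqiB.
have vl r : 0 < r -> loc r (v m) @[m --> U] --> (0 : R).
  by move=> r0; exact: (H1_weak_cvg_loc _ r0 Hu_ Hu uB cu).
have ev : ener (v m) @[m --> U] --> cst - ener u.
  have -> : (fun m => ener (v m)) = (fun m => ener (u_ m) - (ener (u_ m) - ener (v m))).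
    by apply/funext => m; ring.
  by apply: cvgB => //; exact: ener_split.
have vB : \forall m \near U, ip (v m) (v m) <= 2 * (B + ip u u).
  apply: filterS uB => m; rewrite /sobolev2 => h.
  rewrite /v ip_sqrB//; have := ip_ge0 leb (fun x => u_ m x + u x).
  by rewrite ip_sqrD//; have := grad2_ge0 (u_ m); lra.
have : cvg (ip (v m) (v m) @[m --> U]).
  apply: (ultra_bounded_cvg (M := 2 * (B + ip u u))) => //.
  by apply: filterS vB => m; rewrite ger0_norm ?ip_ge0.
set a := lim _ => va.
have a0 : 0 <= a by apply: limr_ge => //; apply: nearW => m; exact: ip_ge0.
have Dule : (D u <= 1)%E.
  by apply: (bform_local_fatou _ su_ su vl); apply: nearW => m; rewrite Du_.
have Dfin : D u \is a fin_num by rewrite ge0_fin_numE ?bform_ge0//;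
  apply: le_lt_trans Dule (ltry _).
pose l := fine (D u); have Dl : D u = l%:E by rewrite fineK.
have l0 : 0 <= l by rewrite -lee_fin -Dl bform_ge0.
have l1 : l <= 1 by rewrite -lee_fin -Dl.
(* Local terms vanish in the limit, so for every [e] the energy left to [v] is at least
   [(1 - e) * a]; then [e] tends to 0. *)
have ea : a <= cst - ener u.
  have low e : 0 < e -> (1 - e) * a <= cst - ener u.
    move=> e0; have [r r0 rE] := ener_ge_loc e0.
    have c1 : ener (v m) - ((1 - e) * ip (v m) (v m) - (1 + M) * loc r (v m)) @[m --> U] -->
        cst - ener u - ((1 - e) * a - (1 + M) * 0).
      apply: cvgB => //; apply: cvgB; first exact: cvgMl_tmp.
      by apply: cvgMl_tmp; exact: vl.
    rewrite -subr_ge0; have : 0 <= cst - ener u - ((1 - e) * a - (1 + M) * 0).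
      rewrite -(cvg_lim _ c1)//; apply: limr_ge; first exact: cvgP c1.
      by apply: nearW => m; have := rE _ (Hv m); have := grad2_ge0 (v m); lra.
    by rewrite mulr0 subr0.
  apply/ler_addgt0Pr => e e0; have a1 : 0 < a + 1 by lra.
  have := low (e / (a + 1)) (divr_gt0 e0 a1).
  have : e / (a + 1) * (a + 1) = e by rewrite divfK// gt_eqF.
  have : 0 < e / (a + 1) by rewrite divr_gt0.
  by move: (e / (a + 1)) => d; nra.
have hom : cst * l `^ p^-1 <= ener u.
  move: l0; rewrite le_eqVlt => /predU1P[l0|l0]; last exact: ener_homogeneous.
  rewrite -l0 powR0 ?mulr0; last by rewrite invr_eq0 gt_eqF.
  by rewrite (ener_eq0 Hu)//; apply: bform_eq0 => //; rewrite Dl -l0.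
have s0 : 0 <= l `^ p^-1 by exact: powR_ge0.
have sp : (l `^ p^-1) `^ p = l by rewrite -powRrM mulVf ?gt_eqF// powRr1.
have le1 (x : R) : 0 <= x -> 1 <= x `^ p -> 1 <= x.
  move=> x0; rewrite leNgt => h; rewrite leNgt; apply/negP => x1; move/negP : h; apply.
  by have := gt0_ltr_powR p0 _ _ x1; rewrite !nnegrE powR1 x0 ler01 => /(_ isT isT).
have pw_le_id (x : R) : 0 <= x -> x <= 1 -> x `^ p <= x.
  rewrite le_eqVlt => /predU1P[<- _|x0 x1]; first by rewrite powR0// gt_eqF.
  by apply: ge1r_powR; [rewrite x0|exact: ltW].
have l1' : l = 1.
  apply/eqP; rewrite eq_le l1/=; set s := l `^ p^-1 in hom s0 sp.
  have s1 : s <= 1.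
    rewrite leNgt; apply/negP => s1; have := gt0_ltr_powR p0 _ _ s1.
    rewrite !nnegrE ler01 (le_trans ler01 (ltW s1)) powR1 sp => /(_ isT isT); lra.
  suff s1' : 1 <= s.
    have sE : s = 1 by apply/eqP; rewrite eq_le s1 s1'.
    by rewrite -sp sE powR1.
  (* For [cst < 0], [cst * s <= ener u <= cst] already gives [1 <= s]. *)
  have [cst0|cst0] := ltP cst 0; first by nra.
  have [c cc cP] := gap cst0; have c0 : 0 < c by lra.
  have ac0 : 0 <= a / c by rewrite divr_ge0// ltW.
  have split e : 0 < e -> 1 <= (1 + e) * (l + (a / c) `^ p) + e.
    move=> e0.
    have FU : Filter U by exact _.
    have := choquard_split mk k0 kN kint p1 p2 c0 cP FU su sv e0 vB vl.
    have c1 : (1 + e) * (l + (ip (v m) (v m) / c) `^ p) + e @[m --> U] -->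
        (1 + e) * (l + (a / c) `^ p) + e.
      apply: cvgD; last exact: cvg_cst.
      apply: cvgMl_tmp; apply: cvgD; first exact: cvg_cst.
      apply: powR_cvg => //; first by move=> m; rewrite divr_ge0 ?ip_ge0// ltW.
      exact: cvgMr_tmp.
    move=> H; rewrite -(cvg_lim _ c1)//; apply: limr_ge; first exact: cvgP c1.
    apply: filterS H => m.
    have -> : (fun x => u x + v m x) = u_ m by apply/funext => x; rewrite /v; ring.
    by rewrite Du_ Dl => h; rewrite -lee_fin; exact: h.
  have h1 : 1 <= l + (a / c) `^ p.
    set b := (a / c) `^ p in split *; have b0 : 0 <= b by exact: powR_ge0.
    apply/ler_addgt0Pr => e e0; have lb : 0 < l + b + 1 by lra.
    have := split (e / (l + b + 1)) (divr_gt0 e0 lb).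
    have : e / (l + b + 1) * (l + b + 1) = e by rewrite divfK// gt_eqF.
    by move: (e / (l + b + 1)) => d; nra.
  have ale : a <= cst * (1 - s) by lra.
  have ac1 : a / c <= 1 by rewrite ler_pdivrMr// mul1r; nra.
  (* Both bases are in [0, 1], so dropping the exponent [p > 1] only increases them. With
     [a <= cst * (1 - s)] this gives [c * (1 - s) <= cst * (1 - s)], hence [s >= 1]. *)
  have h2 : 1 <= s + a / c.
    apply: (le_trans h1); apply: lerD; first by rewrite -sp; exact: pw_le_id.
    exact: pw_le_id.
  have : a / c * c = a by rewrite divfK// gt_eqF.
  by move: (a / c) h2 => b; nra.
have ec : ener u = cst.
  apply/eqP; rewrite eq_le; apply/andP; split; first by lra.
  by apply: cstP => //; rewrite Dl l1'.
split => //; first by rewrite Dl l1'.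
have e0 : 0 < 2^-1 :> R by [].
have [r r0 rE] := ener_ge_loc e0.
(* The lower bound with [e = 1 / 2] controls half of [sobolev2 (v m)], whence the factor 2. *)
have c1 : 2 * (ener (v m) + (1 + M) * loc r (v m)) @[m --> U] --> 2 * (cst - ener u + (1 + M) * 0).
  by apply: cvgMl_tmp; apply: cvgD => //; apply: cvgMl_tmp; exact: vl.
rewrite ec subrr mulr0 addr0 mulr0 in c1.
apply: (squeeze_cvgr _ (cvg_cst 0) c1); apply: nearW => m; rewrite sobolev2_ge0/=.
have := rE _ (Hv m); have := grad2_ge0 (v m); rewrite /sobolev2 -/(v m).
by move: (grad2 _) (ip _ _) (loc _ _) (ener _) => *; lra.
Qed.

End concentration.

(** * The case of the Riesz kernel *)

Section choquard_energy.
Context {R : realType} {n : nat}.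
Local Notation leb := (@lebesgue_rV R n).
Local Notation sqi := (sqi leb).
Local Notation ip := (ip leb).
Variable alpha : R.
Hypotheses (alpha0 : 0 < alpha) (alphan : alpha < n%:R).
Implicit Types u : 'rV[R]_n -> R.
Local Notation kern := (@riesz R n alpha).
Local Notation p := (alpha / n%:R + 1).
Local Notation D := (fun u => bform kern p u u).

Let n0 : (0 : R) < n%:R. Proof. exact: lt_trans alphan. Qed.

Lemma choquard_exponent : 1 < p < 2.
Proof.
rewrite ltrDr divr_gt0//= -[ltRHS]/(1 + 1) ltrD2r ltr_pdivrMr// mul1r; exact: alphan.
Qed.

Lemma choquardE u : measurable_fun setT u -> choquard alpha u = D u.
Proof.
move=> mu; have npu := nn_pw p mu; have [mpu pu0] := npu.
rewrite /choquard /bform /kform; apply: eq_integral => x _; rewrite /convolution.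
rewrite -ge0_integralZr//; last 2 first.
- have := measurable_kinner (measurable_riesz alpha) (fun=> 1) x mpu.
  by under eq_fun do rewrite mulr1.
- by move=> y _; rewrite lee_fin mulr_ge0 ?riesz_ge0// pu0.
by apply: eq_integral => y _; rewrite -EFinM -mulrA.
Qed.

(** Were the constant 0, the kernel and with it the Choquard term would vanish identically. *)
Lemma riesz_const_gt0 u : choquard alpha u = 1%E -> 0 < @riesz_const R n alpha.
Proof.
move=> Du; rewrite lt_neqAle riesz_const_ge0 andbT; apply/eqP => c0.
move: Du; rewrite /choquard integral0_eq; first by move=> /eqP; rewrite eqe eq_sym oner_eq0.
move=> x _; rewrite /convolution integral0_eq ?mul0e// => y _.
by rewrite rieszE -c0 !mul0r.
Qed.

Variable V : 'rV[R]_n -> R.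
Hypotheses (hV : V \in Lfun leb +oo%E) (hliminf : (1 <= ess_liminf_infty V)%E).
Hypothesis hc : (c_star alpha V < c_infty n alpha)%E.

Let mV : measurable_fun setT V. Proof. by have [] := Lfun_oo_bound hV. Qed.

Lemma admissibleE u : admissible alpha u <-> H1 u /\ D u = 1%E.
Proof.
by split=> -[Hu Du]; split => //; have [mu _] := H1_sqi Hu; move: Du; rewrite choquardE.
Qed.

(** The strict inequality between the infima forces an admissible function to exist, since the
    infimum of the empty set is [+oo]; that function makes the constant of the kernel positive. *)
Lemma riesz_pos x : x != 0 -> 0 < kern x.
Proof.
apply: riesz_gt0; have [[u [_ Du]]|H] := pselect (exists u, admissible alpha u).
  exact: riesz_const_gt0 Du.
exfalso; move: hc; rewrite /c_star (_ : [set _ | _ in _] = set0) ?ereal_inf0 ?ltNge ?leey//.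
by apply/seteqP; split => // y -[u Hu _]; apply: H; exists u.
Qed.

Let n0' : (0 < n)%N. Proof. by rewrite -(ltr0n R). Qed.

(** Only admissible functions of negative energy matter for the lower bound. By [coercive] with
    [K = 0] their norms are bounded, and [ener_ge] bounds their energies from below. *)
Lemma c_star_fin : exists cst : R, c_star alpha V = cst%:E.
Proof.
have [_ [M M0 VM]] := Lfun_oo_bound hV; have [p1 p2] := andP choquard_exponent.
have Vinf e : 0 < e -> exists2 r : R, 0 < r & \forall x \ae leb, ~ cube n r x -> 1 - e <= V x.
  exact: ess_liminf_bound.
have [B BP] := coercive (measurable_riesz alpha) (riesz_ge0 alpha) (rieszN alpha)
  riesz_pos n0' p1 mV M0 VM Vinf 0.
have lb : ((- (M * `|B|))%:E <= c_star alpha V)%E.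
  apply: le_ereal_inf_tmp => _ [u /admissibleE[Hu Du] <-].
  rewrite (energyE mV M0 VM)// lee_fin.
  have MB : 0 <= M * `|B| by rewrite mulr_ge0.
  have [E0|E0] := leP 0 (ener V u); first by rewrite (le_trans _ E0)// oppr_le0.
  apply: le_trans (ener_ge mV M0 VM Hu).
  rewrite mulNr lerN2 ler_wpM2l// (le_trans _ (ler_norm B))//.
  apply: le_trans (BP u Hu Du (ltW E0)).
  by rewrite /sobolev2 lerDr grad2_ge0.
exists (fine (c_star alpha V)); rewrite fineK// fin_numE.
apply/andP; split; first by rewrite gt_eqF// (lt_le_trans _ lb)// ltNyr.
by rewrite lt_eqF// (lt_le_trans hc)// leey.
Qed.

Lemma minimizing_subsequence (u_ : nat -> 'rV[R]_n -> R) : minimizing_sequence alpha V u_ ->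
  exists phi : nat -> nat, {homo phi : i j / (i < j)%N} /\
  exists2 u, admissible alpha u /\ energy V u = c_star alpha V &
    H1norm (u_ (phi k) \- u) @[k --> \oo] --> 0%E.
Proof.
move=> [adm Eu]; have [cst cE] := c_star_fin; rewrite cE in Eu *.
have [_ [M M0 VM]] := Lfun_oo_bound hV; have [p1 p2] := andP choquard_exponent.
have Vinf e : 0 < e -> exists2 r : R, 0 < r & \forall x \ae leb, ~ cube n r x -> 1 - e <= V x.
  exact: ess_liminf_bound.
have cstP u : H1 u -> D u = 1%E -> cst <= ener V u.
  move=> Hu Du; rewrite -lee_fin -cE -(energyE mV M0 VM Hu).
  by apply: ereal_inf_lbound; exists u => //; exact/admissibleE.
have gap : 0 <= cst -> exists2 c, cst < c & forall u, sqi u -> D u = 1%E -> c <= ip u u.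
  move=> _; have H u : sqi u -> D u = 1%E -> (c_infty n alpha <= (ip u u)%:E)%E.
    move=> su Du; apply: ereal_inf_lbound; exists u.
      by split; [exact/Lfun2P|rewrite choquardE//; have [] := su].
    by rewrite -sqr_ipE//; apply: eq_integral => x _; rewrite real_normK ?num_real.
  (* If [c_infty] is [+oo], no function satisfies the constraint, and any number above [cst] will
     do. *)
  move: hc H; rewrite cE; case: (c_infty n alpha) => [c| |] // cc H.
    by exists c => // u su Du; rewrite -lee_fin; exact: H.
  by exists (cst + 1); [rewrite ltrDl|move=> u su Du; have := H u su Du].
have Hu_ m : H1 (u_ m) by have /admissibleE[] := adm m.
have Du_ m : D (u_ m) = 1%E by have /admissibleE[] := adm m.
have [U [UU Uoo]] := ultraFilterLemma (@eventually_filter).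
have EU : ener V (u_ m) @[m --> U] --> cst.
  have E : ener V (u_ m) @[m --> \oo] --> cst.
    have /fine_cvg : (ener V (u_ m))%:E @[m --> \oo] --> cst%:E.
      by move: Eu; under eq_fun do rewrite (energyE mV M0 VM (Hu_ _)).
    by apply.
  by move=> A /E; exact: Uoo.
have kint (r : R) : 0 < r -> (\int[leb]_x (\1_(cube n r) x * kern x)%:E < +oo)%E.
  exact: riesz_locally_integrable.
have [u [Hu Du Eu' su]] := minimizing_ultra (measurable_riesz alpha) (riesz_ge0 alpha)
  (rieszN alpha) kint riesz_pos n0' p1 p2 mV M0 VM Vinf cstP gap UU Hu_ Du_ EU.
(* The ultrafilter contains all sets of large indices, so each of its sets has elements beyond any
   given index. This turns the limit along [U] into a strictly increasing choice of indices. *)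
have /choice[f fP] (q : nat * nat) : exists m, (q.1 < m)%N /\
    sobolev2 (fun x => u_ m x - u x) <= q.2.+1%:R^-1.
  have e0 : 0 < q.2.+1%:R^-1 :> R by rewrite invr_gt0 ltr0n.
  have /cvgrPdist_le/(_ _ e0) H := su.
  have H' : \forall m \near U, (q.1 < m)%N by apply: Uoo; exists q.1.+1.
  have [m [h1 h2]] := filter_ex (filterI H' H); exists m; split => //.
  by move: h2; rewrite /= sub0r normrN; apply: le_trans; exact: ler_norm.
pose phi := fix phi k := if k is j.+1 then f (phi j, k) else f (0%N, 0%N).
have phiP k : sobolev2 (fun x => u_ (phi k) x - u x) <= k.+1%:R^-1.
  by case: k => [|k]; [have [] := fP (0%N, 0%N)|have [] := fP (phi k, k.+1)].
exists phi; split.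
  apply: homo_ltn; first by move=> ? ? ?; exact: ltn_trans.
  by move=> k; have [] := fP (phi k, k.+1).
exists u; first by split; [exact/admissibleE|rewrite (energyE mV M0 VM)// Eu'].
have sc : sobolev2 (fun x => u_ (phi k) x - u x) @[k --> \oo] --> (0 : R).
  apply: (squeeze_cvgr _ (cvg_cst 0) (@cvg_harmonic R)).
  by apply: nearW => k; rewrite sobolev2_ge0/=; exact: phiP.
rewrite (_ : (fun k => H1norm _) = (fun k => (Num.sqrt (sobolev2 (fun x =>
  u_ (phi k) x - u x)))%:E)); last first.
  by apply/funext => k; exact: (H1normE (H1B (Hu_ _) Hu)).
apply: cvg_EFin; first exact: nearW.
rewrite -[X in _ --> X](@sqrtr0 R).
by apply: (@cvg_comp _ _ _ _ Num.sqrt) sc _; exact: sqrt_continuous.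
Qed.

Lemma exists_minimizing_sequence : exists u_ : nat -> 'rV[R]_n -> R, minimizing_sequence alpha V u_.
Proof.
have [cst cE] := c_star_fin.
have [_ [M M0 VM]] := Lfun_oo_bound hV.
have /choice[u_ uP] (m : nat) : exists u, admissible alpha u /\
    (c_star alpha V <= energy V u <= (cst + m.+1%:R^-1)%:E)%E.
  have e0 : 0 < m.+1%:R^-1 :> R by rewrite invr_gt0 ltr0n.
  have cf : c_star alpha V \is a fin_num by rewrite cE.
  have [_ [u au <-] h] := lb_ereal_inf_adherent e0 cf; exists u; split => //.
  apply/andP; split; first by apply: ereal_inf_lbound; exists u.
  by apply: ltW; rewrite EFinD -cE.
exists u_; split; first by move=> m; have [] := uP m.
rewrite cE; apply: (squeeze_cvge _ (cvg_cst cst%:E) (h := fun m => (cst + m.+1%:R^-1)%:E)).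
  by apply: nearW => m; have [_] := uP m; rewrite cE.
apply: cvg_EFin; first exact: nearW.
rewrite -[X in _ --> X]addr0; apply: cvgD; first exact: cvg_cst.
exact: (@cvg_harmonic R).
Qed.

End choquard_energy.

Theorem theorem3 (R : realType) (N : nat) (alpha : R) (V : 'rV[R]_N -> R)
    (hN : (1 <= N)%N) (halpha : 0 < alpha < N%:R)
    (hV : V \in Lfun (lebesgue_rV N) +oo%E)
    (hliminf : (1 <= ess_liminf_infty V)%E)
    (hc : (c_star alpha V < c_infty N alpha)%E) :
  c_star_achieved alpha V /\
  forall u_ : nat -> 'rV[R]_N -> R, minimizing_sequence alpha V u_ ->
    exists phi : nat -> nat, {homo phi : i j / (i < j)%N} /\
    exists2 u : 'rV[R]_N -> R, H1 u &
      H1norm (u_ (phi k) \- u) @[k --> \oo] --> 0%E.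
Proof.
have [alpha0 alphaN] := andP halpha.
have sub := minimizing_subsequence alpha0 alphaN hV hliminf hc.
split=> [|u_ /sub[phi [phi_incr [u [[Hu _] _] cu]]]].
  have [u_ /sub[phi [_ [u [au Eu] _]]]] :=
    exists_minimizing_sequence alpha0 alphaN hV hliminf hc.
  by exists u.
by exists phi; split => //; exists u.
Qed.
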